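(* Let $X$ be a compact connected Kähler manifold with $c_1(TX)=0$, equipped with a Ricci-flat Kähler form $\omega$. Let $(E,\theta)$ be a polystable Higgs vector bundle on $X$, and let $h$ be a Hermitian structure on $E$ that satisfies the Yang-Mills-Higgs equation for $(E,\theta)$. Then $h$ also satisfies the Yang-Mills-Higgs equation for the Higgs vector bundle $(E,0)$.
   Context: Let $d=\dim_{\mathbb C}X$, let $\Omega_X$ be the holomorphic cotangent bundle of $X$, and let $\widetilde\omega\in H^2(X,\mathbb R)$ be the class of $\omega$. The degree of a torsionfree coherent analytic sheaf $F$ on $X$ is $\mathrm{degree}(F)=(c_1(F)\cup\widetilde\omega^{d-1})\cap[X]\in\mathbb R$. A Higgs field on a holomorphic vector bundle $E$ is a holomorphic section $\theta$ of $\mathrm{End}(E)\otimes\Omega_X$ with $\theta\wedge\theta=0$ (i.e. its components in local coordinates commute); the pair $(E,\theta)$ is a Higgs vector bundle. $(E,\theta)$ is stable (resp. semistable) if for all coherent analytic subsheaves $F\subset E$ with $0<\mathrm{rank}(F)<\mathrm{rank}(E)$ and $\theta(F)\subseteq F\otimes\Omega_X$ one has $\mathrm{degree}(F)/\mathrm{rank}(F)<\mathrm{degree}(E)/\mathrm{rank}(E)$ (resp. $\le$). A semistable Higgs vector bundle is polystable if it is a direct sum of stable Higgs vector bundles. Let $\Lambda_\omega$ be the adjoint of multiplication of differential forms by $\omega$. A Hermitian structure $h$ on $E$ satisfies the Yang-Mills-Higgs equation for $(E,\theta)$ if $\Lambda_\omega(\mathcal K_h+\theta\wedge\theta^* )=c\sqrt{-1}\cdot\mathrm{Id}_E$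 for some constant $c\in\mathbb R$, where $\mathcal K_h$ is the curvature of the Chern connection of $(E,h)$ and $\theta^*$ is the adjoint of $\theta$ with respect to $h$, an $\mathrm{End}(E)$-valued $(0,1)$-form. Here $\theta\wedge\theta^*$ is the $\mathrm{End}(E)$-valued $(1,1)$-form obtained by combining the wedge product of forms with the Lie bracket of $\mathrm{End}(E)$: if locally $\theta=\sum_j A_j\,dz_j$, then $\theta^*=\sum_k A_k^*\,d\bar z_k$ and $\theta\wedge\theta^*=\sum_{j,k}[A_j,A_k^*]\,dz_j\wedge d\bar z_k$. *)

(* Defs.v *)
From HB Require Import structures.
From mathcomp Require Import all_boot all_order all_algebra.
From mathcomp Require Import perm complex.
From mathcomp Require Import all_classical all_reals all_analysis.
Set Implicit Arguments.
Unset Strict Implicit.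
Unset Printing Implicit Defensive.
Import Order.TTheory GRing.Theory Num.Theory.
Import numFieldNormedType.Exports.
Local Open Scope classical_set_scope.
Local Open Scope ring_scope.
Local Open Scope complex_scope.
Local Open Scope sesquilinear_scope.

(* C^d is modelled by its underlying real normed space: (x, y) : cspace R d is
   the point whose j-th complex coordinate is x_j + i y_j. *)
Definition cspace (R : realType) (d : nat) : normedModType R :=
  ('rV[R]_d * 'rV[R]_d)%type.

Section LocalCalculus.
Context {R : realType} {d : nat}.
Local Notation C := R[i].
Local Notation V := (cspace R d).

Definition ccoord (j : 'I_d) (z : V) : C := z.1 0 j +i* z.2 0 j.

Fixpoint Ck (k : nat) (U : set V) (f : V -> R) : Prop :=
  (forall z, U z -> {for z, continuous f}) /\
  (if k is k'.+1 then
     forall v : V, (forall z, U z -> derivable f z v) /\ Ck k' U ('D_v f)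
   else True).

Definition smooth (U : set V) (f : V -> C) : Prop :=
  forall k, Ck k U (fun z => complex.Re (f z)) /\
            Ck k U (fun z => complex.Im (f z)).

Definition cderive (v : V) (f : V -> C) (z : V) : C :=
  'D_v (fun w => complex.Re (f w)) z +i* 'D_v (fun w => complex.Im (f w)) z.

Definition dir_re (j : 'I_d) : V := (delta_mx 0 j, 0).
Definition dir_im (j : 'I_d) : V := (0, delta_mx 0 j).

(* The Wirtinger operators d/dz_j and d/d\bar z_j. *)
Definition wirt (j : 'I_d) (f : V -> C) (z : V) : C :=
  (cderive (dir_re j) f z - 'i%C * cderive (dir_im j) f z) / 2.
Definition wirtbar (j : 'I_d) (f : V -> C) (z : V) : C :=
  (cderive (dir_re j) f z + 'i%C * cderive (dir_im j) f z) / 2.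

Definition holomorphic (U : set V) (f : V -> C) : Prop :=
  smooth U f /\ forall z, U z -> forall j, wirtbar j f z = 0.

End LocalCalculus.

(* Lebesgue integral over R^n, as an iterated integral (only applied to
   continuous functions with compact support). *)
Fixpoint iintegral (R : realType) (n : nat) : ('rV[R]_n -> R) -> R :=
  if n is n'.+1 then
    fun f : 'rV[R]_(1 + n') -> R =>
      Rintegral lebesgue_measure [set: R]
        (fun x => iintegral (fun w : 'rV[R]_n' => f (row_mx x%:M w)))
  else fun f => f 0.

Definition cintegral (R : realType) (d : nat) (f : cspace R d -> R) : R :=
  iintegral (fun x => iintegral (fun y => f (x, y))).

Record complexManifold (R : realType) (d : nat) := ComplexManifold {
  carrier :> topologicalType;
  carrier_hausdorff : hausdorff_space carrier;
  carrier_second_countable : @second_countable carrier;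
  chart : Type;
  cdom : chart -> set carrier;
  cmap : chart -> carrier -> cspace R d;
  cinv : chart -> cspace R d -> carrier;
  cdom_open : forall i, open (cdom i);
  cdom_cover : forall x, exists i, cdom i x;
  cimg_open : forall i, open (cmap i @` cdom i);
  cmapK : forall i, {in cdom i, cancel (cmap i) (cinv i)};
  cmap_continuous : forall i x, cdom i x -> {for x, continuous (cmap i)};
  cinv_continuous : forall i z, (cmap i @` cdom i) z ->
    {for z, continuous (cinv i)};
  transition_holomorphic : forall i i' (j : 'I_d),
    holomorphic (cmap i @` (cdom i `&` cdom i'))
      (fun z => ccoord j (cmap i' (cinv i z)))
}.

Section Manifold.
Context {R : realType} {d : nat} (X : complexManifold R d).
Local Notation C := R[i].

Definition smooth_on (U : set X) (f : X -> C) : Prop :=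
  forall i : chart X, smooth (cmap i @` (cdom i `&` U)) (f \o cinv i).

Definition holomorphic_on (U : set X) (f : X -> C) : Prop :=
  forall i : chart X, holomorphic (cmap i @` (cdom i `&` U)) (f \o cinv i).

(* d/dz_j and d/d\bar z_j with respect to the coordinates of the chart i;
   meaningful on cdom i only. *)
Definition dz (i : chart X) (j : 'I_d) (f : X -> C) (x : X) : C :=
  wirt j (f \o cinv i) (cmap i x).
Definition dzbar (i : chart X) (j : 'I_d) (f : X -> C) (x : X) : C :=
  wirtbar j (f \o cinv i) (cmap i x).

Definition dzM m n (i : chart X) (j : 'I_d) (A : X -> 'M[C]_(m, n)) (x : X) :
  'M[C]_(m, n) := \matrix_(p, q) dz i j (fun y => A y p q) x.
Definition dzbarM m n (i : chart X) (j : 'I_d) (A : X -> 'M[C]_(m, n)) (x : X) :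
  'M[C]_(m, n) := \matrix_(p, q) dzbar i j (fun y => A y p q) x.

(* (jac i i' x) a b = d z'_b / d z_a, where z, z' are the coordinates of the
   charts i, i'; the column of coefficients of a (1,0)-form in the chart i is
   jac i i' times its column of coefficients in the chart i'. *)
Definition jac (i i' : chart X) (x : X) : 'M[C]_d :=
  \matrix_(a, b) dz i a (fun y => ccoord b (cmap i' y)) x.

(* Throughout, the matrix of coefficients of a (1,1)-form in a chart is taken
   with respect to the dz_j /\ d\bar z_k (without any factor i). *)

(* Coefficient, with respect to the Lebesgue measure of the coordinates, of the
   wedge product of d (1,1)-forms; note dz /\ d\bar z = -2i dx /\ dy. *)
Definition wedge_top (a : 'I_d -> 'M[C]_d) : C :=
  (- (2 * 'i%C)) ^+ d *
  \sum_(s : 'S_d) \sum_(t : 'S_d)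
    (-1) ^+ odd_perm s * (-1) ^+ odd_perm t * \prod_k a k (s k) (t k).

(* v is the integral over X of the (d,d)-form whose density in the chart i is
   f i, computed with a finite partition of unity (X is compact below). *)
Definition is_integral (f : chart X -> X -> R) (v : R) : Prop :=
  exists (n : nat) (c : 'I_n -> chart X) (rho : 'I_n -> X -> R),
    [/\ forall k, continuous (rho k),
        forall k x, 0 <= rho k x,
        forall k, closure [set x | rho k x != 0] `<=` cdom (c k),
        forall x, \sum_k rho k x = 1 &
        v = \sum_k cintegral
              ((fun z => rho k (cinv (c k) z) * f (c k) (cinv (c k) z))
                 \_ (cmap (c k) @` cdom (c k)))].

(* gmx i x is the matrix of the g(d/dz_j, d/dz_k); the fundamental form is
   omega = i \sum_(j,k) g_jk dz_j /\ d\bar z_k. *)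
Record hermitianMetric := HermitianMetric {
  gmx : chart X -> X -> 'M[C]_d;
  gmx_smooth : forall i j k, smooth_on (cdom i) (fun x => gmx i x j k);
  gmx_hermitian : forall i x, cdom i x -> (gmx i x)^t* = gmx i x;
  gmx_posdef : forall i x, cdom i x -> forall v : 'rV[C]_d, v != 0 ->
    0 < (v *m gmx i x *m v^t*) 0 0;
  gmx_compat : forall i i' x, cdom i x -> cdom i' x ->
    gmx i x = jac i i' x *m gmx i' x *m (jac i i' x)^t*
}.

Definition fundamental_form (g : hermitianMetric) (i : chart X) (x : X) :
  'M[C]_d := 'i%C *: gmx g i x.

Definition kaehler (g : hermitianMetric) : Prop :=
  forall i x, cdom i x -> forall j k l : 'I_d,
    dz i j (fun y => fundamental_form g i y k l) x =
      dz i k (fun y => fundamental_form g i y j l) x /\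
    dzbar i j (fun y => fundamental_form g i y k l) x =
      dzbar i l (fun y => fundamental_form g i y k j) x.

(* Pointwise Hermitian inner product on (1,1)-forms induced by g. *)
Definition form11_dot (g a b : 'M[C]_d) : C :=
  \tr (invmx g *m a *m invmx g *m b^t*).

(* The adjoint of f |-> f omega, i.e. the inner product with omega, applied to
   each entry of the matrix-valued (1,1)-form \sum_(j,k) F j k dz_j /\ d\bar z_k. *)
Definition Lambda r (g : hermitianMetric) (i : chart X) (x : X)
    (F : 'I_d -> 'I_d -> 'M[C]_r) : 'M[C]_r :=
  \matrix_(p, q) form11_dot (gmx g i x) (\matrix_(j, k) F j k p q)
                            (fundamental_form g i x).

(* Coefficient of dz_j /\ d\bar z_k in the curvature \bar\partial (H^-1 \partial H)
   of the Chern connection, in a holomorphic frame whose Gram matrix is H, with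
   the convention h(s, t) = t^* H s on coordinate columns. *)
Definition chern_curvature r (i : chart X) (H : X -> 'M[C]_r) (j k : 'I_d)
    (x : X) : 'M[C]_r :=
  - dzbarM i k (fun y => invmx (H y) *m dzM i j H y) x.

(* The Chern-Weil form (i / 2 pi) tr K representing the real first Chern class. *)
Definition chern_form r (i : chart X) (H : X -> 'M[C]_r) (x : X) : 'M[C]_d :=
  \matrix_(j, k) ('i%C / (2 * pi)%:C * \tr (chern_curvature i H j k x)).

(* Gram matrix of the frame d/dz_1, ..., d/dz_d of TX, in the convention
   h(s, t) = t^* H s. *)
Definition tangent_gram (g : hermitianMetric) (i : chart X) (x : X) : 'M[C]_d :=
  (gmx g i x)^T.

(* The Ricci form i tr K(TX, g) vanishes. *)
Definition ricci_flat (g : hermitianMetric) : Prop :=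
  forall i x, cdom i x -> forall j k,
    'i%C * \tr (chern_curvature i (tangent_gram g i) j k x) = 0.

(* c_1(TX) = 0 in H^2(X, R): the Chern form of TX for some Hermitian metric is
   the differential of a real 1-form \sum_j (beta_j dz_j + \bar beta_j d\bar z_j). *)
Definition c1_tangent_zero : Prop :=
  exists (g : hermitianMetric) (beta : chart X -> 'I_d -> X -> C),
    [/\ forall i j, smooth_on (cdom i) (beta i j),
        forall i i' x, cdom i x -> cdom i' x -> forall j,
          beta i j x = \sum_k jac i i' x j k * beta i' k x,
        forall i x, cdom i x -> forall j k,
          dz i j (beta i k) x = dz i k (beta i j) x &
        forall i x, cdom i x -> forall j k,
          dz i j (fun y => Num.conj (beta i k y)) x - dzbar i k (beta i j) x =
          chern_form i (tangent_gram g i) x j k].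

(* A rank r bundle trivialized by frames over an open cover; the coordinate
   columns of a section satisfy s_a = btrans a b *m s_b. *)
Record holBundle (r : nat) := HolBundle {
  frame : Type;
  bdom : frame -> set X;
  btrans : frame -> frame -> X -> 'M[C]_r;
  bdom_open : forall a, open (bdom a);
  bdom_cover : forall x, exists a, bdom a x;
  btrans_holomorphic : forall a b p q,
    holomorphic_on (bdom a `&` bdom b) (fun x => btrans a b x p q);
  btrans_id : forall a x, bdom a x -> btrans a a x = 1%:M;
  btrans_cocycle : forall a b c x, bdom a x -> bdom b x -> bdom c x ->
    btrans a b x *m btrans b c x = btrans a c x
}.

(* A Hermitian structure, given by its Gram matrices: h(s, t) = t^* H s. *)
Record hermitianStructure r (E : holBundle r) := HermitianStructure {
  hmx : frame E -> X -> 'M[C]_r;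
  hmx_smooth : forall a p q, smooth_on (bdom a) (fun x => hmx a x p q);
  hmx_hermitian : forall a x, bdom a x -> (hmx a x)^t* = hmx a x;
  hmx_posdef : forall a x, bdom a x -> forall v : 'cV[C]_r, v != 0 ->
    0 < (v^t* *m hmx a x *m v) 0 0;
  hmx_compat : forall a b x, bdom a x -> bdom b x ->
    hmx b x = (btrans a b x)^t* *m hmx a x *m btrans a b x
}.

(* hgmx i j a is the matrix, in the frame a, of the component A_j of
   theta = \sum_j A_j dz_j in the chart i. *)
Record higgsField r (E : holBundle r) := HiggsField {
  hgmx : chart X -> 'I_d -> frame E -> X -> 'M[C]_r;
  hgmx_holomorphic : forall i j a p q,
    holomorphic_on (cdom i `&` bdom a) (fun x => hgmx i j a x p q);
  hgmx_frame : forall i j a b x, cdom i x -> bdom a x -> bdom b x ->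
    hgmx i j a x = btrans a b x *m hgmx i j b x *m btrans b a x;
  hgmx_chart : forall i i' j a x, cdom i x -> cdom i' x -> bdom a x ->
    hgmx i j a x = \sum_k jac i i' x j k *: hgmx i' k a x;
  hgmx_integrable : forall i j k a x, cdom i x -> bdom a x ->
    hgmx i j a x *m hgmx i k a x = hgmx i k a x *m hgmx i j a x
}.

(* Matrix of the adjoint of A with respect to h, where h(s, t) = t^* H s. *)
Definition adjoint r (H A : 'M[C]_r) : 'M[C]_r := invmx H *m A^t* *m H.

Definition yang_mills_higgs (omega : hermitianMetric) r (E : holBundle r)
    (theta : higgsField E) (h : hermitianStructure E) : Prop :=
  exists c : R, forall i (a : frame E) x, cdom i x -> bdom a x ->
    Lambda omega i x (fun j k =>
      let A := hgmx theta i j a x in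
      let B := adjoint (hmx h a x) (hgmx theta i k a x) in
      chern_curvature i (hmx h a) j k x + (A *m B - B *m A))
    = (c%:C * 'i%C)%:M.

(* Density of alpha /\ omega^(d-1), for a (1,1)-form alpha. For d = 0 there are
   no 2-forms and degrees vanish. *)
Definition degree_density (omega : hermitianMetric)
    (alpha : chart X -> X -> 'M[C]_d) (i : chart X) (x : X) : R :=
  if d == 0%N then 0 else
  complex.Re (wedge_top (fun k : 'I_d =>
    if val k == 0%N then alpha i x else fundamental_form omega i x)).

(* A representative of c_1(E): near x any frame defined at x may be used. *)
Definition is_chern_form r (E : holBundle r) (h : hermitianStructure E)
    (alpha : chart X -> X -> 'M[C]_d) : Prop :=
  forall i (a : frame E) x, cdom i x -> bdom a x ->
    alpha i x = chern_form i (hmx h a) x.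

Definition bundle_degree (omega : hermitianMetric) r (E : holBundle r)
    (delta : R) : Prop :=
  exists (h : hermitianStructure E) alpha,
    is_chern_form h alpha /\ is_integral (degree_density omega alpha) delta.

(* Local sections of E are given by their coordinate columns in all frames; the
   value of such a family outside the relevant open set is irrelevant. *)
Definition sec r (E : holBundle r) := frame E -> X -> 'cV[C]_r.

Definition is_section r (E : holBundle r) (U : set X) (s : sec E) : Prop :=
  [/\ open U,
      forall a b x, U x -> bdom a x -> bdom b x ->
        s a x = btrans a b x *m s b x &
      forall a p, holomorphic_on (U `&` bdom a) (fun x => s a x p 0)].

Definition sec_eq r (E : holBundle r) (U : set X) (s t : sec E) : Prop :=
  forall a x, U x -> bdom a x -> s a x = t a x.

Definition sec_comb r (E : holBundle r) n (f : 'I_n -> X -> C)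
    (s : 'I_n -> sec E) : sec E :=
  fun a x => \sum_k f k x *: s k a x.

Definition is_relation r (E : holBundle r) n (U : set X) (s : 'I_n -> sec E)
    (f : 'I_n -> X -> C) : Prop :=
  (forall k, holomorphic_on U (f k)) /\ sec_eq U (sec_comb f s) (fun _ _ => 0).

(* A subsheaf of O_X-modules of the sheaf of holomorphic sections of E which is
   of finite type and has finite type sheaves of relations. *)
Record coherentSubsheaf r (E : holBundle r) := CoherentSubsheaf {
  shf : set X -> sec E -> Prop;
  shf_section : forall U s, shf U s -> is_section U s;
  shf_ext : forall U s t, shf U s -> sec_eq U s t -> shf U t;
  shf_restrict : forall U W s, shf U s -> open W -> W `<=` U -> shf W s;
  shf_glue : forall U s, is_section U s ->
    (forall x, U x -> exists W, [/\ W x, W `<=` U & shf W s]) -> shf U s;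
  shf_zero : forall U, open U -> shf U (fun _ _ => 0);
  shf_add : forall U s t, shf U s -> shf U t ->
    shf U (fun a x => s a x + t a x);
  shf_scale : forall U f s, holomorphic_on U f -> shf U s ->
    shf U (fun a x => f x *: s a x);
  shf_finite_type : forall x, exists U n (s : 'I_n -> sec E),
    [/\ open U, U x, forall k, shf U (s k) &
        forall W t y, shf W t -> W `<=` U -> W y ->
          exists W' f, [/\ open W', W' y, W' `<=` W,
            forall k, holomorphic_on W' (f k) & sec_eq W' t (sec_comb f s)]];
  shf_relations_finite_type : forall U n (s : 'I_n -> sec E) x, open U ->
    (forall k, shf U (s k)) -> U x ->
    exists W m (rho : 'I_m -> 'I_n -> X -> C),
      [/\ open W, W x, W `<=` U, forall l, is_relation W s (rho l) &
          forall W' f y, open W' -> W' `<=` W -> W' y -> is_relation W' s f ->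
            exists W'' c, [/\ open W'', W'' y, W'' `<=` W',
              forall l : 'I_m, holomorphic_on W'' (c l) &
              forall k z, W'' z -> f k z = \sum_l c l z * rho l k z]]
}.

(* b is a basis of the restriction of F to U as a module over O_U. *)
Definition is_basis r (E : holBundle r) (F : coherentSubsheaf E) m (U : set X)
    (b : 'I_m -> sec E) : Prop :=
  [/\ open U, forall k, shf F U (b k),
      forall W t, shf F W t -> W `<=` U ->
        exists f, (forall k, holomorphic_on W (f k)) /\
                  sec_eq W t (sec_comb f b) &
      forall W f, open W -> W `<=` U -> is_relation W b f ->
        forall k x, W x -> f k x = 0].

(* F has rank m: it is locally free of rank m on a dense open set. *)
Definition sheaf_rank r (E : holBundle r) (F : coherentSubsheaf E) (m : nat) :
  Prop := dense [set x | exists U (b : 'I_m -> sec E), U x /\ is_basis F U b].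

(* L is the determinant line bundle of F: on the open set where F is locally
   free, an isomorphism from det F to L is given by sending each local basis b
   (that is, b_1 /\ ... /\ b_m) to a generator sigma U b of L, compatibly with
   changes of bases. As F is torsionfree, the complement of that open set is an
   analytic subset of codimension at least 2, so that L is the line bundle
   det F = (\Lambda^m F)^** and c_1(F) = c_1(L). *)
Definition is_det r (E : holBundle r) (F : coherentSubsheaf E) (m : nat)
    (L : holBundle 1) : Prop :=
  exists sigma : set X -> ('I_m -> sec E) -> sec L,
    (forall U b, is_basis F U b ->
       is_section U (sigma U b) /\
       forall a x, U x -> bdom a x -> sigma U b a x != 0) /\
    (forall U U' b b' (M : X -> 'M[C]_m),
       is_basis F U b -> is_basis F U' b' ->
       (forall k l, holomorphic_on (U `&` U') (fun x => M x k l)) ->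
       (forall l, sec_eq (U `&` U') (b' l) (sec_comb (fun k x => M x k l) b)) ->
       sec_eq (U `&` U') (sigma U' b') (fun a x => \det (M x) *: sigma U b a x)).

Definition sheaf_degree (omega : hermitianMetric) r (E : holBundle r)
    (F : coherentSubsheaf E) (m : nat) (delta : R) : Prop :=
  exists L : holBundle 1, is_det F m L /\ bundle_degree omega L delta.

(* theta(F) is contained in F \otimes \Omega_X. *)
Definition higgs_invariant r (E : holBundle r) (theta : higgsField E)
    (F : coherentSubsheaf E) : Prop :=
  forall U s i j, shf F U s ->
    shf F (U `&` cdom i) (fun a x => hgmx theta i j a x *m s a x).

Definition higgs_stable (omega : hermitianMetric) r (E : holBundle r)
    (theta : higgsField E) : Prop :=
  forall (F : coherentSubsheaf E) (m : nat) (degF degE : R),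
    sheaf_rank F m -> (0 < m < r)%N -> higgs_invariant theta F ->
    sheaf_degree omega F m degF -> bundle_degree omega E degE ->
    degF / m%:R < degE / r%:R.

Definition higgs_semistable (omega : hermitianMetric) r (E : holBundle r)
    (theta : higgsField E) : Prop :=
  forall (F : coherentSubsheaf E) (m : nat) (degF degE : R),
    sheaf_rank F m -> (0 < m < r)%N -> higgs_invariant theta F ->
    sheaf_degree omega F m degF -> bundle_degree omega E degE ->
    degF / m%:R <= degE / r%:R.

Definition is_morphism r r' (E : holBundle r) (E' : holBundle r')
    (f : frame E' -> frame E -> X -> 'M[C]_(r', r)) : Prop :=
  (forall a' a p q,
     holomorphic_on (bdom a' `&` bdom a) (fun x => f a' a x p q)) /\
  (forall a' b' a b x, bdom a' x -> bdom b' x -> bdom a x -> bdom b x ->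
     f a' a x = btrans a' b' x *m f b' b x *m btrans b a x).

(* (E, theta) is the direct sum of the (G k, eta k), through the inclusions
   iota k and the projections pr k. *)
Definition is_direct_sum r (E : holBundle r) (theta : higgsField E) n
    (rk : 'I_n -> nat) (G : forall k, holBundle (rk k))
    (eta : forall k, higgsField (G k)) : Prop :=
  exists (iota : forall k, frame E -> frame (G k) -> X -> 'M[C]_(r, rk k))
         (pr : forall k, frame (G k) -> frame E -> X -> 'M[C]_(rk k, r)),
    [/\ forall k, is_morphism (iota k) /\ is_morphism (pr k),
        forall k (a : frame E) (b c : frame (G k)) x,
          bdom a x -> bdom b x -> bdom c x ->
          pr k b a x *m iota k a c x = btrans b c x,
        forall k l (a : frame E) (b : frame (G k)) (c : frame (G l)) x,
          k != l -> bdom a x -> bdom b x -> bdom c x ->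
          pr k b a x *m iota l a c x = 0,
        forall (a : frame E) (b : forall k, frame (G k)) x,
          bdom a x -> (forall k, bdom (b k) x) ->
          \sum_k iota k a (b k) x *m pr k (b k) a x = 1%:M &
        forall k i j (a : frame E) (b : frame (G k)) x,
          cdom i x -> bdom a x -> bdom b x ->
          hgmx theta i j a x *m iota k a b x =
          iota k a b x *m hgmx (eta k) i j b x].

Definition higgs_polystable (omega : hermitianMetric) r (E : holBundle r)
    (theta : higgsField E) : Prop :=
  higgs_semistable omega theta /\
  exists n (rk : 'I_n -> nat) (G : forall k, holBundle (rk k))
         (eta : forall k, higgsField (G k)),
    (forall k, higgs_stable omega (eta k)) /\ is_direct_sum theta eta.

Lemma Ck_cst k (U : set (cspace R d)) (c : R) : Ck k U (fun=> c).
Proof.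
elim: k c => [|k IH] c /=; split=> //; first by move=> z _; exact: cst_continuous.
  by move=> z _; exact: cst_continuous.
move=> v; split; first by move=> z _; exact: derivable_cst.
have -> : 'D_v (fun=> c : R) = (fun=> 0) :> (cspace R d -> R).
  by apply/funext => z; exact: derive_cst.
exact: IH.
Qed.

Lemma holomorphic_on_cst (U : set X) (c : C) : holomorphic_on U (fun=> c).
Proof.
move=> i; split=> [k|z _ j]; first by split; exact: Ck_cst.
rewrite /wirtbar /cderive /= !derive_cst.
by rewrite (_ : 0 +i* 0 = 0)%C // mulr0 addr0 mul0r.
Qed.

Definition higgs_zero r (E : holBundle r) : higgsField E.
Proof.
refine (@HiggsField r E (fun _ _ _ _ => 0) _ _ _ _).
- by move=> i j a p q; under [X in holomorphic_on _ X]eq_fun do rewrite mxE;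
    exact: holomorphic_on_cst.
- by move=> *; rewrite mulmx0 mul0mx.
- by move=> *; rewrite big1 // => k _; rewrite scaler0.
- by [].
Defined.

End Manifold.

(* Main.v *)
Require Import Defs.
From mathcomp Require Import all_boot all_order all_algebra.
From mathcomp Require Import complex.
From mathcomp Require Import all_classical all_reals all_analysis.
From mathcomp Require Import ring lra.
Set Implicit Arguments.
Unset Strict Implicit.
Unset Printing Implicit Defensive.
Import Order.TTheory GRing.Theory Num.Theory.
Import numFieldNormedType.Exports.
Local Open Scope classical_set_scope.
Local Open Scope ring_scope.
Local Open Scope complex_scope.
Local Open Scope sesquilinear_scope.

(** The Higgs field commutes with its adjoint at every point: if
    theta = sum_j A_j dz_j and B_k is the adjoint of A_k for h, then
    [A_j, B_k] = 0 for all j and k.  The terms [A_j, B_k] thus disappear from the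
    Yang-Mills-Higgs equation of (E, theta), which becomes that of (E, 0), with
    the same constant.

    The commutators vanish by the Bochner technique, applied to the squared norm
    u of theta as a section of End(E) tensored with the cotangent bundle.  Since
    theta is holomorphic, the Laplacian of u is the squared norm of the covariant
    derivative of theta plus a curvature term.  In the curvature term, the
    curvature of the cotangent bundle of a Kaehler manifold enters through the
    Ricci tensor only, hence not at all ([ricci_contraction]), and that of E
    enters through its mean curvature, which by the Yang-Mills-Higgs equation is
    a scalar minus the contraction of the commutators [A_j, B_k]
    ([curvature_contraction]).  As the components A_j commute with each other,
    the Jacobi identity turns what remains into the squared norm of the family
    of all [A_j, B_k] ([mxtrace_double_commutator], [bochner_formula]).  So u is
    subharmonic, and the commutators vanish wherever its Laplacian does.

    A subharmonic function on a compact connected manifold is constant, by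
    Hopf's strong maximum principle ([max_locally_constant]), which here is
    applied in a chart after the metric Laplacian has been written as a sum of
    squares of real directional derivatives ([metric_directions]).  Therefore the
    Laplacian of u is zero and all commutators vanish ([higgs_commute]). *)

(** * Directional derivatives *)

Section DirectionalDerivatives.
Context {R : realType} {V : normedModType R}.
Implicit Types (f g : V -> R) (U : set V) (u v w z : V).

Lemma continuous_for_dist f z : {for z, continuous f} ->
  forall e : R, 0 < e ->
  exists2 d : R, 0 < d & forall y, `|y - z| < d -> `|f y - f z| < e.
Proof.
move=> /cvgrPdist_lt fz e e0; have /nbhs_ballP[d /= d0 hd] := fz _ e0.
exists d => // y yz; rewrite distrC; apply: hd.
by rewrite -ball_normE /= distrC.
Qed.

Lemma dist_lt_trans (a x y d e : R) :
  `|a - x| < d -> `|a - y| < e -> `|x - y| < d + e.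
Proof.
move=> ax ay; apply: le_lt_trans (ler_distD a x y) _.
by rewrite ltrD // distrC.
Qed.

Lemma dist_lt_add (x x' y y' d e : R) :
  `|x - x'| < d -> `|y - y'| < e -> `|(x + y) - (x' + y')| < d + e.
Proof.
move=> xx yy; rewrite opprD addrACA.
exact: le_lt_trans (ler_normD _ _) (ltrD xx yy).
Qed.

Lemma open_dist U z : open U -> U z ->
  exists2 d : R, 0 < d & forall y, `|y - z| < d -> U y.
Proof.
move=> oU Uz; have /nbhs_ballP[d /= d0 hd] := open_nbhs_nbhs (conj oU Uz).
by exists d => // y yz; apply: hd; rewrite -ball_normE /= distrC.
Qed.

Lemma derive_expansion f z v : derivable f z v ->
  forall e : R, 0 < e -> exists2 d : R, 0 < d & forall t, 0 < t < d ->
    `|f (t *: v + z) - f z - t * 'D_v f z| < e * t.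
Proof.
move=> /derivableP[] fzv _ e e0.
have /cvgrPdist_lt/(_ _ e0) := fzv.
rewrite near_withinE => /nbhs_ballP[d /= d0 hd].
exists d => // t /andP[t0 td].
have := hd t; rewrite -ball_normE /= sub0r normrN gtr0_norm // => /(_ td).
rewrite gt_eqF // => /(_ isT).
set D := lim _; rewrite (_ : 'D_v f z = D) // => H.
set w := f (t *: v + z) - f z.
have -> : w - t * D = - (t * (D - t^-1 *: w)).
  have -> : t^-1 *: w = t^-1 * w by [].
  by field; rewrite gt_eqF.
by rewrite normrN normrM gtr0_norm // mulrC ltr_pM2r.
Qed.

Lemma derivable_line f z v (t : R) : derivable f (t *: v + z) v ->
  is_derive t 1 (fun s => f (s *: v + z)) ('D_v f (t *: v + z)).
Proof.
move=> df.
have E : (fun h : R => h^-1 *: (f (h *: v + (t *: v + z)) - f (t *: v + z)))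
   = (fun h : R => h^-1 *: (f ((h *: 1 + t) *: v + z) - f (t *: v + z))).
  by apply/funext => h; rewrite [h *: 1]mulr1 scalerDl addrA.
apply: DeriveDef; first by rewrite /derivable -E.
by rewrite /derive -E.
Qed.

Lemma MVT_line f z v (t : R) : 0 < t ->
  (forall s, 0 <= s <= t -> derivable f (s *: v + z) v) ->
  exists2 s, 0 < s < t & f (t *: v + z) - f z = t * 'D_v f (s *: v + z).
Proof.
move=> t0 df.
have [|s|s st E] := @MVT R (fun s => f (s *: v + z))
    (fun s => 'D_v f (s *: v + z)) 0 t t0.
- by move=> s /itvP st; apply/derivable_line/df; rewrite !st.
- apply: derivable_within_continuous => s' /itvP st.
  by have [] := derivable_line (df s' _) => //; rewrite !st.
- by exists s => //; move: E; rewrite scale0r add0r subr0 mulrC.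
Qed.

Lemma norm_line_lt u v z (s t d : R) : 0 < t -> 0 <= s <= t ->
  t * (`|u| + `|v| + 1) < d -> `|s *: v + (t *: u + z) - z| < d.
Proof.
move=> t0 /andP[s0 st]; apply: le_lt_trans.
rewrite addrA addrK (le_trans (ler_normD _ _)) // !normrZ ger0_norm //.
rewrite (gtr0_norm t0) !mulrDr mulr1.
have := ler_wpM2r (normr_ge0 v) st; lra.
Qed.

Lemma small_scale (c d : R) : 0 < d -> 0 <= c ->
  exists2 t, 0 < t & forall s, 0 < s <= t -> s * (c + 1) < d.
Proof.
move=> d0 c0; have c1 : 0 < c + 1 by lra.
exists (d / (c + 1) / 2); first by rewrite !divr_gt0.
move=> s /andP[s0 st]; rewrite -ltr_pdivlMr //.
have : 0 < d / (c + 1) by rewrite divr_gt0.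
lra.
Qed.

(** A mean value estimate turns continuity of one partial derivative into
    additivity in the direction. *)
Lemma derive_dirD f z u v U : open U -> U z ->
  (forall y, U y -> derivable f y v) -> {for z, continuous ('D_v f)} ->
  derivable f z u -> derivable f z (u + v) ->
  'D_(u + v) f z = 'D_u f z + 'D_v f z.
Proof.
move=> oU Uz dv cv du duv.
apply/eqP; rewrite -subr_eq0 -normr_le0; apply/ler_addgt0Pl => e e0.
have e3 : 0 < e / 3 by lra.
have [d1 d10 h1] := derive_expansion du e3.
have [d2 d20 h2] := derive_expansion duv e3.
have [d3 d30 h3] := continuous_for_dist cv e3.
have [d4 d40 h4] := open_dist oU Uz.
have d34 : 0 < Num.min d3 d4 by rewrite lt_min d30 d40.
have [t3 t30 h5] := small_scale d34 (addr_ge0 (normr_ge0 u) (normr_ge0 v)).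
pose t := Num.min t3 (Num.min d1 d2) / 2.
have m0 : 0 < Num.min t3 (Num.min d1 d2) by rewrite !lt_min t30 d10.
have : t * 2 = Num.min t3 (Num.min d1 d2) by rewrite /t; field.
have : Num.min t3 (Num.min d1 d2) <= t3 by rewrite ge_min lexx.
have : Num.min t3 (Num.min d1 d2) <= d1 by rewrite !ge_min lexx orbT.
have : Num.min t3 (Num.min d1 d2) <= d2 by rewrite !ge_min lexx !orbT.
move: (Num.min _ _) m0 => m m0 mt2 mt1 mt3 tm.
have [t0 tt3 td1 td2] : [/\ 0 < t, 0 < t <= t3, 0 < t < d1 & 0 < t < d2].
  by move: m0 mt2 mt1 mt3 tm; clear => *; split; lra.
have := h5 _ tt3; rewrite lt_min => /andP[tc3 tc4].
have [s st Es] := @MVT_line f (t *: u + z) v t t0 (fun s st =>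
  dv _ (h4 _ (norm_line_lt z t0 st tc4))).
have st' : 0 <= s <= t by case/andP: st => s0 ?; rewrite !ltW.
have H3 := h3 _ (norm_line_lt z t0 st' tc3).
have H1 := h1 _ td1; have H2 := h2 _ td2.
have E : t *: (u + v) + z = t *: v + (t *: u + z).
  by rewrite scalerDr addrA; congr (_ + _); rewrite addrC.
rewrite E in H2.
have H4 : `|t * 'D_v f (s *: v + (t *: u + z)) - t * 'D_v f z| < e / 3 * t.
  by rewrite -mulrBr normrM gtr0_norm // mulrC ltr_pM2r.
have H : `|t * ('D_(u + v) f z - ('D_u f z + 'D_v f z))| < t * e.
  have Ef : f (t *: v + (t *: u + z)) - f z = f (t *: u + z) - f z +
      t * 'D_v f (s *: v + (t *: u + z)) by rewrite -Es [RHS]addrC subrKA.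
  have := dist_lt_add H1 H4; rewrite -Ef => H5.
  have := dist_lt_trans H2 H5; rewrite -mulrDr -mulrBr => /lt_le_trans; apply.
  by rewrite le_eqVlt; apply/orP; left; apply/eqP; field.
by move: H; rewrite normrM gtr0_norm // ltr_pM2l // addr0 => /ltW.
Qed.

Lemma derive_dirZ_gt0 f z v (c : R) : 0 < c ->
  derivable f z v -> derivable f z (c *: v) -> 'D_(c *: v) f z = c * 'D_v f z.
Proof.
move=> c0 dv dcv.
apply/eqP; rewrite -subr_eq0 -normr_le0; apply/ler_addgt0Pl => e e0.
have e2 : 0 < e / 2 by lra.
have e2c : 0 < e / 2 / c by rewrite divr_gt0.
have [d1 d10 h1] := derive_expansion dv e2c.
have [d2 d20 h2] := derive_expansion dcv e2.
pose t := Num.min (d1 / c) d2 / 2.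
have m0 : 0 < Num.min (d1 / c) d2 by rewrite lt_min d20 divr_gt0.
have : t * 2 = Num.min (d1 / c) d2 by rewrite /t; field.
have : Num.min (d1 / c) d2 <= d1 / c by rewrite ge_min lexx.
have : Num.min (d1 / c) d2 <= d2 by rewrite ge_min lexx orbT.
move=> ? ? ?; have t0 : 0 < t by lra.
have td2 : 0 < t < d2 by lra.
have tcd1 : 0 < t * c < d1 by rewrite mulr_gt0 //= -ltr_pdivlMr //; lra.
have := h1 _ tcd1; have := h2 _ td2.
rewrite scalerA (_ : e / 2 / c * (t * c) = e / 2 * t); last first.
  by field; rewrite gt_eqF.
move=> H2 H1.
have H : `|t * ('D_(c *: v) f z - c * 'D_v f z)| < t * e.
  rewrite mulrBr mulrA; apply: lt_le_trans (dist_lt_trans H2 H1) _.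
  by rewrite le_eqVlt; apply/orP; left; apply/eqP; field.
by move: H; rewrite normrM gtr0_norm // ltr_pM2l // addr0 => /ltW.
Qed.

Lemma derive_dirZ f z v U (c : R) : open U -> U z ->
  (forall w y, U y -> derivable f y w) ->
  (forall w, {for z, continuous ('D_w f)}) -> 'D_(c *: v) f z = c * 'D_v f z.
Proof.
move=> oU Uz df cf.
have [c0|c0|<-] := ltrgtP 0 c.
- by rewrite derive_dirZ_gt0 //; exact: df.
- have Nc0 : 0 < - c by lra.
  have := @derive_dirD f z (c *: v) (- c *: v) U oU Uz (df _) (cf _)
    (df _ _ Uz) (df _ _ Uz).
  rewrite -scalerDl subrr scale0r derive0 (derive_dirZ_gt0 Nc0) //; [|exact: df..].
  by lra.
- by rewrite scale0r derive0 mul0r.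
Qed.

(** The mean value theorem, applied in each of the two directions, equates the
    second difference with [t ^ 2] times the mixed derivative at a point that
    tends to [z] with [t]. *)
Lemma second_difference f z u v U (e : R) : open U -> U z -> 0 < e ->
  (forall w y, U y -> derivable f y w) ->
  (forall w x y, U y -> derivable ('D_w f) y x) ->
  {for z, continuous ('D_u ('D_v f))} ->
  exists2 d : R, 0 < d & forall t, 0 < t <= d ->
   `|f (t *: v + (t *: u + z)) - f (t *: u + z) - (f (t *: v + z) - f z)
     - t * t * 'D_u ('D_v f) z| < e * (t * t).
Proof.
move=> oU Uz e0 df ddf cf.
have [d3 d30 h3] := continuous_for_dist cf e0.
have [d4 d40 h4] := open_dist oU Uz.
have d34 : 0 < Num.min d3 d4 by rewrite lt_min d30 d40.
have [t3 t30 h5] := small_scale d34 (addr_ge0 (normr_ge0 u) (normr_ge0 v)).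
exists t3 => // t tt3; have t0 : 0 < t by case/andP: tt3.
have := h5 _ tt3; rewrite lt_min => /andP[tc3 tc4].
have inU (s s' : R) : 0 <= s <= t -> 0 <= s' <= t ->
    forall d, t * (`|u| + `|v| + 1) < d -> `|s *: v + (s' *: u + z) - z| < d.
  move=> /andP[s0 st] /andP[s'0 s't] d; apply: le_lt_trans.
  rewrite addrA addrK (le_trans (ler_normD _ _)) // !normrZ !ger0_norm //.
  rewrite !mulrDr mulr1.
  have := ler_wpM2r (normr_ge0 v) st; have := ler_wpM2r (normr_ge0 u) s't; lra.
have t00 : 0 <= (0 : R) <= t by lra.
have tt : 0 <= t <= t by lra.
pose g y := f (t *: u + y) - f y.
have gE (s : R) : 0 <= s <= t -> is_derive s 1 (fun s => g (s *: v + z))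
    ('D_v f (s *: v + (t *: u + z)) - 'D_v f (s *: v + z)).
  move=> st; have U1 := h4 _ (inU _ _ st tt _ tc4).
  have U2 := h4 _ (inU _ _ st t00 _ tc4); rewrite scale0r add0r in U2.
  have D1 := derivable_line (df v _ U1); have D2 := derivable_line (df v _ U2).
  rewrite /g (_ : (fun s => _) = (fun s => f (s *: v + (t *: u + z))) -
     (fun s => f (s *: v + z))); first exact: is_deriveB.
  by apply/funext => s'; rewrite fctE addrCA.
have [s st Es] : exists2 s, 0 < s < t & g (t *: v + z) - g z =
    t * ('D_v f (s *: v + (t *: u + z)) - 'D_v f (s *: v + z)).
  have [||s st E] := @MVT R (fun s => g (s *: v + z)) (fun s =>
    'D_v f (s *: v + (t *: u + z)) - 'D_v f (s *: v + z)) 0 t t0.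
  - by move=> s /itvP st; apply: gE; rewrite !st.
  - apply: derivable_within_continuous => s /itvP st.
    by have [|] := @gE s; rewrite ?st.
  - by exists s => //; move: E; rewrite scale0r add0r subr0 mulrC.
have st' : 0 <= s <= t by case/andP: st => s0 ?; rewrite !ltW.
have [s' s't Es'] := @MVT_line ('D_v f) (s *: v + z) u t t0 (fun s' s't =>
   ddf _ _ _ (h4 _ (eq_ind _ (fun y => `|y - z| < d4) (inU s s' st' s't _ tc4) _
      (addrCA _ _ _)))).
have s't' : 0 <= s' <= t by case/andP: s't => s0 ?; rewrite !ltW.
have := h3 _ (inU _ _ st' s't' _ tc3).
have -> : f (t *: v + (t *: u + z)) - f (t *: u + z) - (f (t *: v + z) - f z)
   = g (t *: v + z) - g z.
  rewrite /g (addrCA (t *: v)); ring.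
rewrite Es -[s *: v + (t *: u + z)]addrCA Es'.
rewrite (addrCA (s *: v)) => H.
rewrite mulrA -mulrBr normrM gtr0_norm ?mulr_gt0 // mulrC.
by rewrite ltr_pM2r // mulr_gt0.
Qed.

(** Schwarz's theorem: the second difference quotient along [u] and [v] is
    symmetric in [u] and [v] and converges to either mixed derivative. *)
Lemma derive_comm f z u v U : open U -> U z ->
  (forall w y, U y -> derivable f y w) ->
  (forall w x y, U y -> derivable ('D_w f) y x) ->
  (forall w x, {for z, continuous ('D_w ('D_x f))}) ->
  'D_u ('D_v f) z = 'D_v ('D_u f) z.
Proof.
move=> oU Uz df ddf cf.
apply/eqP; rewrite -subr_eq0 -normr_le0; apply/ler_addgt0Pl => e e0.
have e2 : 0 < e / 2 by lra.
have [d1 d10 h1] := @second_difference f z u v U _ oU Uz e2 df ddf (cf _ _).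
have [d2 d20 h2] := @second_difference f z v u U _ oU Uz e2 df ddf (cf _ _).
pose t := Num.min d1 d2.
have t0 : 0 < t by rewrite lt_min d10.
have td1 : 0 < t <= d1 by rewrite t0 /= ge_min lexx.
have td2 : 0 < t <= d2 by rewrite t0 /= ge_min lexx orbT.
have := h1 _ td1; have := h2 _ td2.
rewrite (addrCA (t *: u)) => H2 H1.
have tt0 : 0 < t * t by rewrite mulr_gt0.
have H : `|t * t * ('D_u ('D_v f) z - 'D_v ('D_u f) z)| < t * t * e.
  have E (a b c o : R) : a - b - (c - o) = a - c - (b - o) by ring.
  rewrite E in H1; rewrite mulrBr.
  apply: lt_le_trans (dist_lt_trans H1 H2) _.
  by rewrite le_eqVlt; apply/orP; left; apply/eqP; field.
by move: H; rewrite normrM gtr0_norm // ltr_pM2l // addr0 => /ltW.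
Qed.

End DirectionalDerivatives.

(** * Real functions of class C^k *)

Section RealCk.
Context {R : realType} {d : nat}.
Local Notation V := (cspace R d).
Implicit Types (f g : V -> R) (U : set V).

Lemma open_near U z : open U -> U z -> \forall y \near z, U y.
Proof. by move=> oU Uz; exact: (open_nbhs_nbhs (conj oU Uz)). Qed.

Lemma Ck_sub k U W f : W `<=` U -> Ck k U f -> Ck k W f.
Proof.
move=> WU; elim: k f => [|k IH] f /= [cf H]; split=> //; try by move=> z /WU/cf.
by move=> v; have [dv kv] := H v; split; [move=> z /WU/dv|exact: IH].
Qed.

Lemma Ck_pred k U f : Ck k.+1 U f -> Ck k U f.
Proof.
elim: k f => [|k IH] f [cf H]; first by split.
by split=> // v; have [dv kv] := H v; split=> //; exact: IH.
Qed.

Lemma Ck_ext k U f g : open U -> (forall z, U z -> f z = g z) ->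
  Ck k U f -> Ck k U g.
Proof.
move=> oU; elim: k f g => [|k IH] f g fg [cf H].
  split=> // z Uz; have fgz : {near z, f =1 g}.
    by near=> y; apply: fg; near: y; exact: open_near.
  rewrite /prop_for /continuous_at -fg //.
  by apply: cvg_trans (cf z Uz); exact: near_eq_cvg.
have nfg z : U z -> {near z, f =1 g}.
  by move=> Uz; near=> y; apply: fg; near: y; exact: open_near.
split=> [z Uz|v].
  rewrite /prop_for /continuous_at -fg //.
  by apply: cvg_trans (cf z Uz); exact/near_eq_cvg/nfg.
have [dv kv] := H v; split=> [z Uz|].
  exact: near_eq_derivable (nfg z Uz) (dv z Uz).
by apply: IH kv => z Uz; apply: near_eq_derive; exact: nfg.
Unshelve. all: by end_near. Qed.

Lemma CkD k U f g : open U -> Ck k U f -> Ck k U g -> Ck k U (fun z => f z + g z).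
Proof.
move=> oU; elim: k f g => [|k IH] f g [cf Hf] [cg Hg].
  by split=> // z Uz; apply: continuousD; [exact: cf|exact: cg].
split=> [z Uz|v]; first by apply: continuousD; [exact: cf|exact: cg].
have [df kf] := Hf v; have [dg kg] := Hg v; split=> [z Uz|].
  by apply: derivableD; [exact: df|exact: dg].
apply: Ck_ext (IH _ _ kf kg) => // z Uz.
by rewrite -deriveD //; [exact: df|exact: dg].
Qed.

Lemma CkN k U f : open U -> Ck k U f -> Ck k U (fun z => - f z).
Proof.
move=> oU; elim: k f => [|k IH] f [cf Hf].
  by split=> // z Uz; apply: continuousN; exact: cf.
split=> [z Uz|v]; first by apply: continuousN; exact: cf.
have [df kf] := Hf v; split=> [z Uz|]; first by apply: derivableN; exact: df.
by apply: Ck_ext (IH _ kf) => // z Uz; rewrite -deriveN //; exact: df.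
Qed.

Lemma CkM k U f g : open U -> Ck k U f -> Ck k U g -> Ck k U (fun z => f z * g z).
Proof.
move=> oU; elim: k f g => [|k IH] f g kf0 kg0.
  have [[cf _] [cg _]] := (kf0, kg0).
  by split=> // z Uz; apply: continuousM; [exact: cf|exact: cg].
have [[cf Hf] [cg Hg]] := (kf0, kg0).
split=> [z Uz|v]; first by apply: continuousM; [exact: cf|exact: cg].
have [df kf] := Hf v; have [dg kg] := Hg v; split=> [z Uz|].
  by apply: derivableM; [exact: df|exact: dg].
apply: Ck_ext (CkD oU (IH _ _ (Ck_pred kf0) kg) (IH _ _ (Ck_pred kg0) kf)) => //.
by move=> z Uz; rewrite -[LHS]/(f z *: 'D_v g z + g z *: 'D_v f z) -deriveM //;
  [exact: df|exact: dg].
Qed.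

Lemma CkV k U f : open U -> (forall z, U z -> f z != 0) ->
  Ck k U f -> Ck k U (fun z => (f z)^-1).
Proof.
move=> oU f0; elim: k => [|k IH] kf0; have [cf Hf] := kf0.
  by split=> // z Uz; apply: continuousV; [exact: f0|exact: cf].
split=> [z Uz|v]; first by apply: continuousV; [exact: f0|exact: cf].
have [df kf] := Hf v; split=> [z Uz|].
  by apply: derivableV; [exact: f0|exact: df].
have kV := IH (Ck_pred kf0).
apply: Ck_ext (CkN oU (CkM oU (CkM oU kV kV) kf)) => // z Uz.
rewrite deriveV; [|exact: f0|exact: df].
by rewrite -mulNr -invfM -expr2.
Qed.

End RealCk.

(** * Smooth complex functions *)

Section SmoothComplex.
Context {R : realType} {d : nat}.
Local Notation C := R[i].
Local Notation V := (cspace R d).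
Variable U : set V.
Hypothesis oU : open U.
Implicit Types (f g : V -> C).

Lemma smooth_ext f g : (forall z, U z -> f z = g z) -> smooth U f -> smooth U g.
Proof.
move=> fg sf k; have [h1 h2] := sf k.
by split; [apply: Ck_ext h1|apply: Ck_ext h2] => // z Uz; rewrite fg.
Qed.

Lemma smooth_cst (c : C) : smooth U (fun=> c).
Proof. by split; exact: Ck_cst. Qed.

Lemma smoothD f g : smooth U f -> smooth U g -> smooth U (fun z => f z + g z).
Proof.
move=> sf sg k; have [f1 f2] := sf k; have [g1 g2] := sg k.
by split; [apply: Ck_ext (CkD oU f1 g1)|apply: Ck_ext (CkD oU f2 g2)] => //
  z Uz; case: (f z) (g z) => [a b] [a' b'].
Qed.

Lemma smoothM f g : smooth U f -> smooth U g -> smooth U (fun z => f z * g z).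
Proof.
move=> sf sg k; have [f1 f2] := sf k; have [g1 g2] := sg k.
split.
  apply: Ck_ext (CkD oU (CkM oU f1 g1) (CkN oU (CkM oU f2 g2))) => // z Uz.
  by case: (f z) (g z) => [a b] [a' b'].
apply: Ck_ext (CkD oU (CkM oU f1 g2) (CkM oU f2 g1)) => // z Uz.
by case: (f z) (g z) => [a b] [a' b'].
Qed.

Lemma smooth_conj f : smooth U f -> smooth U (fun z => (f z)^*).
Proof.
move=> sf k; have [f1 f2] := sf k; split.
  by apply: Ck_ext f1 => // z Uz; case: (f z).
by apply: Ck_ext (CkN oU f2) => // z Uz; case: (f z).
Qed.

Lemma smoothV f : (forall z, U z -> f z != 0) -> smooth U f ->
  smooth U (fun z => (f z)^-1).
Proof.
move=> f0 sf k; have [f1 f2] := sf k.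
have n0 z : U z -> complex.Re (f z) * complex.Re (f z) +
    complex.Im (f z) * complex.Im (f z) != 0.
  move=> /f0; case: (f z) => a b; apply: contraNneq => /= /eqP.
  rewrite -!expr2 paddr_eq0 ?sqr_ge0 // !sqrf_eq0 => /andP[/eqP -> /eqP ->].
  by rewrite eqxx.
have n1 := CkV oU n0 (CkD oU (CkM oU f1 f1) (CkM oU f2 f2)).
split.
  apply: Ck_ext (CkM oU f1 n1) => // z Uz; case: (f z) => a b.
  by rewrite -!expr2.
apply: Ck_ext (CkN oU (CkM oU f2 n1)) => // z Uz; case: (f z) => a b.
by rewrite -!expr2.
Qed.

Lemma smooth_re_derivable f v z : smooth U f -> U z ->
  derivable (fun w => complex.Re (f w)) z v.
Proof. by move=> sf Uz; have [[_ H] _] := sf 1%N; have [+ _] := H v; apply. Qed.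

Lemma smooth_im_derivable f v z : smooth U f -> U z ->
  derivable (fun w => complex.Im (f w)) z v.
Proof. by move=> sf Uz; have [_ [_ H]] := sf 1%N; have [+ _] := H v; apply. Qed.

Lemma smooth_cderive v f : smooth U f -> smooth U (cderive v f).
Proof.
move=> sf k; have [[_ H1] [_ H2]] := sf k.+1.
by split; [have [_ +] := H1 v|have [_ +] := H2 v].
Qed.

Lemma cderive_ext v f g z : (forall y, U y -> f y = g y) -> U z ->
  cderive v f z = cderive v g z.
Proof.
move=> fg Uz; rewrite /cderive; congr (_ +i* _); apply: near_eq_derive;
  by near=> y; rewrite fg //; near: y; exact: open_near.
Unshelve. all: by end_near. Qed.

Lemma cderive_cst (v z : V) (c : C) : cderive v (fun=> c) z = 0.
Proof. by rewrite /cderive !derive_cst. Qed.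

Lemma cderiveD v f g z : smooth U f -> smooth U g -> U z ->
  cderive v (fun y => f y + g y) z = cderive v f z + cderive v g z.
Proof.
move=> sf sg Uz; rewrite /cderive.
have [f1 f2] := (smooth_re_derivable (v := v) sf Uz, smooth_im_derivable (v := v) sf Uz).
have [g1 g2] := (smooth_re_derivable (v := v) sg Uz, smooth_im_derivable (v := v) sg Uz).
rewrite -[RHS]/((_ + _) +i* (_ + _)) -!deriveD //.
by congr (_ +i* _); congr ('D_v _ z); apply/funext => y;
  rewrite /= fctE; case: (f y) (g y) => [a b] [a' b'].
Qed.

Lemma cderiveM v f g z : smooth U f -> smooth U g -> U z ->
  cderive v (fun y => f y * g y) z = cderive v f z * g z + f z * cderive v g z.
Proof.
move=> sf sg Uz; rewrite /cderive.
have [f1 f2] := (smooth_re_derivable (v := v) sf Uz, smooth_im_derivable (v := v) sf Uz).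
have [g1 g2] := (smooth_re_derivable (v := v) sg Uz, smooth_im_derivable (v := v) sg Uz).
set fr := fun w => complex.Re (f w) in f1 *.
set fi := fun w => complex.Im (f w) in f2 *.
set gr := fun w => complex.Re (g w) in g1 *.
set gi := fun w => complex.Im (g w) in g2 *.
have E1 : (fun w => complex.Re (f w * g w)) = fr * gr - fi * gi.
  by apply/funext => y; rewrite /fr /fi /gr /gi !fctE; case: (f y) (g y) => [? ?] [].
have E2 : (fun w => complex.Im (f w * g w)) = fr * gi + fi * gr.
  by apply/funext => y; rewrite /fr /fi /gr /gi !fctE; case: (f y) (g y) => [? ?] [].
rewrite E1 E2 (deriveB (derivableM f1 g1) (derivableM f2 g2)).
rewrite (deriveD (derivableM f1 g2) (derivableM f2 g1)).
rewrite (deriveM f1 g1) (deriveM f2 g2) (deriveM f1 g2) (deriveM f2 g1).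
rewrite /GRing.scale /=.
move: ('D_v fr z) ('D_v fi z) ('D_v gr z) ('D_v gi z) => a b a' b'.
rewrite /fr /fi /gr /gi; case: (f z) (g z) => [p q] [p' q'] /=.
by apply/eqP; rewrite eq_complex /=; apply/andP; split; apply/eqP; ring.
Qed.

Lemma cderive_conj v f z : smooth U f -> U z ->
  cderive v (fun y => (f y)^*) z = (cderive v f z)^*.
Proof.
move=> sf Uz; rewrite /cderive -[RHS]/(_ +i* (- _)) -deriveN; last first.
  exact: smooth_im_derivable.
by congr (_ +i* _); congr ('D_v _ z); apply/funext => y; rewrite ?fctE; case: (f y).
Qed.

Lemma cderiveC v w f z : smooth U f -> U z ->
  cderive v (cderive w f) z = cderive w (cderive v f) z.
Proof.
move=> sf Uz; rewrite /cderive; have [k1 k2] := sf 2.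
have comm (h : V -> R) : Ck 2 U h -> 'D_v ('D_w h) z = 'D_w ('D_v h) z.
  move=> [_ H]; apply: (@derive_comm _ _ _ _ _ _ U) => //.
  - by move=> x y Uy; have [+ _] := H x; apply.
  - by move=> x y y' Uy; have [_ [_ K]] := H x; have [+ _] := K y; apply.
  - by move=> x y; have [_ [_ K]] := H y; have [_ [+ _]] := K x; apply.
exact: (f_equal2 (@Complex R) (comm _ k1) (comm _ k2)).
Qed.

Lemma cderive_dirD u v f z : smooth U f -> U z ->
  cderive (u + v) f z = cderive u f z + cderive v f z.
Proof.
move=> sf Uz; rewrite /cderive -[RHS]/((_ + _) +i* (_ + _)).
have [k1 k2] := sf 1%N.
have add (h : V -> R) : Ck 1 U h -> 'D_(u + v) h z = 'D_u h z + 'D_v h z.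
  move=> [_ H]; apply: (@derive_dirD _ _ _ _ _ _ U) => //.
  - by move=> y; have [+ _] := H v; apply.
  - by have [_ [+ _]] := H v; apply.
  - by have [+ _] := H u; apply.
  - by have [+ _] := H (u + v); apply.
exact: (f_equal2 (@Complex R) (add _ k1) (add _ k2)).
Qed.

Lemma cderive_dirZ (c : R) v f z : smooth U f -> U z ->
  cderive (c *: v) f z = c%:C * cderive v f z.
Proof.
move=> sf Uz; have [k1 k2] := sf 1%N.
have scal (h : V -> R) : Ck 1 U h -> 'D_(c *: v) h z = c * 'D_v h z.
  move=> [_ H]; apply: (@derive_dirZ _ _ _ _ _ U) => //.
  - by move=> w y Uy; have [+ _] := H w; apply.
  - by move=> w; have [_ [+ _]] := H w; apply.
rewrite /cderive !scal //; apply/eqP; rewrite eq_complex /=.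
by apply/andP; split; apply/eqP; ring.
Qed.

End SmoothComplex.

(** * Derivations of an algebra of smooth functions *)

(** Tensor calculus only uses that smooth functions form an algebra closed under
    conjugation and under inversion of nowhere vanishing functions, on which the
    Wirtinger operators act as commuting derivations.  Stating these facts for an
    abstract algebra [S] of functions on [U] keeps the computations independent
    of the construction of the complex numbers and of partial derivatives. *)
Section SmoothAlgebra.
Context {C : numClosedFieldType} {V : Type}.
Implicit Types (f g : V -> C).

Record smooth_algebra (U : set V) (S : (V -> C) -> Prop) : Prop := SmoothAlgebra {
  alg_ext : forall f g, (forall z, U z -> f z = g z) -> S f -> S g;
  alg_cst : forall c, S (fun=> c);
  algD : forall f g, S f -> S g -> S (fun z => f z + g z);
  algM : forall f g, S f -> S g -> S (fun z => f z * g z);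
  algV : forall f, (forall z, U z -> f z != 0) -> S f -> S (fun z => (f z)^-1);
  alg_conj : forall f, S f -> S (fun z => Num.conj (f z))
}.

Record derivation (U : set V) (S : (V -> C) -> Prop) (D : (V -> C) -> V -> C) :
    Prop := Derivation {
  der_smooth : forall f, S f -> S (D f);
  der_ext : forall f g z, (forall y, U y -> f y = g y) -> U z -> D f z = D g z;
  der_cst : forall c z, D (fun=> c) z = 0;
  derD : forall f g z, S f -> S g -> U z ->
    D (fun y => f y + g y) z = D f z + D g z;
  derM : forall f g z, S f -> S g -> U z ->
    D (fun y => f y * g y) z = D f z * g z + f z * D g z
}.

(** The calculus of the operators [d j] = d/dz_j and [db k] = d/d\bar z_k. *)
Record wirtinger_calculus n (U : set V) (S : (V -> C) -> Prop)
    (d db : 'I_n -> (V -> C) -> V -> C) : Prop := WirtingerCalculus {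
  calc_alg : smooth_algebra U S;
  calc_der : forall j, derivation U S (d j);
  calc_derbar : forall k, derivation U S (db k);
  calc_comm : forall j k f z, S f -> U z -> db k (d j f) z = d j (db k f) z;
  calc_conj : forall j f z, S f -> U z ->
    d j (fun y => Num.conj (f y)) z = Num.conj (db j f z);
  calc_conjbar : forall j f z, S f -> U z ->
    db j (fun y => Num.conj (f y)) z = Num.conj (d j f z)
}.

Section Functions.
Variables (U : set V) (S : (V -> C) -> Prop).
Hypothesis aS : smooth_algebra U S.

Lemma alg_sum (I : Type) (r : seq I) (P : pred I) (F : I -> V -> C) :
  (forall i, P i -> S (F i)) -> S (fun z => \sum_(i <- r | P i) F i z).
Proof.
move=> sF; elim: r => [|i r IH].
  by apply: (alg_ext aS) (alg_cst aS 0) => z _; rewrite big_nil.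
have [Pi|nPi] := boolP (P i).
  by apply: (alg_ext aS) (algD aS (sF i Pi) IH) => z _; rewrite big_cons Pi.
by apply: (alg_ext aS) IH => z _; rewrite big_cons (negPf nPi).
Qed.

Lemma alg_prod (I : Type) (r : seq I) (P : pred I) (F : I -> V -> C) :
  (forall i, P i -> S (F i)) -> S (fun z => \prod_(i <- r | P i) F i z).
Proof.
move=> sF; elim: r => [|i r IH].
  by apply: (alg_ext aS) (alg_cst aS 1) => z _; rewrite big_nil.
have [Pi|nPi] := boolP (P i).
  by apply: (alg_ext aS) (algM aS (sF i Pi) IH) => z _; rewrite big_cons Pi.
by apply: (alg_ext aS) IH => z _; rewrite big_cons (negPf nPi).
Qed.

Lemma algN f : S f -> S (fun z => - f z).
Proof.
move=> sf; apply: (alg_ext aS) (algM aS (alg_cst aS (-1)) sf) => z _.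
by rewrite mulN1r.
Qed.

Lemma derZ D (c : C) f z : derivation U S D -> S f -> U z ->
  D (fun y => c * f y) z = c * D f z.
Proof.
move=> dD sf Uz; rewrite (derM dD) //; last exact: (alg_cst aS).
by rewrite (der_cst dD) mul0r add0r.
Qed.

Lemma derN D f z : derivation U S D -> S f -> U z ->
  D (fun y => - f y) z = - D f z.
Proof.
move=> dD sf Uz; rewrite -[RHS]mulN1r -(derZ _ dD sf Uz).
by apply: (der_ext dD) => // y _; rewrite mulN1r.
Qed.

Lemma der_sum D (I : Type) (r : seq I) (P : pred I) (F : I -> V -> C) z :
  derivation U S D -> (forall i, P i -> S (F i)) -> U z ->
  D (fun y => \sum_(i <- r | P i) F i y) z = \sum_(i <- r | P i) D (F i) z.
Proof.
move=> dD sF Uz; elim: r => [|i r IH].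
  rewrite big_nil -[RHS](der_cst dD 0 z).
  by apply: (der_ext dD) => // y _; rewrite big_nil.
rewrite big_cons; case: ifPn => Pi; last first.
  by rewrite -IH; apply: (der_ext dD) => // y _; rewrite big_cons (negPf Pi).
rewrite -IH -(derD dD) //; [|exact: sF|exact: alg_sum].
by apply: (der_ext dD) => // y _; rewrite big_cons Pi.
Qed.

Definition msmooth m n (A : V -> 'M[C]_(m, n)) : Prop :=
  forall p q, S (fun z => A z p q).

Definition mder (D : (V -> C) -> V -> C) m n (A : V -> 'M[C]_(m, n)) (z : V) :
  'M[C]_(m, n) := \matrix_(p, q) D (fun y => A y p q) z.

Lemma msmooth_ext m n (A B : V -> 'M[C]_(m, n)) :
  (forall z, U z -> A z = B z) -> msmooth A -> msmooth B.
Proof.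
by move=> AB sA p q; apply: (alg_ext aS) (sA p q) => // z Uz; rewrite AB.
Qed.

Lemma msmoothD m n (A B : V -> 'M[C]_(m, n)) :
  msmooth A -> msmooth B -> msmooth (fun z => A z + B z).
Proof.
move=> sA sB p q; apply: (alg_ext aS) (algD aS (sA p q) (sB p q)) => // z _.
by rewrite mxE.
Qed.

Lemma msmoothN m n (A : V -> 'M[C]_(m, n)) : msmooth A -> msmooth (fun z => - A z).
Proof.
by move=> sA p q; apply: (alg_ext aS) (algN (sA p q)) => // z _; rewrite mxE.
Qed.

Lemma msmoothB m n (A B : V -> 'M[C]_(m, n)) :
  msmooth A -> msmooth B -> msmooth (fun z => A z - B z).
Proof. by move=> sA sB; exact: msmoothD sA (msmoothN sB). Qed.

Lemma msmoothM m n l (A : V -> 'M[C]_(m, n)) (B : V -> 'M[C]_(n, l)) :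
  msmooth A -> msmooth B -> msmooth (fun z => A z *m B z).
Proof.
move=> sA sB p q.
apply: (alg_ext aS (f := fun z => \sum_j A z p j * B z j q)).
  by move=> z _; rewrite mxE.
by apply: alg_sum => // j _; exact: (algM aS).
Qed.

Lemma msmoothZ m n f (A : V -> 'M[C]_(m, n)) :
  S f -> msmooth A -> msmooth (fun z => f z *: A z).
Proof.
move=> sf sA p q; apply: (alg_ext aS) (algM aS sf (sA p q)) => // z _.
by rewrite mxE.
Qed.

Lemma msmooth_sum m n (I : Type) (r : seq I) (P : pred I)
    (F : I -> V -> 'M[C]_(m, n)) :
  (forall i, P i -> msmooth (F i)) -> msmooth (fun z => \sum_(i <- r | P i) F i z).
Proof.
move=> sF p q.
apply: (alg_ext aS (f := fun z => \sum_(i <- r | P i) F i z p q)).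
  by move=> z _; rewrite summxE.
by apply: alg_sum => // i Pi; exact: sF.
Qed.

Lemma msmooth_ctr m n (A : V -> 'M[C]_(m, n)) :
  msmooth A -> msmooth (fun z => (A z)^t*).
Proof.
move=> sA p q; apply: (alg_ext aS) (alg_conj aS (sA q p)) => // z _.
by rewrite !mxE.
Qed.

Lemma msmooth_tr m n (A : V -> 'M[C]_(m, n)) :
  msmooth A -> msmooth (fun z => (A z)^T).
Proof.
by move=> sA p q; apply: (alg_ext aS) (sA q p) => // z _; rewrite !mxE.
Qed.

Lemma smooth_mxtrace n (A : V -> 'M[C]_n) :
  msmooth A -> S (fun z => \tr (A z)).
Proof. by move=> sA; apply: alg_sum => // i _; exact: sA. Qed.

Lemma smooth_det n (A : V -> 'M[C]_n) :
  msmooth A -> S (fun z => \det (A z)).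
Proof.
move=> sA; apply: alg_sum => // s _; apply: (algM aS) => //.
  exact: (alg_cst aS).
by apply: alg_prod => // i _; exact: sA.
Qed.

Lemma msmooth_inv n (A : V -> 'M[C]_n) :
  (forall z, U z -> A z \in unitmx) -> msmooth A -> msmooth (fun z => invmx (A z)).
Proof.
move=> uA sA; apply: (@msmooth_ext _ _ (fun z => (\det (A z))^-1 *: \adj (A z))).
  by move=> z Uz; rewrite /invmx uA.
have nz z : U z -> \det (A z) != 0.
  by move=> Uz; have := uA z Uz; rewrite unitmxE unitfE.
apply: (msmoothZ (algV aS nz (smooth_det sA))).
move=> p q; apply: (alg_ext aS (f := fun z => cofactor (A z) q p)).
  by move=> z _; rewrite mxE.
apply: (algM aS) => //; first exact: (alg_cst aS).
apply: smooth_det => k l.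
by apply: (alg_ext aS) (sA (lift q k) (lift p l)) => // z _; rewrite !mxE.
Qed.

Section MatrixDerivation.
Variable D : (V -> C) -> V -> C.
Hypothesis dD : derivation U S D.

Lemma msmooth_mder m n (A : V -> 'M[C]_(m, n)) : msmooth A -> msmooth (mder D A).
Proof.
move=> sA p q; apply: (alg_ext aS) (der_smooth dD (sA p q)) => // z _.
by rewrite mxE.
Qed.

Lemma mder_ext m n (A B : V -> 'M[C]_(m, n)) z :
  (forall y, U y -> A y = B y) -> U z -> mder D A z = mder D B z.
Proof.
move=> AB Uz; apply/matrixP => p q; rewrite !mxE; apply: (der_ext dD) => //.
by move=> y Uy; rewrite AB.
Qed.

Lemma mder_cst m n (A : 'M[C]_(m, n)) z : mder D (fun=> A) z = 0.
Proof. by apply/matrixP => p q; rewrite !mxE (der_cst dD). Qed.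

Lemma mderD m n (A B : V -> 'M[C]_(m, n)) z : msmooth A -> msmooth B -> U z ->
  mder D (fun y => A y + B y) z = mder D A z + mder D B z.
Proof.
move=> sA sB Uz; apply/matrixP => p q; rewrite !mxE -(derD dD) //.
by apply: (der_ext dD) => // y _; rewrite mxE.
Qed.

Lemma mderN m n (A : V -> 'M[C]_(m, n)) z : msmooth A -> U z ->
  mder D (fun y => - A y) z = - mder D A z.
Proof.
move=> sA Uz; apply/matrixP => p q; rewrite !mxE -(derN dD) //.
by apply: (der_ext dD) => // y _; rewrite mxE.
Qed.

Lemma mderB m n (A B : V -> 'M[C]_(m, n)) z : msmooth A -> msmooth B -> U z ->
  mder D (fun y => A y - B y) z = mder D A z - mder D B z.
Proof.
by move=> sA sB Uz; rewrite mderD ?mderN //; exact: msmoothN.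
Qed.

Lemma mderM m n l (A : V -> 'M[C]_(m, n)) (B : V -> 'M[C]_(n, l)) z :
  msmooth A -> msmooth B -> U z ->
  mder D (fun y => A y *m B y) z = mder D A z *m B z + A z *m mder D B z.
Proof.
move=> sA sB Uz; apply/matrixP => p q; rewrite !mxE -big_split /=.
transitivity (D (fun y => \sum_j A y p j * B y j q) z).
  by apply: (der_ext dD) => // y _; rewrite mxE.
rewrite (der_sum _ dD) //; last by move=> j _; exact: (algM aS).
by apply: eq_bigr => j _; rewrite (derM dD) // !mxE.
Qed.

Lemma mderZ m n f (A : V -> 'M[C]_(m, n)) z :
  S f -> msmooth A -> U z ->
  mder D (fun y => f y *: A y) z = D f z *: A z + f z *: mder D A z.
Proof.
move=> sf sA Uz; apply/matrixP => p q; rewrite !mxE -(derM dD) //.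
by apply: (der_ext dD) => // y _; rewrite mxE.
Qed.

Lemma mder_sum m n (I : Type) (r : seq I) (P : pred I)
    (F : I -> V -> 'M[C]_(m, n)) z :
  (forall i, P i -> msmooth (F i)) -> U z ->
  mder D (fun y => \sum_(i <- r | P i) F i y) z = \sum_(i <- r | P i) mder D (F i) z.
Proof.
move=> sF Uz; apply/matrixP => p q; rewrite !mxE summxE.
transitivity (D (fun y => \sum_(i <- r | P i) F i y p q) z).
  by apply: (der_ext dD) => // y _; rewrite summxE.
rewrite (der_sum _ dD) //; last by move=> i Pi; exact: sF.
by apply: eq_bigr => i _; rewrite mxE.
Qed.

Lemma der_mxtrace n (A : V -> 'M[C]_n) z : msmooth A -> U z ->
  D (fun y => \tr (A y)) z = \tr (mder D A z).
Proof.
move=> sA Uz; rewrite /mxtrace (der_sum _ dD) //.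
by apply: eq_bigr => i _; rewrite mxE.
Qed.

Lemma mder_inv n (A : V -> 'M[C]_n) z : (forall y, U y -> A y \in unitmx) ->
  msmooth A -> U z ->
  mder D (fun y => invmx (A y)) z = - (invmx (A z) *m mder D A z *m invmx (A z)).
Proof.
move=> uA sA Uz; have sV := msmooth_inv uA sA.
have : mder D (fun y => A y *m invmx (A y)) z = 0.
  rewrite -(@mder_cst n n 1%:M z); apply: mder_ext => // y Uy.
  by rewrite mulmxV // uA.
rewrite mderM // => /eqP; rewrite addrC addr_eq0 => /eqP E.
have := congr1 (mulmx (invmx (A z))) E.
by rewrite (mulKmx (uA _ Uz)) mulmxN mulmxA.
Qed.

End MatrixDerivation.

End Functions.

Section MatrixCalculus.
Variables (n : nat) (U : set V) (S : (V -> C) -> Prop).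
Variables (d db : 'I_n -> (V -> C) -> V -> C).
Hypothesis cS : wirtinger_calculus U S d db.

Lemma mderbar_ctr j m l (A : V -> 'M[C]_(m, l)) z : msmooth S A -> U z ->
  mder (db j) (fun y => (A y)^t*) z = (mder (d j) A z)^t*.
Proof.
move=> sA Uz; apply/matrixP => p q; rewrite !mxE -(calc_conjbar cS j (sA q p)) //.
by apply: (der_ext (calc_derbar cS j)) => // y _; rewrite !mxE.
Qed.

Lemma mder_ctr j m l (A : V -> 'M[C]_(m, l)) z : msmooth S A -> U z ->
  mder (d j) (fun y => (A y)^t*) z = (mder (db j) A z)^t*.
Proof.
move=> sA Uz; apply/matrixP => p q; rewrite !mxE -(calc_conj cS j (sA q p)) //.
by apply: (der_ext (calc_der cS j)) => // y _; rewrite !mxE.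
Qed.

Lemma mderbar_mder j k m l (A : V -> 'M[C]_(m, l)) z : msmooth S A -> U z ->
  mder (db k) (mder (d j) A) z = mder (d j) (mder (db k) A) z.
Proof.
move=> sA Uz; apply/matrixP => p q; rewrite !mxE.
have dj := calc_der cS j; have dk := calc_derbar cS k.
transitivity (db k (d j (fun y => A y p q)) z).
  by apply: (der_ext dk) => // y _; rewrite mxE.
by rewrite (calc_comm cS) //; apply: (der_ext dj) => // y _; rewrite mxE.
Qed.

End MatrixCalculus.

End SmoothAlgebra.

(** * The Wirtinger operators *)

Lemma leibniz_comb (F : comPzRingType) (a b x y x' y' f g : F) :
  a * (x * g + f * x') + b * (y * g + f * y') =
  (a * x + b * y) * g + f * (a * x' + b * y').
Proof. ring. Qed.

Lemma half_comb (F : fieldType) (e x y : F) :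
  2^-1 * x + (e / 2) * y = (x + e * y) / 2.
Proof. by rewrite mulrDl mulrC -!mulrA [2^-1 * y]mulrC. Qed.

Section Wirtinger.
Context {R : realType} {d : nat}.
Local Notation C := R[i].
Local Notation V := (cspace R d).
Variable U : set V.
Hypothesis oU : open U.
Implicit Types (f g : V -> C).
Local Notation derivation := (derivation U (smooth U)).

Lemma smooth_smooth_algebra : smooth_algebra U (smooth U).
Proof.
split.
- by move=> f g fg sf; exact: smooth_ext fg sf.
- exact: smooth_cst.
- by move=> f g; exact: smoothD.
- by move=> f g; exact: smoothM.
- by move=> f; exact: smoothV.
- by move=> f; exact: smooth_conj.
Qed.

Lemma derivation_comb (a b : C) (v w : V) :
  derivation (fun f z => a * cderive v f z + b * cderive w f z).
Proof.
split=> [f sf|f g z fg Uz|c z|f g z sf sg Uz|f g z sf sg Uz].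
- by apply: smoothD => //; apply: smoothM => //;
    [exact: smooth_cst|exact: smooth_cderive|exact: smooth_cst|
     exact: smooth_cderive].
- by rewrite !(cderive_ext oU _ fg).
- by rewrite !cderive_cst !mulr0 addr0.
- by rewrite !(cderiveD _ sf sg) // !mulrDr addrACA.
- by rewrite !(cderiveM _ sf sg) // leibniz_comb.
Qed.

Lemma derivation_eq D D' : (forall f z, D f z = D' f z) ->
  derivation D -> derivation D'.
Proof.
by move=> E dD; have -> : D' = D by apply/funext => f; apply/funext => z.
Qed.

Lemma wirtE j f z :
  2^-1 * cderive (dir_re j) f z + (- 'i%C / 2) * cderive (dir_im j) f z =
  wirt j f z :> C.
Proof. by rewrite half_comb mulNr. Qed.

Lemma wirtbarE j f z :
  2^-1 * cderive (dir_re j) f z + ('i%C / 2) * cderive (dir_im j) f z =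
  wirtbar j f z :> C.
Proof. exact: half_comb. Qed.

Lemma wirt_derivation j : derivation (wirt j).
Proof. by apply: derivation_eq (derivation_comb _ _ _ _); exact: wirtE. Qed.

Lemma wirtbar_derivation j : derivation (wirtbar j).
Proof. by apply: derivation_eq (derivation_comb _ _ _ _); exact: wirtbarE. Qed.

Let derZ D (c : C) f z := @derZ _ _ _ _ smooth_smooth_algebra D c f z.

Lemma cderive_cstM (v : V) (c : C) f z : smooth U f -> U z ->
  cderive v (fun y => c * f y) z = c * cderive v f z.
Proof.
move=> sf Uz; rewrite (cderiveM v (smooth_cst U c) sf Uz) cderive_cst.
by rewrite mul0r add0r.
Qed.

(** Schwarz's theorem extends to constant complex combinations of real
    derivatives, in particular to the Wirtinger operators. *)
Lemma comb_cderiveC D (v : V) f z : derivation D ->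
  (exists a b u w, forall f z, D f z = a * cderive u f z + b * cderive w f z) ->
  smooth U f -> U z -> D (cderive v f) z = cderive v (D f) z.
Proof.
move=> dD [a [b [u [w E]]]] sf Uz; rewrite E.
have -> : D f = fun y => a * cderive u f y + b * cderive w f y.
  by apply/funext => y; exact: E.
have su := smooth_cderive u sf; have sw := smooth_cderive w sf.
have sa := smoothM oU (smooth_cst U a) su.
have sb := smoothM oU (smooth_cst U b) sw.
rewrite [RHS](cderiveD v sa sb Uz).
rewrite (cderive_cstM v a su Uz) (cderive_cstM v b sw Uz).
by rewrite (cderiveC oU v u sf Uz) (cderiveC oU v w sf Uz).
Qed.

Lemma wirtbar_wirt j k f z : smooth U f -> U z ->
  wirtbar k (wirt j f) z = wirt j (wirtbar k f) z.
Proof.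
move=> sf Uz; have sb := der_smooth (wirtbar_derivation k) sf.
rewrite -[RHS]wirtE -!(@comb_cderiveC (wirtbar k)) //; last 4 first.
- exact: wirtbar_derivation.
- by do 4 eexists; move=> f0 z0; rewrite -wirtbarE; reflexivity.
- exact: wirtbar_derivation.
- by do 4 eexists; move=> f0 z0; rewrite -wirtbarE; reflexivity.
have dk := wirtbar_derivation k.
have s1 := smooth_cderive (dir_re j) sf; have s2 := smooth_cderive (dir_im j) sf.
rewrite -!(derZ _ dk) // -(derD dk) //; [|exact/smoothM/s1/smooth_cst|
  exact/smoothM/s2/smooth_cst].
by apply: (der_ext dk) => // y _; rewrite -wirtE.
Qed.

Lemma conj_imaginary : Num.conj ('i%C : C) = - 'i%C.
Proof. by apply/eqP; rewrite eq_complex /= oppr0 !eqxx. Qed.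

Lemma wirt_conj j f z : smooth U f -> U z ->
  wirt j (fun y => Num.conj (f y)) z = Num.conj (wirtbar j f z).
Proof.
move=> sf Uz; rewrite /wirt /wirtbar !(cderive_conj _ sf Uz).
rewrite rmorphM rmorphV ?unitfE ?pnatr_eq0 // rmorphD rmorphM /= rmorph_nat.
by rewrite conj_imaginary mulNr.
Qed.

Lemma wirtbar_conj j f z : smooth U f -> U z ->
  wirtbar j (fun y => Num.conj (f y)) z = Num.conj (wirt j f z).
Proof.
move=> sf Uz; rewrite /wirt /wirtbar !(cderive_conj _ sf Uz).
rewrite rmorphM rmorphV ?unitfE ?pnatr_eq0 // rmorphB rmorphM /= rmorph_nat.
by rewrite conj_imaginary mulNr opprK.
Qed.

Lemma wirtinger_calculus_smooth :
  wirtinger_calculus U (smooth U) (@wirt R d) (@wirtbar R d).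
Proof.
split.
- exact: smooth_smooth_algebra.
- exact: wirt_derivation.
- exact: wirtbar_derivation.
- by move=> j k f z sf Uz; exact: wirtbar_wirt.
- by move=> j f z sf Uz; exact: wirt_conj.
- by move=> j f z sf Uz; exact: wirtbar_conj.
Qed.

End Wirtinger.

(** * Positive Hermitian matrices *)

Section PositiveMatrices.
Context {C : numClosedFieldType}.

Lemma ctr_mul m n p (A : 'M[C]_(m, n)) (B : 'M[C]_(n, p)) :
  (A *m B)^t* = B^t* *m A^t*.
Proof. by rewrite trmx_mul map_mxM. Qed.

Lemma ctrD m n (A B : 'M[C]_(m, n)) : (A + B)^t* = A^t* + B^t*.
Proof. by apply/matrixP => i j; rewrite !mxE rmorphD. Qed.

Lemma ctrB m n (A B : 'M[C]_(m, n)) : (A - B)^t* = A^t* - B^t*.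
Proof. by apply/matrixP => i j; rewrite !mxE rmorphB. Qed.

Lemma ctrK m n (A : 'M[C]_(m, n)) : (A^t*)^t* = A.
Proof. by apply/matrixP => i j; rewrite !mxE conjCK. Qed.

Lemma ctr_unit n (A : 'M[C]_n) : (A^t* \in unitmx) = (A \in unitmx).
Proof. by rewrite map_unitmx unitmx_tr. Qed.

Lemma ctr_inv n (A : 'M[C]_n) : (invmx A)^t* = invmx (A^t*).
Proof. by rewrite trmx_inv map_invmx. Qed.

Lemma invmx_mul n (A B : 'M[C]_n) : A \in unitmx -> B \in unitmx ->
  invmx (A *m B) = invmx B *m invmx A.
Proof.
move=> uA uB; have uAB : A *m B \in unitmx by rewrite unitmx_mul uA.
rewrite -[LHS]mulmx1 -(mulmxV uA) -{2}(mulmxK uB A) -!mulmxA (mulmxA A B).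
by rewrite mulKmx.
Qed.

Lemma mxtrace_ctr n (A : 'M[C]_n) : \tr (A^t*) = Num.conj (\tr A).
Proof. by rewrite /mxtrace rmorph_sum; apply: eq_bigr => i _; rewrite !mxE. Qed.

(** [T] comes from the square roots of the eigenvalues, in a unitary eigenbasis. *)
Lemma posdef_factor n (g : 'M[C]_n) : g^t* = g ->
  (forall v : 'rV[C]_n, v != 0 -> 0 < (v *m g *m v^t*) 0 0) ->
  exists2 T : 'M[C]_n, T \in unitmx & g = T *m T^t*.
Proof.
move=> gh gpos.
have gn : g \is normalmx by apply/normalmxP; rewrite gh.
have gE := orthomx_spectralP gn.
set P := spectralmx g in gE; set e := spectral_diag g in gE.
have Pu : P \is unitarymx := spectral_unitarymx g.
have Pinv := invmx_unitary Pu; have Punit := unitarymx_unit Pu.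
have PgP : P *m g *m P^t* = diag_mx e.
  by rewrite {1}gE -Pinv !mulmxA mulmxV // mul1mx mulmxK.
have e0 i : 0 < e 0 i.
  have v0 : row i P != 0.
    apply: contraTneq isT => r0; have := mulmxV Punit.
    move=> /(congr1 (row i)); rewrite row_mul r0 mul0mx rowE mulmx1.
    by move=> /matrixP/(_ 0 i); rewrite !mxE !eqxx => /eqP; rewrite eq_sym oner_eq0.
  have := gpos _ v0; rewrite -row_mul mxE.
  suff -> : \sum_j row i (P *m g) 0 j * (row i P)^t* j 0 = e 0 i by [].
  transitivity ((P *m g *m P^t*) i i); last by rewrite PgP mxE eqxx.
  by rewrite [RHS]mxE; apply: eq_bigr => j _; rewrite !mxE.
pose s := diag_mx (map_mx sqrtC e).
have ss : s *m s^t* = diag_mx e.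
  have -> : s^t* = s.
    apply/matrixP => i j; rewrite !mxE; case: eqVneq => [->|ij].
      by rewrite !mulr1n geC0_conj // sqrtC_ge0 ltW.
    by rewrite !mulr0n conjC0.
  rewrite mulmx_diag; congr diag_mx; apply/rowP => i.
  by rewrite !mxE -expr2 sqrtCK.
exists (P^t* *m s); last first.
  by rewrite ctr_mul ctrK {1}gE Pinv -ss !mulmxA.
rewrite unitmx_mul ctr_unit Punit /= unitmxE det_diag unitfE prodf_seq_neq0.
by apply/allP => i _ /=; rewrite mxE sqrtC_eq0 gt_eqF.
Qed.

Lemma posdef_unit n (g : 'M[C]_n) : g^t* = g ->
  (forall v : 'rV[C]_n, v != 0 -> 0 < (v *m g *m v^t*) 0 0) -> g \in unitmx.
Proof.
by move=> gh gp; have [T uT ->] := posdef_factor gh gp; rewrite unitmx_mul ctr_unit uT.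
Qed.

Lemma mxtrace_mul_ctr_ge0 m n (A : 'M[C]_(m, n)) : 0 <= \tr (A *m A^t*).
Proof.
apply: sumr_ge0 => i _; rewrite mxE; apply: sumr_ge0 => j _.
by rewrite !mxE -normCK exprn_ge0.
Qed.

Lemma mxtrace_mul_ctr_eq0 m n (A : 'M[C]_(m, n)) : \tr (A *m A^t*) = 0 -> A = 0.
Proof.
have pos i j : 0 <= A i j * (A^t*) j i by rewrite !mxE -normCK exprn_ge0.
move=> /eqP; rewrite psumr_eq0; last first.
  by move=> i _; rewrite mxE; apply: sumr_ge0 => j _.
move=> /allP A0; apply/matrixP => i j; have := A0 i (mem_index_enum i).
rewrite /= mxE psumr_eq0 => [|k _] //.
move=> /allP/(_ j (mem_index_enum j)) /=.
by rewrite !mxE -normCK sqrf_eq0 normr_eq0 => /eqP.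
Qed.

Section HermitianForm.
Variables (r : nat) (H : 'M[C]_r).
Hypothesis Hh : H^t* = H.
Hypothesis Hpos : forall v : 'rV[C]_r, v != 0 -> 0 < (v *m H *m v^t*) 0 0.
Implicit Types X Y : 'M[C]_r.

(** Conjugation by a factor of [H] turns the adjoint for [H] into the conjugate
    transpose, so that the Hermitian norm becomes a sum of squared moduli. *)
Lemma hermitian_norm_factor X : exists2 T : 'M[C]_r, T \in unitmx &
  \tr (X *m (invmx H *m X^t* *m H)) =
  \tr ((T *m X *m invmx T) *m (T *m X *m invmx T)^t*).
Proof.
have [T uT HT] := posdef_factor Hh Hpos; exists (T^t*).
  by rewrite ctr_unit.
rewrite HT invmx_mul ?ctr_unit // !ctr_mul ctr_inv !ctrK.
by rewrite -!mulmxA [RHS]mxtrace_mulC !mulmxA.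
Qed.

Lemma hermitian_norm_ge0 X : 0 <= \tr (X *m (invmx H *m X^t* *m H)).
Proof.
by have [T _ ->] := hermitian_norm_factor X; exact: mxtrace_mul_ctr_ge0.
Qed.

Lemma hermitian_norm_eq0 X : \tr (X *m (invmx H *m X^t* *m H)) = 0 -> X = 0.
Proof.
have [T uT ->] := hermitian_norm_factor X => /mxtrace_mul_ctr_eq0 E.
have := congr1 (fun Z => invmx T *m Z *m T) E.
by rewrite -!mulmxA mulVmx // mulmx1 mulmxA mulVmx // mul1mx mul0mx mulmx0.
Qed.

End HermitianForm.

Section GramContraction.
Variables (r : nat) (H : 'M[C]_r) (I : finType).
Local Notation adj X := (invmx H *m X^t* *m H).

Lemma adj_sum (c : I -> C) (N : I -> 'M[C]_r) :
  adj (\sum_i c i *: N i) = \sum_i Num.conj (c i) *: adj (N i).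
Proof.
rewrite raddf_sum /= map_mx_sum mulmx_sumr mulmx_suml.
by apply: eq_bigr => i _; rewrite linearZ /= map_mxZ -scalemxAr -scalemxAl.
Qed.

(** A kernel that is itself a Gram matrix contracts an indexed family of
    matrices to a sum of norms of combinations of its members. *)
Lemma gram_contraction (J : finType) (K : I -> I -> C) (s : J -> I -> C)
    (N : I -> 'M[C]_r) :
  (forall i i', K i i' = \sum_a s a i * Num.conj (s a i')) ->
  \sum_i \sum_i' K i i' * \tr (N i *m adj (N i')) =
  \sum_a \tr ((\sum_i s a i *: N i) *m adj (\sum_i s a i *: N i)).
Proof.
move=> KE; transitivity (\sum_a \sum_i \sum_i'
    s a i * Num.conj (s a i') * \tr (N i *m adj (N i'))).
  rewrite [RHS]exchange_big; apply: eq_bigr => i _.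
  by rewrite [RHS]exchange_big; apply: eq_bigr => i' _; rewrite KE mulr_suml.
apply: eq_bigr => a _; rewrite adj_sum mulmx_suml raddf_sum.
apply: eq_bigr => i _; rewrite mulmx_sumr raddf_sum; apply: eq_bigr => i' _.
by rewrite -scalemxAl -scalemxAr /= !mxtraceZ mulrA.
Qed.

End GramContraction.

Lemma unit_comb_eq0 n r (S : 'M[C]_n) (G : 'I_n -> 'M[C]_r) : S \in unitmx ->
  (forall a, \sum_l S a l *: G l = 0) -> forall l, G l = 0.
Proof.
move=> uS S0 l; transitivity (\sum_a invmx S l a *: (\sum_m S a m *: G m)).
  under eq_bigr do rewrite scaler_sumr; rewrite exchange_big /=.
  transitivity (\sum_m (invmx S *m S) l m *: G m).
    rewrite mulVmx // (bigD1 l) //= mxE eqxx scale1r big1 ?addr0 // => m ml.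
    by rewrite mxE eq_sym (negPf ml) scale0r.
  apply: eq_bigr => m _; rewrite mxE scaler_suml.
  by apply: eq_bigr => a _; rewrite scalerA.
by apply: big1 => a _; rewrite S0 scaler0.
Qed.

End PositiveMatrices.

(** * Algebra of the curvature term *)

Section CommutatorTrace.
Context {F : comPzRingType} {r : nat}.
Implicit Types X Y Z : 'M[F]_r.

(** As [A] and [A'] commute, the Jacobi identity moves the commutator with [A']
    from [A * B - B * A] onto [B], and the trace then moves the one with [A] onto
    [B'].  With [B], [B'] the adjoints of Higgs components, the right-hand side
    is a product of a commutator with an adjoint commutator. *)
Lemma mxtrace_double_commutator (A A' B B' : 'M[F]_r) : A *m A' = A' *m A ->
  \tr (((A *m B - B *m A) *m A' - A' *m (A *m B - B *m A)) *m B') =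
  \tr ((A' *m B - B *m A') *m (A *m B' - B' *m A)).
Proof.
move=> AA'; rewrite !(mulmxBl, mulmxBr) !raddfB /= !mulmxA.
have -> : \tr (A *m B *m A' *m B') = \tr (B *m A' *m B' *m A).
  by rewrite -!mulmxA mxtrace_mulC !mulmxA.
have -> : B *m A *m A' *m B' = B *m A' *m A *m B' by rewrite -(mulmxA B) AA' mulmxA.
have -> : \tr (A' *m A *m B *m B') = \tr (A' *m B *m B' *m A).
  by rewrite -AA' -!mulmxA mxtrace_mulC !mulmxA.
set a := \tr _; set b := \tr _; set c := \tr _; set e := \tr _.
ring.
Qed.

Lemma mxtrace_commutator (X Y Z : 'M[F]_r) :
  \tr (X *m (Y *m Z - Z *m Y)) = \tr ((Z *m X - X *m Z) *m Y).
Proof.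
rewrite mulmxBr mulmxBl !raddfB /= !mulmxA; congr (_ - _).
by rewrite mxtrace_mulC mulmxA.
Qed.

End CommutatorTrace.

Section BochnerPositivity.
Context {C : numClosedFieldType} (n r : nat).
Variables (g : 'M[C]_n) (H : 'M[C]_r).
Hypothesis gh : g^t* = g.
Hypothesis gpos : forall v : 'rV[C]_n, v != 0 -> 0 < (v *m g *m v^t*) 0 0.
Hypothesis Hh : H^t* = H.
Hypothesis Hpos : forall v : 'rV[C]_r, v != 0 -> 0 < (v *m H *m v^t*) 0 0.
Local Notation W := (invmx g).
Local Notation adj X := (invmx H *m X^t* *m H).

Lemma inverse_gram : exists2 S : 'M[C]_n, S \in unitmx & W = S^t* *m S.
Proof.
have [T uT gT] := posdef_factor gh gpos.
exists (invmx T); first by rewrite unitmx_inv.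
by rewrite gT invmx_mul ?ctr_unit // ctr_inv.
Qed.

Lemma gram_entry (S : 'M[C]_n) m l : W = S^t* *m S ->
  W m l = \sum_a Num.conj (S a m) * S a l.
Proof. by move=> ->; rewrite mxE; apply: eq_bigr => a _; rewrite !mxE. Qed.

(** For a family [Cv j l] that is linear in both indices, the squares are those
    of its components in an orthonormal frame. *)
Lemma derivative_norm_ge0 (Cv : 'I_n -> 'I_n -> 'M[C]_r) :
  0 <= \sum_j \sum_k W k j *
    (\sum_l \sum_m W m l * \tr (Cv j l *m adj (Cv k m))).
Proof.
have [S uS WS] := inverse_gram.
pose s (a i : 'I_n * 'I_n) := S a.1 i.1 * S a.2 i.2.
pose K (i i' : 'I_n * 'I_n) := W i'.1 i.1 * W i'.2 i.2.
have KE i i' : K i i' = \sum_a s a i * Num.conj (s a i').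
  rewrite /K !(gram_entry _ _ WS) big_distrlr /= pair_bigA /=.
  apply: eq_bigr => a _; rewrite /s rmorphM /=; ring.
have := gram_contraction H (fun i => Cv i.1 i.2) KE.
set rhs := (X in _ = X) => E.
suff -> : \sum_j \sum_k W k j *
    (\sum_l \sum_m W m l * \tr (Cv j l *m adj (Cv k m))) = rhs.
  by apply: sumr_ge0 => a _; exact: (hermitian_norm_ge0 Hh Hpos).
rewrite -E -(pair_bigA _ (fun j l => \sum_i' K (j, l) i' *
  \tr (Cv j l *m adj (Cv i'.1 i'.2)))) /=; apply: eq_bigr => j _.
under [RHS]eq_bigr => l _ do rewrite -(pair_bigA _ (fun k m => K (j, l) (k, m) *
  \tr (Cv j l *m adj (Cv k m)))) /=.
rewrite [RHS]exchange_big /=; apply: eq_bigr => k _.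
rewrite mulr_sumr; apply: eq_bigr => l _; rewrite mulr_sumr.
by apply: eq_bigr => m _; rewrite mulrA.
Qed.

(** The commutator [N l k] of a component of the Higgs field with the adjoint of
    another is linear in [l] and antilinear in [k].  The squares are those of its
    components in an orthonormal frame and the conjugate frame, hence the
    conjugate in the weights [s]. *)
Lemma commutator_norm (N : 'I_n -> 'I_n -> 'M[C]_r) :
  let u := \sum_j \sum_k W k j *
    (\sum_l \sum_m W m l * \tr (N l k *m adj (N m j))) in
  0 <= u /\ (u = 0 -> forall j k, N j k = 0).
Proof.
move=> u; have [S uS WS] := inverse_gram.
pose s (a i : 'I_n * 'I_n) := S a.1 i.1 * Num.conj (S a.2 i.2).
pose K (i i' : 'I_n * 'I_n) := W i'.1 i.1 * W i.2 i'.2.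
have KE i i' : K i i' = \sum_a s a i * Num.conj (s a i').
  rewrite /K !(gram_entry _ _ WS) big_distrlr /= pair_bigA /=.
  apply: eq_bigr => a _; rewrite /s rmorphM /= conjCK; ring.
have E := gram_contraction H (fun i => N i.1 i.2) KE.
have uE : u = \sum_i \sum_i' K i i' * \tr (N i.1 i.2 *m adj (N i'.1 i'.2)).
  rewrite -(pair_bigA _ (fun l k => \sum_i' K (l, k) i' *
    \tr (N l k *m adj (N i'.1 i'.2)))) /=.
  under [RHS]eq_bigr => l _ do under eq_bigr => k _ do
    rewrite -(pair_bigA _ (fun m j => K (l, k) (m, j) *
      \tr (N l k *m adj (N m j)))) /= exchange_big /=.
  rewrite /u exchange_big /= [RHS]exchange_big /=; apply: eq_bigr => k _.
  rewrite [RHS]exchange_big /=; apply: eq_bigr => j _.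
  rewrite mulr_sumr; apply: eq_bigr => l _; rewrite mulr_sumr.
  by apply: eq_bigr => m _; rewrite /K /= mulrA [W k j * _]mulrC.
rewrite uE E; split; first by apply: sumr_ge0 => a _; exact: (hermitian_norm_ge0 Hh Hpos).
move=> /eqP; rewrite psumr_eq0; last by move=> a _; exact: (hermitian_norm_ge0 Hh Hpos).
move=> /allP X0.
have X0' a b : \sum_l S a l *: (\sum_k Num.conj (S b k) *: N l k) = 0.
  have := X0 (a, b) (mem_index_enum _) => /= /eqP/(hermitian_norm_eq0 Hh Hpos).
  move=> X0ab; apply: etrans X0ab.
  rewrite -(pair_bigA _ (fun l k => s (a, b) (l, k) *: N l k)) /=.
  apply: eq_bigr => l _; rewrite scaler_sumr; apply: eq_bigr => k _.
  by rewrite scalerA.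
move=> j k.
have uS' : map_mx Num.conj S \in unitmx by rewrite map_unitmx.
apply: (unit_comb_eq0 (G := fun k => N j k) uS') => b.
have := unit_comb_eq0 (G := fun l => \sum_k Num.conj (S b k) *: N l k) uS
  (fun a => X0' a b) j.
by move=> N0; apply: etrans N0; apply: eq_bigr => k' _; rewrite mxE.
Qed.

End BochnerPositivity.

(** * The Bochner formula for a Higgs field in coordinates *)

Section LocalBochner.
Context {C : numClosedFieldType} {V : Type} {n r : nat}.
Variables (U : set V) (S : (V -> C) -> Prop).
Variables (d db : 'I_n -> (V -> C) -> V -> C).
Hypothesis cS : wirtinger_calculus U S d db.
Variables (g : V -> 'M[C]_n) (H : V -> 'M[C]_r) (A : 'I_n -> V -> 'M[C]_r).
Hypothesis sg : msmooth S g.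
Hypothesis gh : forall z, U z -> (g z)^t* = g z.
Hypothesis ug : forall z, U z -> g z \in unitmx.
Hypothesis sH : msmooth S H.
Hypothesis Hh : forall z, U z -> (H z)^t* = H z.
Hypothesis uH : forall z, U z -> H z \in unitmx.
Hypothesis sA : forall j, msmooth S (A j).
Hypothesis hA : forall j k z, U z -> mder (db k) (A j) z = 0.

Let aS : smooth_algebra U S := calc_alg cS.
Let dd (j : 'I_n) : derivation U S (d j) := calc_der cS j.
Let dk (k : 'I_n) : derivation U S (db k) := calc_derbar cS k.
Local Notation "'D[ j ]" := (mder (d j)) (at level 0, j at level 2).
Local Notation "'D`[ k ]" := (mder (db k)) (at level 0, k at level 2).
Local Notation adj z X := (invmx (H z) *m X^t* *m H z).

Definition inverse_metric (z : V) : 'M[C]_n := invmx (g z).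
Definition higgs_adjoint (m : 'I_n) (z : V) : 'M[C]_r := adj z (A m z).
Definition chern_connection (j : 'I_n) (z : V) : 'M[C]_r :=
  invmx (H z) *m 'D[j] H z.
Definition metric_connection (j : 'I_n) (z : V) : 'M[C]_n :=
  'D[j] g z *m inverse_metric z.
(** The covariant derivative along d/dz_j of the component [A l], for the
    connection of End(E) alone. *)
Definition endo_derivative (j l : 'I_n) (z : V) : 'M[C]_r :=
  'D[j] (A l) z +
  (chern_connection j z *m A l z - A l z *m chern_connection j z).
(** The same for the connection of End(E) tensored with the cotangent bundle. *)
Definition higgs_derivative (j l : 'I_n) (z : V) : 'M[C]_r :=
  endo_derivative j l z - \sum_p metric_connection j z l p *: A p z.
Definition higgs_pairing (z : V) : 'M[C]_n :=
  \matrix_(l, m) \tr (A l z *m higgs_adjoint m z).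
(** The squared norm of the Higgs field, whose form indices are contracted with
    the inverse of [g]. *)
Definition higgs_norm (z : V) : C := \tr (inverse_metric z *m higgs_pairing z).

Local Notation W := inverse_metric.
Local Notation B := higgs_adjoint.
Local Notation P := chern_connection.
Local Notation Q := metric_connection.
Local Notation DA := endo_derivative.
Local Notation Cv := higgs_derivative.
Local Notation T := higgs_pairing.

Lemma smooth_W : msmooth S W. Proof. exact: (msmooth_inv aS ug sg). Qed.

Lemma smooth_iH : msmooth S (fun z => invmx (H z)).
Proof. exact: (msmooth_inv aS uH sH). Qed.

Lemma smooth_B m : msmooth S (B m).
Proof.
have sHi := smooth_iH; rewrite /higgs_adjoint.
exact: (msmoothM aS (msmoothM aS sHi (msmooth_ctr aS (sA m))) sH).
Qed.

Lemma smooth_P j : msmooth S (P j).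
Proof. exact: (msmoothM aS smooth_iH (msmooth_mder aS (dd j) sH)). Qed.

Lemma smooth_Q j : msmooth S (Q j).
Proof. exact: (msmoothM aS (msmooth_mder aS (dd j) sg) smooth_W). Qed.

Lemma smooth_DA j l : msmooth S (DA j l).
Proof.
have sP := smooth_P j.
exact: (msmoothD aS (msmooth_mder aS (dd j) (sA l))
  (msmoothB aS (msmoothM aS sP (sA l)) (msmoothM aS (sA l) sP))).
Qed.

Lemma smooth_QA j l : msmooth S (fun z => \sum_p Q j z l p *: A p z).
Proof.
by apply: (msmooth_sum aS) => p _; exact: (msmoothZ aS (smooth_Q j l p) (sA p)).
Qed.

Lemma smooth_Cv j l : msmooth S (Cv j l).
Proof. exact: (msmoothB aS (smooth_DA j l) (smooth_QA j l)). Qed.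

Lemma smooth_T : msmooth S T.
Proof.
move=> l m.
apply: (alg_ext aS (f := fun z => \tr (A l z *m B m z))).
  by move=> z _; rewrite mxE.
exact: (smooth_mxtrace aS (msmoothM aS (sA l) (smooth_B m))).
Qed.

Lemma smooth_higgs_norm : S higgs_norm.
Proof. exact: (smooth_mxtrace aS (msmoothM aS smooth_W smooth_T)). Qed.

Lemma wirtbar_H k z : U z -> 'D`[k] H z = (P k z)^t* *m H z.
Proof.
move=> Uz; rewrite -(mder_ext (dk k) Hh Uz) (mderbar_ctr cS k sH Uz).
rewrite -[X in _ *m X](Hh Uz) -ctr_mul /chern_connection mulmxA mulmxV ?uH // mul1mx //.
Qed.

Lemma wirt_W j z : U z -> 'D[j] W z = - (W z *m Q j z).
Proof. by move=> Uz; rewrite (mder_inv aS (dd j) ug sg Uz) -mulmxA. Qed.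

Lemma wirtbar_g k z : U z -> 'D`[k] g z = ('D[k] g z)^t*.
Proof.
by move=> Uz; rewrite -(mderbar_ctr cS k sg Uz); exact/esym/(mder_ext (dk k) gh).
Qed.

Lemma ctr_W z : U z -> (W z)^t* = W z.
Proof. by move=> Uz; rewrite ctr_inv gh. Qed.

Lemma wirtbar_W k z : U z -> 'D`[k] W z = - ((Q k z)^t* *m W z).
Proof.
move=> Uz; rewrite (mder_inv aS (dk k) ug sg Uz) wirtbar_g //.
by rewrite /metric_connection ctr_mul ctr_W.
Qed.

Lemma wirt_B j m z : U z -> 'D[j] (B m) z = B m z *m P j z - P j z *m B m z.
Proof.
move=> Uz; have sHi := smooth_iH; have sAc := msmooth_ctr aS (sA m).
rewrite (mderM aS (dd j) (msmoothM aS sHi sAc) sH Uz).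
rewrite (mderM aS (dd j) sHi sAc Uz) (mder_ctr cS j (sA m) Uz) hA //.
rewrite trmx0 map_mx0 mulmx0 addr0 (mder_inv aS (dd j) uH sH Uz).
rewrite addrC !mulNmx; congr (_ - _); last by rewrite /P /B !mulmxA.
by rewrite /B /P !mulmxA (mulmxK (uH Uz)).
Qed.

Lemma wirtbar_B k m z : U z -> 'D`[k] (B m) z = adj z (DA k m z).
Proof.
move=> Uz; have sHi := smooth_iH; have sAc := msmooth_ctr aS (sA m).
rewrite (mderM aS (dk k) (msmoothM aS sHi sAc) sH Uz).
rewrite (mderM aS (dk k) sHi sAc Uz) (mderbar_ctr cS k (sA m) Uz).
rewrite (mder_inv aS (dk k) uH sH Uz) wirtbar_H //.
rewrite (mulmxA (invmx (H z)) _ (H z)) (mulmxK (uH Uz)).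
rewrite /DA ctrD ctrB !ctr_mul.
rewrite mulmxDr mulmxBr !mulmxDl !mulNmx !mulmxA addrAC addrC.
by congr (_ + _); rewrite addrC.
Qed.

Lemma wirt_T j z : U z ->
  'D[j] T z = \matrix_(l, m) \tr (DA j l z *m B m z).
Proof.
move=> Uz; apply/matrixP => l m; rewrite !mxE.
transitivity (d j (fun y => \tr (A l y *m B m y)) z).
  by apply: (der_ext (dd j)) => // y _; rewrite mxE.
have sB := smooth_B m.
rewrite (der_mxtrace aS (dd j) (msmoothM aS (sA l) sB) Uz).
rewrite (mderM aS (dd j) (sA l) sB Uz) wirt_B // mxtraceD mxtrace_commutator.
by rewrite -mxtraceD -mulmxDl.
Qed.

(** The adjoints of the components are antiholomorphic up to connection terms,
    so only the first factor of the pairing gets a covariant derivative. *)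
Lemma wirt_higgs_norm j z : U z -> d j higgs_norm z =
  \tr (W z *m \matrix_(l, m) \tr (Cv j l z *m B m z)).
Proof.
move=> Uz; have sW := smooth_W; have sT := smooth_T.
rewrite (der_mxtrace aS (dd j) (msmoothM aS sW sT) Uz).
rewrite (mderM aS (dd j) sW sT Uz) wirt_W // wirt_T // mulNmx -mulmxA addrC -mulmxBr.
congr (\tr (_ *m _)); apply/matrixP => l m; rewrite !mxE mulmxBl raddfB /=.
congr (_ - _); rewrite mulmx_suml raddf_sum; apply: eq_bigr => p _.
by rewrite !mxE -scalemxAl /= mxtraceZ.
Qed.

(** The derivative of the second factor gives the adjoint of a covariant
    derivative; that of the first is a curvature term, by [wirtbar_Cv]. *)
Lemma wirtbar_wirt_higgs_norm j k z : U z -> db k (d j higgs_norm) z =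
  \sum_l \sum_m W z m l * (\tr ('D`[k] (Cv j l) z *m B m z) +
    \tr (Cv j l z *m adj z (Cv k m z))).
Proof.
move=> Uz; have sW := smooth_W.
pose c z := \matrix_(l, m) \tr (Cv j l z *m B m z) : 'M[C]_n.
have sc : msmooth S c.
  move=> l m; apply: (alg_ext aS (f := fun z => \tr (Cv j l z *m B m z))).
    by move=> y _; rewrite mxE.
  exact: (smooth_mxtrace aS (msmoothM aS (smooth_Cv j l) (smooth_B m))).
transitivity (db k (fun y => \tr (W y *m c y)) z).
  by apply: (der_ext (dk k)) => // y Uy; exact: wirt_higgs_norm.
rewrite (der_mxtrace aS (dk k) (msmoothM aS sW sc) Uz).
rewrite (mderM aS (dk k) sW sc Uz) wirtbar_W // mulNmx mxtraceD raddfN /=.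
rewrite -mulmxA mxtrace_mulC addrC -mulmxA -raddfB -mulmxBr /=.
rewrite /mxtrace exchange_big; apply: eq_bigr => m _.
rewrite mxE; apply: eq_bigr => l _; congr (_ * _).
rewrite !mxE.
transitivity (db k (fun y => \tr (Cv j l y *m B m y)) z -
    \sum_p c z l p * (Q k z)^t* p m).
  by congr (_ - _); apply: (der_ext (dk k)) => // y _; rewrite mxE.
rewrite (der_mxtrace aS (dk k) (msmoothM aS (smooth_Cv j l) (smooth_B m)) Uz).
rewrite (mderM aS (dk k) (smooth_Cv j l) (smooth_B m) Uz) mxtraceD -addrA.
congr (_ + _); rewrite wirtbar_B //.
transitivity (\tr (Cv j l z *m (adj z (DA k m z) -
    \sum_p Num.conj (Q k z m p) *: B p z))).
  rewrite mulmxBr raddfB /=; congr (_ - _).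
  rewrite mulmx_sumr raddf_sum; apply: eq_bigr => p _ /=.
  by rewrite -scalemxAr mxtraceZ !mxE mulrC.
congr (\tr (_ *m _)); rewrite /B -adj_sum -mulmxBl -mulmxBr.
by rewrite /Cv ctrB.
Qed.

(** The components are holomorphic, so that only the connection matrices are
    differentiated, which gives curvatures. *)
Lemma wirtbar_Cv j k l z : U z -> 'D`[k] (Cv j l) z =
  ('D`[k] (P j) z *m A l z - A l z *m 'D`[k] (P j) z) -
  \sum_p 'D`[k] (Q j) z l p *: A p z.
Proof.
move=> Uz; have sP := smooth_P j.
rewrite (mderB aS (dk k) (smooth_DA j l) (smooth_QA j l) Uz); congr (_ - _).
  have sPA := msmoothM aS sP (sA l); have sAP := msmoothM aS (sA l) sP.
  rewrite (mderD (dk k) (msmooth_mder aS (dd j) (sA l)) (msmoothB aS sPA sAP) Uz).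
  rewrite (mderbar_mder cS j k (sA l) Uz).
  rewrite (mder_ext (dd j) (hA l k) Uz) (mder_cst (dd j)) add0r.
  rewrite (mderB aS (dk k) sPA sAP Uz) (mderM aS (dk k) sP (sA l) Uz).
  by rewrite (mderM aS (dk k) (sA l) sP Uz) !hA // mulmx0 mul0mx addr0 add0r.
rewrite (mder_sum aS (dk k)) //; last first.
  by move=> p _; exact: (msmoothZ aS (smooth_Q j l p) (sA p)).
apply: eq_bigr => p _; rewrite (mderZ (dk k) (smooth_Q j l p) (sA p) Uz).
by rewrite hA // scaler0 addr0 mxE.
Qed.

Hypothesis cA : forall j k z, U z -> A j z *m A k z = A k z *m A j z.
Hypothesis gK : forall j k l z, U z ->
  d j (fun y => g y k l) z = d k (fun y => g y j l) z.
Hypothesis gKbar : forall j k l z, U z ->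
  db j (fun y => g y k l) z = db l (fun y => g y k j) z.
Hypothesis ricci0 : forall j k z, U z -> \tr ('D`[k] (Q j) z) = 0.
Variable c : C.
Hypothesis ymh : forall z, U z -> \sum_j \sum_k W z k j *:
  (- 'D`[k] (P j) z + (A j z *m B k z - B k z *m A j z)) = c%:M.

(** Up to sign, the curvature of the metric with its last index lowered. *)
Definition metric_curvature (j k : 'I_n) (z : V) : 'M[C]_n :=
  'D`[k] ('D[j] g) z - 'D[j] g z *m W z *m 'D`[k] g z.
Local Notation Rm := metric_curvature.

Lemma wirtbar_Q j k z : U z -> 'D`[k] (Q j) z = Rm j k z *m W z.
Proof.
move=> Uz; have sW := smooth_W; have sdg := msmooth_mder aS (dd j) sg.
rewrite (mderM aS (dk k) sdg sW Uz) (mder_inv aS (dk k) ug sg Uz).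
by rewrite /Rm mulmxBl mulmxN !mulmxA.
Qed.

Lemma metric_curvature_swapl j k l m z : U z -> Rm j k z l m = Rm l k z j m.
Proof.
move=> Uz; have gj q y : U y -> 'D[j] g y l q = 'D[l] g y j q.
  by move=> Uy; rewrite !mxE gK.
rewrite /Rm !mxE; congr (_ - _).
  by apply: (der_ext (dk k)) => // y Uy; exact: gj.
apply: eq_bigr => p _; congr (_ * _); rewrite !mxE.
by apply: eq_bigr => q _; rewrite gj.
Qed.

Lemma metric_curvature_swapr j k l m z : U z -> Rm j k z l m = Rm j m z l k.
Proof.
move=> Uz; have gk p y : U y -> 'D`[k] g y p m = 'D`[m] g y p k.
  by move=> Uy; rewrite !mxE gKbar.
rewrite /Rm !(mderbar_mder cS) // !mxE; congr (_ - _).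
  by apply: (der_ext (dd j)) => // y Uy; exact: gk.
by apply: eq_bigr => p _; rewrite gk.
Qed.

(** The symmetries of the curvature of a Kaehler metric identify this contraction
    of the curvature of the cotangent bundle with the Ricci form, one of whose
    indices is raised. *)
Lemma ricci_contraction l p z : U z ->
  \sum_j \sum_k W z k j * 'D`[k] (Q j) z l p = 0.
Proof.
move=> Uz.
transitivity (\sum_m W z m p * \tr (Rm l m z *m W z)); last first.
  by apply: big1 => m _; rewrite -wirtbar_Q // ricci0 // mulr0.
transitivity (\sum_j \sum_k \sum_m W z m p * (Rm l m z j k * W z k j)).
  apply: eq_bigr => j _; apply: eq_bigr => k _; rewrite wirtbar_Q // mxE mulr_sumr.
  apply: eq_bigr => m _.
  rewrite metric_curvature_swapl // metric_curvature_swapr //.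
  by rewrite mulrA mulrC [W z k j * _]mulrC.
under eq_bigr do rewrite exchange_big; rewrite exchange_big; apply: eq_bigr => m _.
rewrite /mxtrace mulr_sumr; apply: eq_bigr => j _.
by rewrite mxE mulr_sumr.
Qed.

Lemma contraction_exchange (F : 'I_n -> 'I_n -> 'I_n -> 'M[C]_r) z :
  \sum_j \sum_k W z k j * (\sum_l \sum_m W z m l * \tr (F j k l *m B m z)) =
  \sum_l \sum_m W z m l * \tr ((\sum_j \sum_k W z k j *: F j k l) *m B m z).
Proof.
transitivity (\sum_j \sum_k \sum_l \sum_m
    W z m l * (W z k j * \tr (F j k l *m B m z))).
  apply: eq_bigr => j _; apply: eq_bigr => k _; rewrite mulr_sumr.
  apply: eq_bigr => l _; rewrite mulr_sumr; apply: eq_bigr => m _.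
  by rewrite mulrCA.
under eq_bigr do rewrite exchange_big; rewrite exchange_big; apply: eq_bigr => l _.
under eq_bigr do rewrite exchange_big; rewrite exchange_big; apply: eq_bigr => m _.
rewrite mulmx_suml raddf_sum mulr_sumr; apply: eq_bigr => j _.
rewrite /= mulmx_suml raddf_sum mulr_sumr; apply: eq_bigr => k _.
by rewrite -scalemxAl /= mxtraceZ.
Qed.

Let N j k z := A j z *m B k z - B k z *m A j z.

Lemma adj_adj z (X : 'M[C]_r) : U z -> adj z (adj z X) = X.
Proof.
move=> Uz; rewrite !ctr_mul ctr_inv ctrK Hh // !mulmxA mulVmx ?uH // mul1mx.
by rewrite -mulmxA mulVmx ?uH // mulmx1.
Qed.

Lemma adj_mul z (X Y : 'M[C]_r) : U z -> adj z (X *m Y) = adj z Y *m adj z X.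
Proof.
move=> Uz; rewrite ctr_mul !mulmxA; congr (_ *m _ *m _).
by rewrite mulmxK // uH.
Qed.

Lemma adj_commutator m j z : U z ->
  adj z (N m j z) = A j z *m B m z - B m z *m A j z.
Proof.
move=> Uz; have E : adj z (B j z) = A j z := adj_adj (A j z) Uz.
rewrite /N ctrB mulmxBr mulmxBl (adj_mul (A m z) (B j z) Uz).
by rewrite (adj_mul (B j z) (A m z) Uz) E.
Qed.

(** The Yang-Mills-Higgs equation replaces the mean curvature of [H] by
    commutators of the Higgs field, up to a scalar that disappears in the
    commutator with [A l]; the curvature of the cotangent bundle contributes its
    Ricci tensor, which vanishes. *)
Lemma curvature_contraction l z : U z ->
  \sum_j \sum_k W z k j *: 'D`[k] (Cv j l) z =
  \sum_j \sum_k W z k j *: (N j k z *m A l z - A l z *m N j k z).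
Proof.
move=> Uz.
pose K := \sum_j \sum_k W z k j *: 'D`[k] (P j) z.
pose M := \sum_j \sum_k W z k j *: N j k z.
have MK : K = M - c%:M.
  rewrite -(ymh Uz) /M /K -sumrB; apply: eq_bigr => j _.
  rewrite -sumrB; apply: eq_bigr => k _.
  by rewrite -scalerBr opprD opprK addrCA subrr addr0.
have comm (F : 'I_n -> 'I_n -> 'M[C]_r) :
    \sum_j \sum_k W z k j *: (F j k *m A l z - A l z *m F j k) =
    (\sum_j \sum_k W z k j *: F j k) *m A l z
    - A l z *m (\sum_j \sum_k W z k j *: F j k).
  rewrite mulmx_suml mulmx_sumr -sumrB; apply: eq_bigr => j _.
  rewrite mulmx_suml mulmx_sumr -sumrB; apply: eq_bigr => k _.
  by rewrite scalerBr scalemxAl scalemxAr.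
transitivity (\sum_j \sum_k W z k j *:
    ('D`[k] (P j) z *m A l z - A l z *m 'D`[k] (P j) z)); last first.
  rewrite !comm -/K -/M MK mulmxBl mulmxBr opprB addrA.
  by rewrite scalar_mxC subrK.
apply/eqP; rewrite -subr_eq0 -sumrB; apply/eqP.
transitivity (- \sum_p (\sum_j \sum_k W z k j * 'D`[k] (Q j) z l p) *: A p z).
  under [in RHS]eq_bigr do rewrite scaler_suml.
  rewrite [in RHS]exchange_big -sumrN; apply: eq_bigr => j _.
  rewrite -sumrB.
  under [in RHS]eq_bigr do rewrite scaler_suml.
  rewrite [in RHS]exchange_big -sumrN; apply: eq_bigr => k _.
  rewrite wirtbar_Cv // -scalerBr addrAC subrr add0r scalerN scaler_sumr.
  by congr (- _); apply: eq_bigr => p _; rewrite scalerA.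
by rewrite big1 ?oppr0 // => p _; rewrite ricci_contraction // scale0r.
Qed.

(** The Bochner formula.  The first sum is what [curvature_contraction] and
    [mxtrace_double_commutator] make of the curvature term; the second one arises
    when each factor of the norm is differentiated once. *)
Lemma bochner_formula z : U z ->
  \sum_j \sum_k W z k j * db k (d j higgs_norm) z =
  \sum_j \sum_k W z k j *
    (\sum_l \sum_m W z m l * \tr (N l k z *m adj z (N m j z))) +
  \sum_j \sum_k W z k j *
    (\sum_l \sum_m W z m l * \tr (Cv j l z *m adj z (Cv k m z))).
Proof.
move=> Uz.
have -> : \sum_j \sum_k W z k j *
    (\sum_l \sum_m W z m l * \tr (N l k z *m adj z (N m j z))) =
  \sum_j \sum_k W z k j *
    (\sum_l \sum_m W z m l * \tr ('D`[k] (Cv j l) z *m B m z)).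
  rewrite (contraction_exchange (fun j k l => 'D`[k] (Cv j l) z)).
  under [RHS]eq_bigr do under eq_bigr do rewrite curvature_contraction //.
  rewrite -(contraction_exchange
    (fun j k l => N j k z *m A l z - A l z *m N j k z)).
  apply: eq_bigr => j _; apply: eq_bigr => k _; congr (_ * _).
  apply: eq_bigr => l _; apply: eq_bigr => m _; congr (_ * _).
  by rewrite adj_commutator // mxtrace_double_commutator // cA.
rewrite -big_split; apply: eq_bigr => j _ /=; rewrite -big_split.
apply: eq_bigr => k _ /=; rewrite -mulrDr; congr (_ * _).
rewrite wirtbar_wirt_higgs_norm // -big_split; apply: eq_bigr => l _ /=.
by rewrite -big_split; apply: eq_bigr => m _ /=; rewrite mulrDr.
Qed.

Hypothesis gpos : forall z, U z ->
  forall v : 'rV[C]_n, v != 0 -> 0 < (v *m g z *m v^t*) 0 0.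
Hypothesis Hpos : forall z, U z ->
  forall v : 'rV[C]_r, v != 0 -> 0 < (v *m H z *m v^t*) 0 0.

Lemma higgs_norm_subharmonic z : U z ->
  0 <= \sum_j \sum_k W z k j * db k (d j higgs_norm) z.
Proof.
move=> Uz; rewrite bochner_formula //; apply: addr_ge0.
  exact: (commutator_norm (gh Uz) (gpos Uz) (Hh Uz) (Hpos Uz)
    (fun j k => N j k z)).1.
exact: (derivative_norm_ge0 (gh Uz) (gpos Uz) (Hh Uz) (Hpos Uz)
    (fun j l => Cv j l z)).
Qed.

Lemma higgs_norm_harmonic z : U z ->
  \sum_j \sum_k W z k j * db k (d j higgs_norm) z = 0 ->
  forall j k, A j z *m B k z - B k z *m A j z = 0.
Proof.
move=> Uz; rewrite bochner_formula // => /eqP.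
have [N0 NE] := commutator_norm (gh Uz) (gpos Uz) (Hh Uz) (Hpos Uz)
  (fun j k => N j k z).
have C0 := derivative_norm_ge0 (gh Uz) (gpos Uz) (Hh Uz) (Hpos Uz)
  (fun j l => Cv j l z).
by rewrite paddr_eq0 // => /andP[/eqP u0 _] j k; exact: NE.
Qed.

End LocalBochner.

(** * The strong maximum principle *)

Section EuclideanNorm.
Context {R : realType} {d : nat}.
Local Notation V := (cspace R d).
Implicit Types x y z : V.

Lemma continuous_bigsum (I : Type) (s : seq I) (F : I -> V -> R) :
  (forall i, continuous (F i)) -> continuous (fun x => \sum_(i <- s) F i x).
Proof.
move=> cF; elim: s => [|i s IH].
  by under eq_fun do rewrite big_nil; exact: cst_continuous.
under eq_fun do rewrite big_cons.
by move=> x; apply: continuousD; [exact: cF|exact: IH].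
Qed.

Definition dot x y : R :=
  \sum_j x.1 0 j * y.1 0 j + \sum_j x.2 0 j * y.2 0 j.
Definition sqnorm x : R := dot x x.

Lemma dotC x y : dot x y = dot y x.
Proof. by congr (_ + _); apply: eq_bigr => j _; rewrite mulrC. Qed.

Lemma dotDl x y z : dot (x + y) z = dot x z + dot y z.
Proof.
rewrite /dot addrACA; congr (_ + _); rewrite -big_split /=;
  by apply: eq_bigr => j _; rewrite mxE mulrDl.
Qed.

Lemma dotZl (c : R) x y : dot (c *: x) y = c * dot x y.
Proof.
rewrite /dot mulrDr !mulr_sumr.
by congr (_ + _); apply: eq_bigr => j _; rewrite mxE mulrA.
Qed.

Lemma dotDr x y z : dot x (y + z) = dot x y + dot x z.
Proof. by rewrite dotC dotDl !(dotC x). Qed.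

Lemma dotZr (c : R) x y : dot x (c *: y) = c * dot x y.
Proof. by rewrite dotC dotZl dotC. Qed.

Lemma sqnorm_ge0 x : 0 <= sqnorm x.
Proof. by apply: addr_ge0; apply: sumr_ge0 => j _; rewrite -expr2 sqr_ge0. Qed.

Lemma sqnormN x : sqnorm (- x) = sqnorm x.
Proof. by rewrite /sqnorm -scaleN1r dotZl dotZr !mulN1r opprK. Qed.

Lemma sqnorm_line x y (t : R) :
  sqnorm (t *: y + x) = sqnorm x + 2 * dot x y * t + sqnorm y * t ^+ 2.
Proof. by rewrite /sqnorm !(dotDl, dotDr, dotZl, dotZr) (dotC y x); ring. Qed.

Lemma sqnorm_triangle x y : sqnorm (x + y) <= 2 * sqnorm x + 2 * sqnorm y.
Proof.
have := sqnorm_ge0 (x - y).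
rewrite /sqnorm -scaleN1r !(dotDl, dotDr, dotZl, dotZr) (dotC y x); lra.
Qed.

Lemma norm_sqnorm x (e : R) : 0 <= e -> sqnorm x <= e ^+ 2 -> `|x| <= e.
Proof.
move=> e0 xe.
have aux (v : 'rV[R]_d) : \sum_j v 0 j * v 0 j <= e ^+ 2 -> `|v| <= e.
  move=> ve; rewrite [X in X <= _]/Num.norm /= mx_normrE; apply: bigmax_le => // i _.
  rewrite -(ler_pXn2r (_ : 0 < 2)%N) ?nnegrE // real_normK ?num_real //.
  apply: le_trans ve; rewrite (bigD1 i.2) //= (ord1 i.1) expr2 lerDl.
  by apply: sumr_ge0 => j _; rewrite -expr2 sqr_ge0.
have s1 : 0 <= \sum_j x.1 0 j * x.1 0 j.
  by apply: sumr_ge0 => j _; rewrite -expr2 sqr_ge0.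
have s2 : 0 <= \sum_j x.2 0 j * x.2 0 j.
  by apply: sumr_ge0 => j _; rewrite -expr2 sqr_ge0.
rewrite [X in X <= _]/Num.norm /= ge_max; apply/andP.
split; apply: aux; apply: le_trans xe; rewrite /sqnorm /dot.
  by rewrite lerDl.
by rewrite lerDr.
Qed.

Lemma continuous_sqnorm (q : V) : continuous (fun x => sqnorm (x - q)).
Proof.
have cont_coord (v : 'rV[R]_d) (pr : V -> 'rV[R]_d) j : continuous pr ->
    continuous (fun x => pr x 0 j - v 0 j).
  move=> cpr x; apply: continuousB; last exact: cst_continuous.
  by apply: (@continuous_comp _ _ _ pr (fun w => w 0 j));
    [exact: cpr|exact: coord_continuous].
have cont_sum (v : 'rV[R]_d) (pr : V -> 'rV[R]_d) : continuous pr ->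
    continuous (fun x => \sum_j (pr x 0 j - v 0 j) * (pr x 0 j - v 0 j)).
  move=> cpr; apply: continuous_bigsum => j x.
  by have cj := @cont_coord v pr j cpr; exact: (continuousM (cj x) (cj x)).
have -> : (fun x => sqnorm (x - q)) = (fun x =>
    \sum_j (x.1 0 j - q.1 0 j) * (x.1 0 j - q.1 0 j) +
    \sum_j (x.2 0 j - q.2 0 j) * (x.2 0 j - q.2 0 j)).
  apply/funext => x; rewrite /sqnorm /dot.
  by congr (_ + _); apply: eq_bigr => j _; rewrite !mxE.
move=> x; apply: continuousD.
  exact: (@cont_sum q.1 (fun x => x.1) (fun x => cvg_fst)).
exact: (@cont_sum q.2 (fun x => x.2) (fun x => cvg_snd)).
Qed.

(** The space carries the maximum norm, so a Euclidean ball is placed inside a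
    product of compact balls for that norm. *)
Lemma compact_sqnorm_ball (p : V) (e : R) : compact [set x | sqnorm (x - p) <= e ^+ 2].
Proof.
wlog e0 : e / 0 <= e.
  move=> H; have [/H //|/ltW e0] := leP 0 e.
  by rewrite -sqrrN; apply: H; rewrite oppr_ge0.
pose rect := [set a : 'rV[R]_d | `|a - p.1| <= e] `*`
             [set b : 'rV[R]_d | `|b - p.2| <= e].
have cball (v : 'rV[R]_d) : compact [set a : 'rV[R]_d | `|a - v| <= e].
  apply: bounded_closed_compact.
    exists (e + `|v|); split; first exact: num_real.
    move=> M HM a /= av; apply: le_trans (ltW HM).
    by rewrite -(subrK v a) (le_trans (ler_normD _ _)) // lerD2r.
  have -> : [set a : 'rV[R]_d | `|a - v| <= e] = closed_ball_ Num.norm v e.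
    by apply/seteqP; split=> a; rewrite /closed_ball_ /= distrC.
  exact: closed_closed_ball_.
apply: (@subclosed_compact _ _ rect).
- apply: (@closed_comp _ _ (fun x => sqnorm (x - p)) [set t | t <= e ^+ 2]).
    by move=> x _; exact: continuous_sqnorm.
  exact: closed_le.
- by apply: compact_setX; exact: cball.
- move=> x /= xe; have : `|x - p| <= e by exact: norm_sqnorm.
  by rewrite [X in X <= _]/Num.norm /= ge_max => /andP[].
Qed.

End EuclideanNorm.

Section MaximumPrinciple.
Context {R : realType}.

(** The first derivative vanishes at the maximum; with a positive second
    derivative it would be positive just after, and [f] would increase. *)
Lemma second_derivative_at_max (f f1 : R -> R) (c e : R) : 0 < e ->
  (forall t : R, `|t| < e -> is_derive t (1 : R) f (f1 t)) ->
  is_derive (0 : R) (1 : R) f1 c ->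
  (forall t : R, `|t| < e -> f t <= f 0) -> c <= 0.
Proof.
move=> e0 df df1 fmax; rewrite leNgt; apply/negP => c0.
have itvE t : t \in `]-e, e[%R -> `|t| < e by rewrite in_itv /= ltr_norml.
have n0 : `|0 : R| < e by rewrite normr0.
have f10 : f1 0 = 0.
  have Ne : - e <= e by lra.
  have := @derive1_at_max R f (- e) e 0 Ne.
  have H1 t : t \in `]-e, e[%R -> derivable f t 1 by move=> /itvE/df[].
  have H2 : 0 \in `]-e, e[%R by rewrite in_itv /= oppr_lt0 e0.
  have H3 t : t \in `]-e, e[%R -> f t <= f 0 by move=> /itvE/fmax.
  move=> /(_ H1 H2 H3) d0; have d1 := df _ n0.
  by rewrite -(@derive_val _ _ _ _ _ _ _ d1) (@derive_val _ _ _ _ _ _ _ d0).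
have c2 : 0 < c / 2 by lra.
have [k k0 hk] := derive_expansion (@ex_derive _ _ _ _ _ _ _ df1) c2.
pose t := Num.min k e / 2.
have m0 : 0 < Num.min k e by rewrite lt_min k0.
have : Num.min k e <= k by rewrite ge_min lexx.
have : Num.min k e <= e by rewrite ge_min lexx orbT.
have t2 : t * 2 = Num.min k e by rewrite /t; field.
move=> me mk; have t0 : 0 < t by lra.
have te : t < e by lra.
have tk : t < k by lra.
have [||s st E] := @MVT R f f1 0 t t0.
- by move=> s /itvP st; apply: df; rewrite gtr0_norm ?st // (lt_trans _ te) ?st.
- apply: derivable_within_continuous => s /itvP st.
  have se : `|s| < e by rewrite ger0_norm ?st // (le_lt_trans _ te) ?st.
  by have [] := df _ se.
have s0 : 0 < s by rewrite (itvP st).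
have sk : 0 < s < k by rewrite s0 (lt_trans _ tk) ?(itvP st).
have := hk _ sk; rewrite (@derive_val _ _ _ _ _ _ _ df1) f10 subr0 addr0.
rewrite [s *: 1]mulr1 ltr_norml => /andP[H _].
have f1s : 0 < f1 s.
  have : s * c - c / 2 * s = c / 2 * s by field.
  have : 0 < c / 2 * s by rewrite mulr_gt0.
  lra.
have tE : `|t| < e by rewrite gtr0_norm.
have := fmax _ tE; rewrite -subr_le0 E subr0 leNgt => /negP; apply.
exact: mulr_gt0.
Qed.

Lemma is_derive_quad (a b c t : R) :
  is_derive t (1 : R) (fun t => a + b * t + c * t ^+ 2) (b + 2 * c * t).
Proof.
have -> : (fun t => a + b * t + c * t ^+ 2) =
   cst a + b *: (@id R) + c *: (@id R) ^+ 2.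
  by apply/funext => x; rewrite !fctE.
have d2 : is_derive t (1 : R) ((@id R) ^+ 2) _ := is_deriveX _ (is_derive_id t (1 : R)).
have dD := is_deriveD (is_deriveD (is_derive_cst a t (1 : R))
  (is_deriveZ b (is_derive_id t (1 : R)))) (is_deriveZ c d2).
apply: (@is_derive_eq _ _ _ _ _ _ _ _ dD).
rewrite add0r expr1 /GRing.scale /=; ring.
Qed.

Lemma is_derive_gauss (al a b c t : R) :
  is_derive t (1 : R) (fun t => expR (- al * (a + b * t + c * t ^+ 2)))
    (- al * (b + 2 * c * t) * expR (- al * (a + b * t + c * t ^+ 2))).
Proof.
have dq := is_derive_quad (- al * a) (- al * b) (- al * c) t.
have -> : (fun t => expR (- al * (a + b * t + c * t ^+ 2))) =
  expR \o (fun t => - al * a + - al * b * t + - al * c * t ^+ 2).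
  by apply/funext => x /=; congr expR; ring.
apply: is_derive_eq.
rewrite /GRing.scale /=.
rewrite (_ : - al * a + - al * b * t + - al * c * t ^+ 2 =
   - al * (a + b * t + c * t ^+ 2)); ring.
Qed.

Lemma is_derive_gauss2 (al a b c : R) :
  is_derive (0 : R) (1 : R)
    (fun t => - al * (b + 2 * c * t) * expR (- al * (a + b * t + c * t ^+ 2)))
    (((al * b) ^+ 2 - 2 * al * c) * expR (- al * a)).
Proof.
have dg := is_derive_gauss al a b c 0.
have dl := is_derive_quad (- al * b) (- al * (2 * c)) 0 (0 : R).
have -> : (fun t => - al * (b + 2 * c * t) * expR (- al * (a + b * t + c * t ^+ 2)))
  = (fun t => - al * b + - al * (2 * c) * t + 0 * t ^+ 2) *
    (fun t => expR (- al * (a + b * t + c * t ^+ 2))).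
  by apply/funext => x /=; rewrite fctE; ring.
apply: is_derive_eq.
rewrite /GRing.scale /= !mulr0 expr0n /= !addr0 !mulr0 !addr0; ring.
Qed.

Section LocalMaximum.
Context {d : nat}.
Local Notation V := (cspace R d).
Variables (U : set V) (u : V -> R) (M Lam : R).
Hypothesis oU : open U.
Hypothesis u2 : Ck 2 U u.
Hypothesis uM : forall z, U z -> u z <= M.
Hypothesis Lam0 : 0 < Lam.
(** [u] is subharmonic for a uniformly elliptic operator which, at each point,
    is a sum of squares of directional derivatives. *)
Hypothesis elliptic : forall z, U z -> exists (I : finType) (xi : I -> V),
  [/\ 0 <= \sum_a 'D_(xi a) ('D_(xi a) u) z,
      forall y : V, sqnorm y <= Lam * \sum_a dot y (xi a) ^+ 2 &
      \sum_a sqnorm (xi a) <= Lam].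

Let gauss (al : R) (q x : V) : R := expR (- al * sqnorm (x - q)).

(** At an interior maximum of [u] plus a multiple of the barrier [gauss], the
    second derivatives in the directions [xi a] would sum to something both
    nonpositive and positive. *)
Lemma no_interior_max (al eps r0 : R) (q x : V) :
  0 < al -> 0 < eps -> 0 < r0 -> r0 <= sqnorm (x - q) -> Lam ^+ 2 < 2 * r0 * al ->
  U x ->
  ~ (\forall y \near x, u y + eps * gauss al q y <= u x + eps * gauss al q x).
Proof.
move=> al0 eps0 r00 rx alL Ux.
move=> /nbhs_ballP[e0 /= e00 he0].
have [e1 e10 he1] := open_dist oU Ux.
have [I [xi [L0 L1 L2]]] := elliptic Ux.
pose E := gauss al q x.
have E0 : 0 < E by exact: expR_gt0.
have step a : 'D_(xi a) ('D_(xi a) u) x +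
    eps * (((al * (2 * dot (x - q) (xi a))) ^+ 2 - 2 * al * sqnorm (xi a)) * E) <= 0.
  set v := xi a.
  have [_ Hu] := u2; have [du [_ Hdu]] := Hu v; have [ddu _] := Hdu v.
  have m0 : 0 < Num.min e0 e1 by rewrite lt_min e00.
  have [t0 t00 ht0] := small_scale m0 (normr_ge0 v).
  have small (t : R) : `|t| < t0 -> `|t *: v| < Num.min e0 e1.
    move=> tt0; rewrite normrZ; have [->|tn0] := eqVneq t 0.
      by rewrite normr0 mul0r.
    have nt0 : 0 < `|t| <= t0 by rewrite normr_gt0 tn0 ltW.
    apply: le_lt_trans (ht0 _ nt0); rewrite mulrDr mulr1 lerDl; exact: normr_ge0.
  pose s (t : R) := sqnorm (x - q) + 2 * dot (x - q) v * t + sqnorm v * t ^+ 2.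
  have sE t : gauss al q (t *: v + x) = expR (- al * s t).
    by rewrite /gauss -addrA sqnorm_line.
  pose f (t : R) := u (t *: v + x) + eps * expR (- al * s t).
  pose f1 (t : R) := 'D_v u (t *: v + x) + eps *
    (- al * (2 * dot (x - q) v + 2 * sqnorm v * t) * expR (- al * s t)).
  apply: (@second_derivative_at_max f f1 _ t0 t00).
  - move=> t tt0; have Ut : U (t *: v + x).
      by apply: he1; rewrite addrK; have := small _ tt0; rewrite lt_min => /andP[].
    have d1 := derivable_line (du _ Ut).
    have d2 := is_derive_gauss al (sqnorm (x - q)) (2 * dot (x - q) v) (sqnorm v) t.
    exact: (is_deriveD d1 (is_deriveZ eps d2)).
  - have U0 : derivable ('D_v u) (0 *: v + x) v by rewrite scale0r add0r; exact: ddu.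
    have d1 := derivable_line U0; rewrite scale0r add0r in d1.
    have d2 := is_derive_gauss2 al (sqnorm (x - q)) (2 * dot (x - q) v) (sqnorm v).
    exact: (is_deriveD d1 (is_deriveZ eps d2)).
  - move=> t tt0; rewrite /f -!sE scale0r add0r; apply: he0.
    rewrite -ball_normE /= opprD addrCA subrr addr0 normrN.
    by have := small _ tt0; rewrite lt_min => /andP[].
have : \sum_a ('D_(xi a) ('D_(xi a) u) x +
    eps * (((al * (2 * dot (x - q) (xi a))) ^+ 2 - 2 * al * sqnorm (xi a)) * E)) <= 0.
  by rewrite -oppr_ge0 -sumrN; apply: sumr_ge0 => a _; rewrite oppr_ge0.
rewrite big_split /= -mulr_sumr -mulr_suml sumrB -mulr_sumr leNgt => /negP; apply.
apply: ltr_wpDl => //; rewrite mulr_gt0 // mulr_gt0 // subr_gt0.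
under [ltRHS]eq_bigr do rewrite !exprMn mulrA.
rewrite -mulr_sumr.
move: L2 (L1 (x - q)).
set X := \sum_a sqnorm _; set Y := \sum_a dot _ _ ^+ 2 => L2 L1'.
have Yr : r0 <= Lam * Y by exact: le_trans rx L1'.
have h1 : 2 * al * X <= 2 * al * Lam by rewrite ler_wpM2l // mulr_ge0 // ltW.
apply: le_lt_trans h1 _.
rewrite -(ltr_pM2l Lam0).
have -> : Lam * (2 * al * Lam) = 2 * al * Lam ^+ 2 by ring.
have -> : Lam * (al ^+ 2 * 2 ^+ 2 * Y) = 4 * al ^+ 2 * (Lam * Y) by ring.
have h2 : 4 * al ^+ 2 * r0 <= 4 * al ^+ 2 * (Lam * Y).
  by rewrite ler_wpM2l // mulr_ge0 // sqr_ge0.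
apply: lt_le_trans h2.
have -> : 4 * al ^+ 2 * r0 = 2 * al * (2 * r0 * al) by ring.
by rewrite ltr_pM2l // mulr_gt0.
Qed.

(** Hopf's argument.  If [u] is smaller than [M] at a point [q] close to [p],
    then on the part of a ball around [p] outside a small ball around [q], the
    sum of [u] and of a small multiple of a Gaussian centred at [q] has its
    maximum in the interior: the Gaussian is larger at [p] than on the outer
    sphere, and on the inner sphere [u] stays away from [M]. *)
Lemma max_locally_constant p : U p -> u p = M -> \forall q \near p, u q = M.
Proof.
have ar1 (m v gx gp e : R) : M + gp <= v + gx -> v < m -> gx <= e * 1 ->
  e * 2 = M - m -> m < M -> 0 < gp -> False by move=> *; lra.
have ar2 (x q t : R) : t <= 2 * x + 2 * q -> q < t / 4 -> q < x.
  by move=> *; lra.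
have ar3 (v gx gp : R) : M + gp <= v + gx -> gx < gp -> v <= M -> False.
  by move=> *; lra.
move=> Up up.
have [cu _] := u2.
have [de de0 hde] := open_dist oU Up.
(* The ball of radius rho around p lies in U, and q is taken in the ball of
   radius rho / 2, so that p is closer to q than the outer sphere is. *)
pose rho := de / 2; have rho0 : 0 < rho by rewrite divr_gt0.
have rho_de : rho < de by rewrite /rho; lra.
have KU x : sqnorm (x - p) <= rho ^+ 2 -> U x.
  move=> xK; apply: hde; apply: le_lt_trans rho_de.
  by apply: norm_sqnorm => //; exact: ltW.
have cs q : continuous (fun x : V => sqnorm (x - q)) := @continuous_sqnorm _ _ q.
have oball q c : open [set x : V | sqnorm (x - q) < c].
  by apply: (@open_comp _ _ (fun x => sqnorm (x - q)) [set t | t < c]);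
    [move=> x _; exact: cs|exact: open_lt].
have rho24 : 0 < rho ^+ 2 / 4 by rewrite divr_gt0 // exprn_gt0.
have nearq : \forall q \near p, sqnorm (q - p) < rho ^+ 2 / 4.
  apply: open_nbhs_nbhs; split; first exact: oball.
  by rewrite /= subrr /sqnorm -[0](scale0r 0) dotZl mul0r.
apply: filterS nearq => q qp.
have rho4 : rho ^+ 2 / 4 <= rho ^+ 2 by lra.
have Uq : U q by apply: KU; exact: ltW (lt_le_trans qp rho4).
apply/eqP; rewrite eq_le uM //= leNgt; apply/negP => uq.
have gap : 0 < (M - u q) / 2 by lra.
pose m := (u q + M) / 2.
have [eta eta0 heta] := continuous_for_dist (cu _ Uq) gap.
pose r0 := (eta / 2) ^+ 2.
have r00 : 0 < r0 by rewrite exprn_gt0 // divr_gt0.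
have um y : sqnorm (y - q) <= r0 -> u y < m.
  move=> yq; have eta2 : 0 <= eta / 2 by rewrite divr_ge0 // ltW.
  have := norm_sqnorm eta2 yq => yq'.
  have yq2 : `|y - q| < eta by apply: le_lt_trans yq' _; lra.
  have := heta _ yq2; rewrite ltr_norml /m => /andP[_]; lra.
have mM : m < M by rewrite /m; lra.
have pq : sqnorm (p - q) = sqnorm (q - p) by rewrite -sqnormN opprB.
have r0R : r0 < sqnorm (p - q).
  by rewrite ltNge; apply/negP => /um; rewrite up; lra.
(* Fast enough decay makes the Gaussian strictly subharmonic outside the small
   ball around q, whose squared radius is r0. *)
pose al := Lam ^+ 2 / (2 * r0) + 1.
have al0 : 0 < al by rewrite ltr_wpDl // divr_ge0 ?sqr_ge0 // mulr_ge0 // ltW.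
have alL : Lam ^+ 2 < 2 * r0 * al.
  rewrite /al mulrDr mulr1 mulrC divfK ?lt0r_neq0 ?mulr_gt0 //.
  by rewrite ltrDl mulr_gt0.
(* The Gaussian is at most 1, so this multiple of it does not fill the gap
   between m and M on the inner sphere. *)
pose eps := (M - m) / 2; have eps0 : 0 < eps by rewrite divr_gt0 // subr_gt0.
pose w (x : V) := u x + eps * gauss al q x.
pose Om := [set x : V | sqnorm (x - p) <= rho ^+ 2] `&`
  [set x : V | r0 <= sqnorm (x - q)].
have cOm : compact Om.
  apply: compact_closedI; first exact: compact_sqnorm_ball.
  by apply: (@closed_comp _ _ (fun x => sqnorm (x - q)) [set t | r0 <= t]);
    [move=> x _; exact: cs|exact: closed_ge].
have OmU x : Om x -> U x by move=> [xK _]; exact: KU.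
have cg : continuous (gauss al q).
  move=> x; apply: (@continuous_comp _ _ _ (fun x => - al * sqnorm (x - q)) expR).
    by apply: continuousM; [exact: cst_continuous|exact: cs].
  exact: continuous_expR.
have cw : {within Om, continuous w}.
  apply: continuous_in_subspaceT => x; rewrite inE => /OmU Ux.
  exact: (continuousD (cu _ Ux)
    (continuousM (@cst_continuous _ _ eps x) (cg x))).
have Omp : Om p.
  split=> /=; last exact: ltW.
  by rewrite subrr /sqnorm -[0](scale0r 0) dotZl mul0r sqr_ge0.
have [x xOm xmax] := compact_EVT_max (ex_intro _ p Omp) cOm cw.
rewrite inE in xOm; have [xK xq] := xOm; rewrite /= in xK xq.
have wp : w p <= w x by apply: xmax; rewrite inE.
have g0 y : 0 < gauss al q y by exact: expR_gt0.
have g1 y : gauss al q y <= 1.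
  by rewrite -expR0 ler_expR mulNr oppr_le0 mulr_ge0 ?sqnorm_ge0 // ltW.
have egp : 0 < eps * gauss al q p by rewrite mulr_gt0.
have xq' : r0 < sqnorm (x - q).
  rewrite lt_neqAle xq andbT; apply/negP => /eqP xr.
  have /um ux : sqnorm (x - q) <= r0 by rewrite xr.
  have egx : eps * gauss al q x <= eps * 1 by rewrite ler_wpM2l // ltW.
  have e2 : eps * 2 = M - m by rewrite /eps; field.
  by move: wp; rewrite /w up => wp; exact: (ar1 _ _ _ _ _ wp ux egx e2 mM egp).
have xK' : sqnorm (x - p) < rho ^+ 2.
  rewrite lt_neqAle xK andbT; apply/negP => /eqP xr.
  have := sqnorm_triangle (x - q) (q - p); rewrite addrA subrK xr => tri.
  have gx : gauss al q x < gauss al q p.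
    rewrite ltr_expR !mulNr ltrN2 ltr_pM2l // pq.
    exact: ar2 tri qp.
  have egx : eps * gauss al q x < eps * gauss al q p by rewrite ltr_pM2l.
  by move: wp; rewrite /w up => wp; exact: (ar3 _ _ _ wp egx (uM (OmU _ xOm))).
apply: (no_interior_max al0 eps0 r00 (ltW xq') alL (OmU _ xOm)).
have nx : \forall y \near x, sqnorm (y - p) < rho ^+ 2 /\ r0 < sqnorm (y - q).
  apply: filterI; apply: open_nbhs_nbhs; split=> //; first exact: oball.
  by apply: (@open_comp _ _ (fun x => sqnorm (x - q)) [set t | r0 < t]);
    [move=> y _; exact: cs|exact: open_gt].
apply: filterS nx => y [yp yq]; apply: xmax.
by rewrite inE; split; exact: ltW.
Qed.

End LocalMaximum.

End MaximumPrinciple.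

(** * The metric Laplacian as a sum of squares of real derivatives *)

Section WirtingerSquares.
Context {C : numClosedFieldType} {V : Type} {n : nat}.
Variables (U : set V) (S : (V -> C) -> Prop).
Variables (d db : 'I_n -> (V -> C) -> V -> C).
Hypothesis cS : wirtinger_calculus U S d db.

(** With [b] the conjugate of [a] this is the real derivative in the direction
    [a] of C^n = R^2n. *)
Definition real_derivative (a b : 'I_n -> C) (f : V -> C) (z : V) : C :=
  \sum_j (a j * d j f z + b j * db j f z).

Let aS := calc_alg cS.

Lemma smooth_terms a b f j : S f -> S (fun z => a * d j f z + b * db j f z).
Proof.
move=> sf; apply: (algD aS); apply: (algM aS); first exact: (alg_cst aS).
- exact: (der_smooth (calc_der cS j)).
- exact: (alg_cst aS).
- exact: (der_smooth (calc_derbar cS j)).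
Qed.

Lemma der_terms D a b f j z : derivation U S D -> S f -> U z ->
  D (fun z => a * d j f z + b * db j f z) z = a * D (d j f) z + b * D (db j f) z.
Proof.
move=> dD sf Uz; have s1 := der_smooth (calc_der cS j) sf.
have s2 := der_smooth (calc_derbar cS j) sf.
rewrite (derD dD (algM aS (alg_cst aS a) s1) (algM aS (alg_cst aS b) s2) Uz).
by rewrite (derZ aS _ dD s1 Uz) (derZ aS _ dD s2 Uz).
Qed.

Lemma real_derivative2 a b f z : S f -> U z ->
  real_derivative a b (real_derivative a b f) z =
  \sum_k \sum_j (a k * a j * d k (d j f) z + a k * b j * d k (db j f) z +
                 b k * a j * db k (d j f) z + b k * b j * db k (db j f) z).
Proof.
move=> sf Uz; apply: eq_bigr => k _.
have dk := calc_der cS k; have dbk := calc_derbar cS k.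
rewrite /real_derivative (der_sum aS _ dk) //; last first.
  by move=> j _; exact: smooth_terms.
rewrite (der_sum aS _ dbk) //; last by move=> j _; exact: smooth_terms.
rewrite !mulr_sumr -big_split; apply: eq_bigr => j _ /=.
rewrite !der_terms //; ring.
Qed.

(** Adding the second derivative in the direction [e a], where [e] is an
    imaginary unit, cancels the terms without a mixed derivative. *)
Lemma sum_squares (e : C) a b f z : e * e = -1 -> S f -> U z ->
  real_derivative a b (real_derivative a b f) z +
  real_derivative (fun j => e * a j) (fun j => - e * b j)
    (real_derivative (fun j => e * a j) (fun j => - e * b j) f) z =
  4 * \sum_j \sum_k (b k * a j) * db k (d j f) z.
Proof.
move=> ee sf Uz; rewrite !real_derivative2 // -big_split /=.
transitivity (\sum_k \sum_j 2 * (b k * a j * db k (d j f) z) +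
              \sum_k \sum_j 2 * (b j * a k * db j (d k f) z)).
  rewrite -big_split; apply: eq_bigr => k _ /=; rewrite -!big_split.
  apply: eq_bigr => j _ /=; rewrite (calc_comm cS k j sf Uz).
  move: (d k (d j f) z) (db k (db j f) z) (db k (d j f) z) (d k (db j f) z).
  move=> A B D E.
  transitivity (a k * a j * A + a k * b j * E + b k * a j * D + b k * b j * B +
    (e * e) * (a k * a j * A - a k * b j * E - b k * a j * D + b k * b j * B)).
    ring.
  rewrite ee; ring.
rewrite [X in _ + X = _](_ : _ = \sum_k \sum_j 2 * (b k * a j * db k (d j f) z)).
  rewrite exchange_big -big_split mulr_sumr; apply: eq_bigr => j _ /=.
  rewrite -big_split mulr_sumr; apply: eq_bigr => k _ /=; ring.
by rewrite exchange_big.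
Qed.

End WirtingerSquares.

Section GramBounds.
Context {C : numClosedFieldType} (n : nat).
Variable g : 'M[C]_n.
Hypothesis gh : g^t* = g.
Hypothesis gpos : forall v : 'rV[C]_n, v != 0 -> 0 < (v *m g *m v^t*) 0 0.

Lemma mxtrace_gram m p (A : 'M[C]_(m, p)) :
  \tr (A *m A^t*) = \sum_i \sum_j `|A i j| ^+ 2.
Proof.
apply: eq_bigr => i _; rewrite mxE; apply: eq_bigr => j _.
by rewrite !mxE normCK.
Qed.

(** The Cauchy-Schwarz inequality in each column of [A]. *)
Lemma norm_mulmx_row m (w : 'rV[C]_m) (A : 'M[C]_(m, n)) :
  \sum_j `|(w *m A) 0 j| ^+ 2 <= (\sum_a `|w 0 a| ^+ 2) * \tr (A^t* *m A).
Proof.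
have dotE (v : 'rV[C]_m) : \sum_a `|v 0 a| ^+ 2 = (v *m v^t*) 0 0.
  by rewrite mxE; apply: eq_bigr => a _; rewrite !mxE normCK.
rewrite /mxtrace mulr_sumr; apply: ler_sum => j _.
pose v := row j (A^t*).
have : `|dotmx w v| ^+ 2 <= dotmx w w * dotmx v v := (CauchySchwarz _ w v).1.
rewrite !dotmxE dotE; congr (_ <= _ * _).
  congr (`|_| ^+ 2); rewrite !mxE; apply: eq_bigr => a _.
  by rewrite !mxE conjCK.
by rewrite !mxE; apply: eq_bigr => a _; rewrite !mxE conjCK.
Qed.

(** The rows of [S] are the directions of the squares into which the Laplacian
    decomposes; the bounds make that decomposition uniformly elliptic where the
    traces of [g] and of its inverse are bounded. *)
Lemma gram_bounds : exists S : 'M[C]_n,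
  [/\ invmx g = S^t* *m S,
      forall y : 'rV[C]_n,
        \sum_j `|y 0 j| ^+ 2 <= \tr g * \sum_a `|(y *m S^t*) 0 a| ^+ 2 &
      \sum_a \sum_j `|S a j| ^+ 2 = \tr (invmx g)].
Proof.
have [T uT gT] := posdef_factor gh gpos.
have gS : invmx g = (invmx T)^t* *m invmx T.
  by rewrite gT invmx_mul ?ctr_unit // ctr_inv.
exists (invmx T); split=> // [y|].
  have := norm_mulmx_row (y *m (invmx T)^t*) (T^t*).
  rewrite ctrK -gT -mulmxA -(ctr_mul T) mulmxV // trmx1 map_mx1 mulmx1 => H.
  by rewrite [X in _ <= X]mulrC.
by rewrite gS mxtrace_mulC mxtrace_gram.
Qed.

End GramBounds.

Section MetricLaplacian.
Context {R : realType} {d : nat}.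
Local Notation C := R[i].
Local Notation V := (cspace R d).

Lemma ReD (a b : C) : complex.Re (a + b) = complex.Re a + complex.Re b.
Proof. by case: a b => [? ?] []. Qed.

Lemma Re_sum (I : Type) (s : seq I) (F : I -> C) :
  complex.Re (\sum_(i <- s) F i) = \sum_(i <- s) complex.Re (F i).
Proof. exact: (big_morph (@complex.Re R) ReD). Qed.

Definition real_vector (s : 'I_d -> C) : V :=
  (\row_j complex.Re (s j), \row_j complex.Im (s j)).

Lemma sum_directions (v : V) :
  v = \sum_j ((v.1 0 j) *: dir_re j + (v.2 0 j) *: dir_im j).
Proof.
have fstS (F : 'I_d -> V) : (\sum_j F j).1 = \sum_j (F j).1.
  exact: (big_morph (fun x : V => x.1)).
have sndS (F : 'I_d -> V) : (\sum_j F j).2 = \sum_j (F j).2.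
  exact: (big_morph (fun x : V => x.2)).
rewrite [RHS]surjective_pairing fstS sndS [LHS]surjective_pairing; congr (_, _).
  rewrite [LHS]row_sum_delta; apply: eq_bigr => j _.
  by rewrite /= scaler0 addr0.
rewrite [LHS]row_sum_delta; apply: eq_bigr => j _.
by rewrite /= scaler0 add0r.
Qed.

Section Directions.
Variable U : set V.
Hypothesis oU : open U.
Implicit Types f : V -> C.
Let cS := wirtinger_calculus_smooth oU.

Lemma cderive_sum_dir (I : Type) (s : seq I) (v : I -> V) f z :
  smooth U f -> U z ->
  cderive (\sum_(i <- s) v i) f z = \sum_(i <- s) cderive (v i) f z.
Proof.
move=> sf Uz; elim: s => [|i s IH].
  by rewrite !big_nil /cderive !derive0.
by rewrite !big_cons (cderive_dirD oU _ _ sf Uz) IH.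
Qed.

Lemma half_real (F : numFieldType) (e a b x y : F) : e * e = -1 ->
  (a + e * b) * ((x - e * y) / 2) + (a - e * b) * ((x + e * y) / 2) = a * x + b * y.
Proof.
move=> ee; transitivity (a * x - (e * e) * (b * y)); first by field.
by rewrite ee; ring.
Qed.

Lemma imaginary_sqr : 'i%C * 'i%C = -1 :> C.
Proof. by rewrite -expr2 sqr_i. Qed.

Lemma cderive_real_vector (s : 'I_d -> C) f z : smooth U f -> U z ->
  cderive (real_vector s) f z =
  real_derivative (@wirt R d) (@wirtbar R d) s (fun j => Num.conj (s j)) f z.
Proof.
move=> sf Uz; rewrite [X in cderive X](sum_directions (real_vector s)).
rewrite (cderive_sum_dir _ _ sf Uz); apply: eq_bigr => j _.
rewrite (cderive_dirD oU _ _ sf Uz) !(cderive_dirZ oU _ _ sf Uz) !mxE.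
rewrite /wirt /wirtbar -(half_real _ _ _ _ imaginary_sqr).
congr (_ * _ + _ * _); first exact: esym (complexE _).
case: (s j) => a b; apply/eqP; rewrite eq_complex /=.
by apply/andP; split; apply/eqP; ring.
Qed.

Lemma cderive2_real_vector (s : 'I_d -> C) f z : smooth U f -> U z ->
  cderive (real_vector s) (cderive (real_vector s) f) z =
  real_derivative (@wirt R d) (@wirtbar R d) s (fun j => Num.conj (s j))
    (real_derivative (@wirt R d) (@wirtbar R d) s (fun j => Num.conj (s j)) f) z.
Proof.
move=> sf Uz; have sc := smooth_cderive (real_vector s) sf.
rewrite (cderive_real_vector s sc Uz); apply: eq_bigr => j _.
set F := cderive _ f; set G := real_derivative _ _ _ _ f.
have FG y : U y -> F y = G y by exact: cderive_real_vector.
have E1 := der_ext (calc_der cS j) FG Uz.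
have E2 := der_ext (calc_derbar cS j) FG Uz.
exact: (f_equal2 (fun x y => s j * x + Num.conj (s j) * y) E1 E2).
Qed.

Lemma sum_squares_real_vector (s : 'I_d -> C) f z : smooth U f -> U z ->
  4 * \sum_j \sum_k (Num.conj (s k) * s j) * wirtbar k (wirt j f) z =
  cderive (real_vector s) (cderive (real_vector s) f) z +
  cderive (real_vector (fun j => 'i%C * s j))
    (cderive (real_vector (fun j => 'i%C * s j)) f) z.
Proof.
move=> sf Uz; rewrite !cderive2_real_vector //.
rewrite -(sum_squares cS s _ imaginary_sqr sf Uz); congr (_ + _).
suff -> : (fun j => Num.conj ('i%C * s j)) = (fun j => - 'i%C * Num.conj (s j)) by [].
by apply/funext => j; rewrite rmorphM /= conj_imaginary.
Qed.

End Directions.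

Lemma sqr_norm_Re_Im (x : C) :
  `|x| ^+ 2 = (complex.Re x ^+ 2 + complex.Im x ^+ 2)%:C.
Proof. by rewrite add_Re2_Im2. Qed.

Lemma sqnorm_real_vector (s : 'I_d -> C) :
  (sqnorm (real_vector s))%:C = \sum_j `|s j| ^+ 2.
Proof.
rewrite /sqnorm /dot -big_split raddf_sum; apply: eq_bigr => j _.
by rewrite sqr_norm_Re_Im !mxE -!expr2.
Qed.

Lemma sqr_dot_real_vector (y s : 'I_d -> C) :
  (dot (real_vector y) (real_vector s) ^+ 2 +
   dot (real_vector y) (real_vector (fun j => 'i%C * s j)) ^+ 2)%:C =
  `|\sum_j y j * Num.conj (s j)| ^+ 2.
Proof.
rewrite sqr_norm_Re_Im; congr (_ ^+ 2 + _ ^+ 2)%:C.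
  rewrite Re_sum /dot -big_split; apply: eq_bigr => j _; rewrite !mxE.
  by case: (y j) (s j) => [a b] [a' b'] /=; ring.
have -> : complex.Im (\sum_j y j * Num.conj (s j)) =
    \sum_j complex.Im (y j * Num.conj (s j)).
  by apply: (big_morph (@complex.Im R)) => // [[? ?] []].
rewrite /dot -big_split; apply: eq_bigr => j _; rewrite !mxE.
by case: (y j) (s j) => [a b] [a' b'] /=; ring.
Qed.

(** The contraction of the complex Hessian with the inverse of a positive
    Hermitian matrix [g] is a sum of squares of real derivatives, in directions
    whose Gram matrix is bounded in terms of [g]. *)
Lemma metric_directions (g : 'M[C]_d) : g^t* = g ->
  (forall v : 'rV[C]_d, v != 0 -> 0 < (v *m g *m v^t*) 0 0) ->
  exists (I : finType) (xi : I -> V),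
  [/\ forall (U : set V) (f : V -> C) z, open U -> smooth U f -> U z ->
        \sum_a 'D_(xi a) ('D_(xi a) (fun y => complex.Re (f y))) z =
        complex.Re (4 * \sum_j \sum_k invmx g k j * wirtbar k (wirt j f) z),
      forall y : V, sqnorm y <=
        complex.Re (\tr g) * \sum_a dot y (xi a) ^+ 2 &
      \sum_a sqnorm (xi a) = 2 * complex.Re (\tr (invmx g))].
Proof.
move=> gh gpos; have [S [gS S1 S2]] := gram_bounds gh gpos.
pose xi (p : 'I_d + 'I_d) : V := match p with
  | inl a => real_vector (S a) | inr a => real_vector (fun j => 'i%C * S a j) end.
exists ('I_d + 'I_d)%type, xi; split.
- move=> U f z oU sf Uz; rewrite big_sumType /=.
  have -> : 4 * (\sum_j \sum_k invmx g k j * wirtbar k (wirt j f) z) =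
      \sum_a 4 * \sum_j \sum_k (Num.conj (S a k) * S a j) * wirtbar k (wirt j f) z.
    rewrite -mulr_sumr; congr (_ * _).
    rewrite [RHS]exchange_big; apply: eq_bigr => j _.
    rewrite [RHS]exchange_big; apply: eq_bigr => k _.
    by rewrite (gram_entry _ _ gS) mulr_suml.
  rewrite Re_sum -big_split; apply: eq_bigr => a _.
  by rewrite (sum_squares_real_vector oU (S a) sf Uz) ReD.
- move=> y; pose yc : 'rV[C]_d := \row_j (y.1 0 j +i* y.2 0 j).
  have yE : y = real_vector (yc 0).
    rewrite [LHS]surjective_pairing; congr (_, _); apply/rowP => j;
      by rewrite !mxE.
  have := S1 yc; rewrite -sqnorm_real_vector -yE.
  have -> : \sum_a `|(yc *m S^t*) 0 a| ^+ 2 = (\sum_a dot y (xi a) ^+ 2)%:C.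
    rewrite big_sumType /= -big_split raddf_sum; apply: eq_bigr => a _ /=.
    rewrite yE sqr_dot_real_vector; congr (`|_| ^+ 2); rewrite mxE.
    by apply: eq_bigr => j _; rewrite !mxE.
  have trg : (complex.Re (\tr g))%:C = \tr g.
    apply: RRe_real; apply/CrealP; rewrite -mxtrace_ctr gh //.
  by rewrite -trg -rmorphM /= lecR.
- have trg : (complex.Re (\tr (invmx g)))%:C = \tr (invmx g).
    by apply: RRe_real; apply/CrealP; rewrite -mxtrace_ctr ctr_inv gh.
  apply: complexI; rewrite rmorphM /= trg -S2 big_sumType /= rmorphD /= !raddf_sum /=.
  rewrite rmorph_nat mulr_natl mulr2n; congr (_ + _); apply: eq_bigr => a _.
    exact: sqnorm_real_vector.
  rewrite sqnorm_real_vector; apply: eq_bigr => j _.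
  rewrite normrM (_ : `|'i%C| = 1 :> C) ?mul1r //.
  by rewrite normc_def /= expr0n expr1n add0r sqrtr1.
Qed.

End MetricLaplacian.

Section MetricMaximumPrinciple.
Context {R : realType} {d : nat}.
Local Notation C := R[i].
Local Notation V := (cspace R d).
Variables (U : set V) (g : V -> 'M[C]_d) (f : V -> C) (M : R).
Hypothesis oU : open U.
Hypothesis sg : msmooth (smooth U) g.
Hypothesis gh : forall z, U z -> (g z)^t* = g z.
Hypothesis gpos : forall z, U z ->
  forall v : 'rV[C]_d, v != 0 -> 0 < (v *m g z *m v^t*) 0 0.
Hypothesis sf : smooth U f.

Let laplacian z := \sum_j \sum_k invmx (g z) k j * wirtbar k (wirt j f) z.

Lemma smooth_re_continuous (F : V -> C) z : smooth U F -> U z ->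
  {for z, continuous (fun y => complex.Re (F y))}.
Proof. by move=> sF Uz; have [[cF _] _] := sF 0%N; exact: cF. Qed.

(** Near [p] the traces of [g] and of its inverse, hence the ellipticity
    constants of [metric_directions], are bounded by continuity. *)
Lemma metric_strong_maximum p :
  (forall z, U z -> 0 <= laplacian z) ->
  (forall z, U z -> complex.Re (f z) <= M) ->
  U p -> complex.Re (f p) = M -> \forall q \near p, complex.Re (f q) = M.
Proof.
move=> L0 fM Up fp; have aS := smooth_smooth_algebra oU.
have ug z : U z -> g z \in unitmx by move=> Uz; exact: posdef_unit (gh Uz) (gpos Uz).
pose t1 z := complex.Re (\tr (g z)); pose t2 z := complex.Re (\tr (invmx (g z))).
have c1 : {for p, continuous t1}.
  exact: (smooth_re_continuous (smooth_mxtrace aS sg)).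
have c2 : {for p, continuous t2}.
  exact: (smooth_re_continuous (smooth_mxtrace aS (msmooth_inv aS ug sg))).
have [e1 e10 h1] := continuous_for_dist c1 ltr01.
have [e2 e20 h2] := continuous_for_dist c2 ltr01.
pose Lam := `|t1 p| + 2 * `|t2 p| + 2.
have Lam0 : 0 < Lam by rewrite ltr_wpDl // addr_ge0 // mulr_ge0.
have bound1 y : `|y - p| < e1 -> t1 y <= Lam.
  move=> /h1; rewrite ltr_norml => /andP[_]; rewrite ltrBlDr => /ltW/le_trans; apply.
  have := ler_norm (t1 p); have := normr_ge0 (t2 p); rewrite /Lam; lra.
have bound2 y : `|y - p| < e2 -> 2 * t2 y <= Lam.
  move=> /h2; rewrite ltr_norml => /andP[_] ?.
  have := ler_norm (t2 p); have := normr_ge0 (t1 p); rewrite /Lam; lra.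
pose U' := U `&` (ball p e1 `&` ball p e2).
have oU' : open U' by apply: openI => //; apply: openI; exact: ball_open.
have U'U : U' `<=` U by move=> y [].
have sf' : Ck 2 U' (fun y => complex.Re (f y)) by apply: Ck_sub U'U _; have [] := sf 2%N.
apply: (@max_locally_constant R d U' _ M Lam) => //.
- by move=> z /U'U; exact: fM.
- move=> z [Uz []]; rewrite -ball_normE /= (distrC p) => z1 z2.
  have [I [xi [X1 X2 X3]]] := metric_directions (gh Uz) (gpos Uz).
  exists I, xi; split.
  + rewrite (X1 U) // ; have := L0 z Uz; rewrite lecE /= => /andP[_ Lz].
    have -> : complex.Re (4 * laplacian z) = 4 * complex.Re (laplacian z).
      by rewrite mulr_natl [in RHS]mulr_natl raddfMn.
    by rewrite mulr_ge0.
  + move=> y; apply: le_trans (X2 y) _; rewrite ler_wpM2r //; last exact: bound1.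
    by apply: sumr_ge0 => a _; exact: sqr_ge0.
  + by rewrite X3; exact: bound2.
- by split=> //; split; apply: ballxx.
Qed.

Lemma metric_laplacian_cst z : (forall y, U y -> complex.Re (f y) = M) -> U z ->
  0 <= laplacian z -> laplacian z = 0.
Proof.
move=> fM Uz; have [I [xi [X1 _ _]]] := metric_directions (gh Uz) (gpos Uz).
have := X1 U f z oU sf Uz.
have nearM y : U y -> {near y, (fun y => complex.Re (f y)) =1 cst M}.
  by move=> Uy; near=> x; apply: fM; near: x; exact: open_near.
have D0 v y : U y -> 'D_v (fun y => complex.Re (f y)) y = 0.
  by move=> Uy; rewrite (near_eq_derive v (nearM y Uy)) derive_cst.
have DD0 v : 'D_v ('D_v (fun y => complex.Re (f y))) z = 0.
  rewrite (near_eq_derive (g := cst 0)) ?derive_cst //.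
  by near=> x; apply: D0; near: x; exact: open_near.
rewrite big1 // => E; rewrite lecE => /andP[/eqP Im0 _].
apply/eqP; rewrite eq_complex Im0 eqxx andbT; apply/eqP.
move: E; have -> : complex.Re (4 * laplacian z) = 4 * complex.Re (laplacian z).
  by rewrite mulr_natl [in RHS]mulr_natl raddfMn.
by move=> /esym/eqP; rewrite mulf_eq0 pnatr_eq0 /= => /eqP.
Unshelve. all: by end_near. Qed.

End MetricMaximumPrinciple.

(** * Invariance of the norm of the Higgs field *)

Section NormInvariance.
Context {C : numClosedFieldType} {n r : nat}.
Local Notation adj H X := (invmx H *m X^t* *m H).

Lemma pairing_frame_invariant (T T' H : 'M[C]_r) (A B : 'M[C]_r) :
  T *m T' = 1%:M -> H \in unitmx ->
  \tr ((T *m A *m T') *m adj H (T *m B *m T')) =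
  \tr (A *m adj (T^t* *m H *m T) B).
Proof.
move=> TT' uH; have [uT uT'] := mulmx1_unit TT'.
have T'T : T' *m T = 1%:M by exact: mulmx1C.
have iT : invmx T = T' by rewrite -[LHS]mulmx1 -TT' mulKmx.
have iTc : invmx (T^t*) = T'^t* by rewrite -ctr_inv iT.
have iH : invmx (T^t* *m H *m T) = T' *m invmx H *m T'^t*.
  by rewrite !invmx_mul ?unitmx_mul ?ctr_unit ?uT // iT iTc mulmxA.
have -> : adj H (T *m B *m T') = T *m adj (T^t* *m H *m T) B *m T'.
  rewrite iH !ctr_mul !mulmxA TT' mul1mx -!mulmxA TT' mulmx1 //.
move: (adj _ B) => D; rewrite -!mulmxA (mulmxA T') T'T mul1mx mxtrace_mulC.
by rewrite -!mulmxA T'T mulmx1.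
Qed.

Lemma norm_chart_invariant (J g : 'M[C]_n) (H : 'M[C]_r) (A : 'I_n -> 'M[C]_r) :
  J \in unitmx -> g \in unitmx ->
  let A' j := \sum_k J j k *: A k in
  \tr (invmx (J *m g *m J^t*) *m \matrix_(l, m) \tr (A' l *m adj H (A' m))) =
  \tr (invmx g *m \matrix_(l, m) \tr (A l *m adj H (A m))).
Proof.
move=> uJ ug A'.
have -> : \matrix_(l, m) \tr (A' l *m adj H (A' m)) =
    J *m (\matrix_(l, m) \tr (A l *m adj H (A m))) *m J^t*.
  apply/matrixP => l m; rewrite !mxE adj_sum mulmx_sumr raddf_sum.
  apply: eq_bigr => p _; rewrite !mxE -scalemxAr /= mxtraceZ mulrC; congr (_ * _).
  rewrite mulmx_suml raddf_sum; apply: eq_bigr => k _.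
  by rewrite !mxE -scalemxAl /= mxtraceZ.
have uJc : J^t* \in unitmx by rewrite ctr_unit.
rewrite !invmx_mul ?unitmx_mul ?uJ ?ug // -!mulmxA (mulKmx uJ) mxtrace_mulC.
by rewrite -!mulmxA mulmxV // mulmx1.
Qed.

Lemma higgs_norm_frame (V : Type) (g : V -> 'M[C]_n) (H1 H2 : V -> 'M[C]_r)
    (A1 A2 : 'I_n -> V -> 'M[C]_r) (T T' : 'M[C]_r) x :
  T *m T' = 1%:M -> H1 x \in unitmx -> H2 x = T^t* *m H1 x *m T ->
  (forall j, A1 j x = T *m A2 j x *m T') ->
  higgs_norm g H1 A1 x = higgs_norm g H2 A2 x.
Proof.
move=> TT' uH HE AE; rewrite /higgs_norm; congr (\tr (_ *m _)).
apply/matrixP => l m; rewrite !mxE /higgs_adjoint !AE HE.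
exact: pairing_frame_invariant.
Qed.

Lemma higgs_norm_chart (V : Type) (g1 g2 : V -> 'M[C]_n) (H : V -> 'M[C]_r)
    (A1 A2 : 'I_n -> V -> 'M[C]_r) (J : 'M[C]_n) x :
  J \in unitmx -> g2 x \in unitmx -> g1 x = J *m g2 x *m J^t* ->
  (forall j, A1 j x = \sum_k J j k *: A2 k x) ->
  higgs_norm g1 H A1 x = higgs_norm g2 H A2 x.
Proof.
move=> uJ ug gE AE; rewrite /higgs_norm /inverse_metric gE.
apply: etrans (norm_chart_invariant (H x) (fun k => A2 k x) uJ ug).
congr (\tr (_ *m _)); apply/matrixP => l m.
by rewrite !mxE /higgs_adjoint !AE.
Qed.

End NormInvariance.

Section LambdaContraction.
Context {R : realType} {d : nat} {X : complexManifold R d}.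
Local Notation C := R[i].

Lemma metric_unit (omega : hermitianMetric X) i x : cdom i x ->
  gmx omega i x \in unitmx.
Proof.
by move=> ix; apply: posdef_unit (gmx_hermitian omega ix) (gmx_posdef omega ix).
Qed.

Lemma metric_trace (g a : 'M[C]_d) (e : C) : g^t* = g -> g \in unitmx ->
  form11_dot g a (e *: g) = Num.conj e * \tr (invmx g *m a).
Proof.
move=> gh ug; rewrite /form11_dot linearZ /= map_mxZ gh -scalemxAr mxtraceZ.
by rewrite mulmxKV.
Qed.

(** The fundamental form is ['i] times [g], and the inner product is antilinear
    in it; hence the factor [- 'i]. *)
Lemma Lambda_contraction r (omega : hermitianMetric X) i x
    (F : 'I_d -> 'I_d -> 'M[C]_r) : cdom i x ->
  Lambda omega i x F =
  - 'i%C *: \sum_j \sum_k invmx (gmx omega i x) k j *: F j k.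
Proof.
move=> ix; apply/matrixP => p q.
rewrite !mxE (metric_trace _ _ (gmx_hermitian omega ix) (metric_unit omega ix)).
rewrite conj_imaginary; congr (_ * _); rewrite summxE /mxtrace.
under eq_bigr do rewrite mxE; rewrite exchange_big; apply: eq_bigr => j _.
by rewrite summxE; apply: eq_bigr => k _; rewrite !mxE.
Qed.

End LambdaContraction.

(** * From local to global *)

Lemma near_eq_continuous (R : realType) (T : topologicalType) (f g : T -> R) x :
  (\forall y \near x, f y = g y) -> {for x, continuous g} -> {for x, continuous f}.
Proof.
move=> fg cg; rewrite /prop_for /continuous_at (nbhs_singleton fg).
by apply: cvg_trans cg; apply: near_eq_cvg; apply: filterS fg => y ->.
Qed.

Section Global.
Context {R : realType} {d : nat} {X : complexManifold R d}.
Local Notation C := R[i].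
Local Notation V := (cspace R d).

Section Metrics.
Variables (omega : hermitianMetric X) (r : nat) (E : holBundle X r).
Variables (theta : higgsField E) (h : hermitianStructure E).

Lemma hmx_posdef_row (a : frame E) (x : X) (v : 'rV[C]_r) : bdom a x -> v != 0 ->
  0 < (v *m hmx h a x *m v^t*) 0 0.
Proof.
move=> ax v0; have v0' : v^t* != 0.
  by apply: contraNneq v0 => v0'; rewrite -(ctrK v) v0' trmx0 map_mx0.
by have := hmx_posdef h ax v0'; rewrite ctrK.
Qed.

Lemma hmx_unit (a : frame E) (x : X) : bdom a x -> hmx h a x \in unitmx.
Proof.
move=> ax; apply: posdef_unit (hmx_hermitian h ax) _ => v; exact: hmx_posdef_row.
Qed.

Definition local_norm (i : chart X) (a : frame E) (x : X) : C :=
  higgs_norm (gmx omega i) (hmx h a) (fun j => hgmx theta i j a) x.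

Lemma jac_unit (i i' : chart X) (x : X) : cdom i x -> cdom i' x -> jac i i' x \in unitmx.
Proof.
move=> ix i'x; have := metric_unit omega ix.
by rewrite (gmx_compat omega ix i'x) !unitmx_mul => /andP[/andP[]].
Qed.

(** Transition matrices of frames conjugate the components, and Jacobians
    transform their form index; both cancel in the contraction, so the local
    norms define a function on the manifold. *)
Lemma local_norm_invariant (i i' : chart X) (a b : frame E) (x : X) :
  cdom i x -> cdom i' x -> bdom a x -> bdom b x ->
  local_norm i a x = local_norm i' b x.
Proof.
move=> ix i'x ax bx.
transitivity (local_norm i b x).
  have TT' : btrans a b x *m btrans b a x = 1%:M.
    by rewrite (btrans_cocycle ax bx ax) btrans_id.
  apply: (higgs_norm_frame _ TT' (hmx_unit ax) (hmx_compat h ax bx)) => j.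
  exact: hgmx_frame.
apply: (higgs_norm_chart _ (jac_unit ix i'x) (metric_unit omega i'x)).
  exact: gmx_compat.
by move=> j; exact: hgmx_chart.
Qed.

End Metrics.

Section OneChart.
Variables (omega : hermitianMetric X) (r : nat) (E : holBundle X r).
Variables (theta : higgsField E) (h : hermitianStructure E).
Variables (i : chart X) (a : frame E).

Definition chart_domain : set V := cmap i @` (cdom i `&` bdom a).
Local Notation U := chart_domain.
Local Notation gV := (gmx omega i \o cinv i).
Local Notation HV := (hmx h a \o cinv i).
Local Notation AV := (fun j => hgmx theta i j a \o cinv i).

Lemma chart_domainP z : U z ->
  [/\ cdom i (cinv i z), bdom a (cinv i z) & cmap i (cinv i z) = z].
Proof. by move=> [x [ix ax] <-]; rewrite (cmapK (mem_set ix)). Qed.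

Lemma chart_domain_open : open U.
Proof.
rewrite openE => z Uz; have [iz az zz] := chart_domainP Uz.
have imz : (cmap i @` cdom i) z by exists (cinv i z).
have n1 : \forall y \near z, (cmap i @` cdom i) y := open_near (@cimg_open _ _ X i) imz.
have n2 : \forall y \near z, bdom a (cinv i y).
  exact: (cinv_continuous imz (open_nbhs_nbhs (conj (@bdom_open _ _ X r E a) az))).
apply: filterS2 n1 n2.
move=> y [x ix xy] ay; exists x => //; split=> //.
by rewrite -(cmapK (mem_set ix)) xy.
Qed.
Let oU := chart_domain_open.
Let cS := wirtinger_calculus_smooth oU.

Lemma smooth_sub (U1 U2 : set V) f : U2 `<=` U1 -> smooth U1 f -> smooth U2 f.
Proof. by move=> s sf k; have [? ?] := sf k; split; exact: Ck_sub s _. Qed.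

Lemma metric_smooth : msmooth (smooth U) gV.
Proof.
move=> j k; apply: smooth_sub (gmx_smooth omega i j k i).
by move=> z [x [ix ax] <-]; exists x.
Qed.

Lemma gram_smooth : msmooth (smooth U) HV.
Proof. by move=> p q; exact: (hmx_smooth h a p q i). Qed.

Lemma chart_sub : U `<=` cmap i @` (cdom i `&` (cdom i `&` bdom a)).
Proof. by move=> z [x [ix ax] <-]; exists x. Qed.

Lemma higgs_smooth j : msmooth (smooth U) (AV j).
Proof.
move=> p q; have [sA _] := hgmx_holomorphic theta i j a p q i.
by apply: smooth_sub sA; exact: chart_sub.
Qed.

Lemma higgs_holomorphic j k z : U z -> mder (wirtbar k) (AV j) z = 0.
Proof.
move=> Uz; apply/matrixP => p q; rewrite !mxE.
have [_ hol] := hgmx_holomorphic theta i j a p q i.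
exact: (hol z (chart_sub Uz) k).
Qed.

Lemma metric_kaehler : kaehler omega -> forall j k l z, U z ->
  wirt j (fun y => gV y k l) z = wirt k (fun y => gV y j l) z /\
  wirtbar j (fun y => gV y k l) z = wirtbar l (fun y => gV y k j) z.
Proof.
move=> ka j k l z Uz; have [iz az zz] := chart_domainP Uz.
have [] := ka i _ iz j k l; rewrite /dz /dzbar zz.
have fE D k' l' : derivation U (smooth U) D ->
    D ((fun y => fundamental_form omega i y k' l') \o cinv i) z =
    'i%C * D (fun y => gV y k' l') z.
  move=> dD.
  rewrite -(derZ (calc_alg cS) 'i%C dD (metric_smooth k' l') Uz).
  by apply: (der_ext dD) => // y _; rewrite /= mxE.
have i0 : 'i%C != 0 :> C by rewrite eq_complex /= oner_eq0 andbF.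
rewrite !(fE _ _ _ (calc_der cS _)) !(fE _ _ _ (calc_derbar cS _)).
by move=> /(mulfI i0) ? /(mulfI i0).
Qed.

Lemma chern_curvatureE n (K : X -> 'M[C]_n) j k z : U z ->
  chern_curvature i K j k (cinv i z) =
  - mder (wirtbar k) (chern_connection (@wirt R d) (K \o cinv i) j) z.
Proof.
move=> Uz; have [iz az zz] := chart_domainP Uz.
pose F y := invmx (K y) *m dzM i j K y.
have -> : chern_curvature i K j k (cinv i z) =
  - mder (wirtbar k) (F \o cinv i) (cmap i (cinv i z)) by [].
have FP y : U y -> (F \o cinv i) y = chern_connection (@wirt R d) (K \o cinv i) j y.
  move=> Uy; have [iy ay yy] := chart_domainP Uy.
  apply: (f_equal (mulmx (invmx (K (cinv i y))))).
  by rewrite -[RHS]/(mder (wirt j) (K \o cinv i) y) -{2}yy.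
rewrite zz; exact: (f_equal -%R (mder_ext (calc_derbar cS k) FP Uz)).
Qed.

Lemma metric_ricci : ricci_flat omega -> forall j k z, U z ->
  \tr (mder (wirtbar k) (metric_connection (@wirt R d) gV j) z) = 0.
Proof.
move=> ri j k z Uz; have [iz az zz] := chart_domainP Uz.
have i0 : 'i%C != 0 :> C by rewrite eq_complex /= oner_eq0 andbF.
have := ri i _ iz j k; rewrite chern_curvatureE // => /eqP.
rewrite mulf_eq0 (negPf i0) /= raddfN oppr_eq0 /= => /eqP E0.
have ug z' : U z' -> gV z' \in unitmx.
  by move=> /chart_domainP[iz' _ _]; exact: metric_unit.
have sg := metric_smooth; have aS := calc_alg cS.
have dk := calc_derbar cS k; have dj := calc_der cS j.
have sgT : msmooth (smooth U) (fun y => (gV y)^T) := msmooth_tr aS sg.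
have ugT z' : U z' -> (gV z')^T \in unitmx by move=> /ug; rewrite unitmx_tr.
have sQ : msmooth (smooth U) (metric_connection (@wirt R d) gV j).
  exact: (msmoothM aS (msmooth_mder aS dj sg) (msmooth_inv aS ug sg)).
have sP : msmooth (smooth U)
    (chern_connection (@wirt R d) (tangent_gram omega i \o cinv i) j).
  exact: (msmoothM aS (msmooth_inv aS ugT sgT) (msmooth_mder aS dj sgT)).
rewrite -E0 -(der_mxtrace aS dk sQ Uz) -(der_mxtrace aS dk sP Uz).
apply: (der_ext dk) => // y _.
have mT : mder (wirt j) (tangent_gram omega i \o cinv i) y =
    (mder (wirt j) gV y)^T.
  by apply/matrixP => p q; rewrite !mxE; congr (wirt j _ y); apply/funext => y';
    rewrite /= mxE.
rewrite /metric_connection /chern_connection mT -mxtrace_tr trmx_mul.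
by rewrite /inverse_metric trmx_inv.
Qed.

Lemma scalar_of_imaginary (e c : C) (S : 'M[C]_r) : e * e = -1 ->
  - e *: S = (c * e)%:M -> S = (- c)%:M.
Proof.
move=> ee /(congr1 ( *:%R e)).
by rewrite scalerA mulrN ee opprK scale1r scale_scalar_mx mulrCA ee mulrN1.
Qed.

Hypothesis omega_kaehler : kaehler omega.
Hypothesis omega_ricci_flat : ricci_flat omega.
Variable c : R.
Hypothesis ymh : forall x, cdom i x -> bdom a x ->
  Lambda omega i x (fun j k =>
    let A := hgmx theta i j a x in
    let B := adjoint (hmx h a x) (hgmx theta i k a x) in
    chern_curvature i (hmx h a) j k x + (A *m B - B *m A))
  = (c%:C * 'i%C)%:M.

Lemma chart_yang_mills_higgs z : U z ->
  \sum_j \sum_k inverse_metric gV z k j *: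
    (- mder (wirtbar k) (chern_connection (@wirt R d) HV j) z +
      (AV j z *m higgs_adjoint HV AV k z - higgs_adjoint HV AV k z *m AV j z))
  = (- c%:C)%:M.
Proof.
move=> Uz; have [iz az zz] := chart_domainP Uz.
have := ymh iz az; rewrite Lambda_contraction // => E1.
have := scalar_of_imaginary imaginary_sqr E1; apply: etrans.
apply: eq_bigr => j _; apply: eq_bigr => k _.
by rewrite -(chern_curvatureE (hmx h a) j k Uz).
Qed.

Lemma chart_metric_hermitian z : U z -> (gV z)^t* = gV z.
Proof. by move=> /chart_domainP[iz _ _]; exact: gmx_hermitian. Qed.

Lemma chart_metric_posdef z : U z ->
  forall v : 'rV[C]_d, v != 0 -> 0 < (v *m gV z *m v^t*) 0 0.
Proof. by move=> /chart_domainP[iz _ _] v; exact: gmx_posdef. Qed.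

Lemma chart_metric_unit z : U z -> gV z \in unitmx.
Proof. by move=> /chart_domainP[iz _ _]; exact: metric_unit. Qed.

Lemma chart_gram_hermitian z : U z -> (HV z)^t* = HV z.
Proof. by move=> /chart_domainP[_ az _]; exact: hmx_hermitian. Qed.

Lemma chart_gram_posdef z : U z ->
  forall v : 'rV[C]_r, v != 0 -> 0 < (v *m HV z *m v^t*) 0 0.
Proof. by move=> /chart_domainP[_ az _] v; exact: hmx_posdef_row. Qed.

Lemma chart_gram_unit z : U z -> HV z \in unitmx.
Proof. by move=> /chart_domainP[_ az _]; exact: hmx_unit. Qed.

Lemma chart_higgs_commute j k z : U z -> AV j z *m AV k z = AV k z *m AV j z.
Proof. by move=> /chart_domainP[iz az _]; exact: hgmx_integrable. Qed.

Definition chart_norm : V -> C := higgs_norm gV HV AV.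

Lemma chart_norm_smooth : smooth U chart_norm.
Proof.
exact: (smooth_higgs_norm cS metric_smooth chart_metric_unit gram_smooth
  chart_gram_unit higgs_smooth).
Qed.

Lemma chart_norm_subharmonic z : U z ->
  0 <= \sum_j \sum_k invmx (gV z) k j * wirtbar k (wirt j chart_norm) z.
Proof.
exact: (higgs_norm_subharmonic cS metric_smooth chart_metric_hermitian
  chart_metric_unit gram_smooth chart_gram_hermitian chart_gram_unit higgs_smooth
  higgs_holomorphic chart_higgs_commute
  (fun j k l z Uz => (metric_kaehler omega_kaehler j k l Uz).1)
  (fun j k l z Uz => (metric_kaehler omega_kaehler j k l Uz).2)
  (metric_ricci omega_ricci_flat) chart_yang_mills_higgs
  chart_metric_posdef chart_gram_posdef).
Qed.

Lemma chart_norm_harmonic z : U z ->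
  \sum_j \sum_k invmx (gV z) k j * wirtbar k (wirt j chart_norm) z = 0 ->
  forall j k, AV j z *m higgs_adjoint HV AV k z - higgs_adjoint HV AV k z *m AV j z = 0.
Proof.
exact: (higgs_norm_harmonic cS metric_smooth chart_metric_hermitian
  chart_metric_unit gram_smooth chart_gram_hermitian chart_gram_unit higgs_smooth
  higgs_holomorphic chart_higgs_commute
  (fun j k l z Uz => (metric_kaehler omega_kaehler j k l Uz).1)
  (fun j k l z Uz => (metric_kaehler omega_kaehler j k l Uz).2)
  (metric_ricci omega_ricci_flat) chart_yang_mills_higgs
  chart_metric_posdef chart_gram_posdef).
Qed.

Local Notation norm_at x := (complex.Re (local_norm omega theta h i a x)).

Lemma chart_normE z : chart_norm z = local_norm omega theta h i a (cinv i z).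
Proof. by []. Qed.

Lemma chart_nbhs x (P : set V) : cdom i x -> bdom a x ->
  (\forall z \near cmap i x, P z) ->
  \forall y \near x, [/\ cdom i y, bdom a y & P (cmap i y)].
Proof.
move=> ix ax nP.
have n1 : \forall y \near x, cdom i y.
  exact: (open_nbhs_nbhs (conj (@cdom_open _ _ X i) ix)).
have n2 : \forall y \near x, bdom a y.
  exact: (open_nbhs_nbhs (conj (@bdom_open _ _ X r E a) ax)).
have n3 : \forall y \near x, P (cmap i y) := cmap_continuous ix nP.
by apply: filterS3 n1 n2 n3.
Qed.

Lemma norm_at_continuous x : cdom i x -> bdom a x ->
  {for x, continuous (fun y => norm_at y)}.
Proof.
move=> ix ax; have Ux : U (cmap i x) by exists x.
have cx := smooth_re_continuous chart_norm_smooth Ux.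
have cc : {for x, continuous (fun y => complex.Re (chart_norm (cmap i y)))}.
  exact: (continuous_comp (cmap_continuous ix) cx).
have nx : \forall y \near x, norm_at y = complex.Re (chart_norm (cmap i y)).
  have nT : \forall z \near cmap i x, [set: V] z by exact: filterT.
  apply: filterS (chart_nbhs ix ax nT) => y [iy ay _].
  by rewrite chart_normE (cmapK (mem_set iy)).
exact: near_eq_continuous nx cc.
Qed.

Lemma norm_at_max_near M x : (forall y, cdom i y -> bdom a y -> norm_at y <= M) ->
  cdom i x -> bdom a x -> norm_at x = M -> \forall y \near x, norm_at y = M.
Proof.
move=> uM ix ax xM; have Ux : U (cmap i x) by exists x.
have uM' z : U z -> complex.Re (chart_norm z) <= M.
  by move=> /chart_domainP[iz az _]; exact: uM.
have xM' : complex.Re (chart_norm (cmap i x)) = M.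
  by rewrite chart_normE (cmapK (mem_set ix)).
have nM := metric_strong_maximum oU metric_smooth chart_metric_hermitian
  chart_metric_posdef chart_norm_smooth chart_norm_subharmonic uM' Ux xM'.
apply: filterS (chart_nbhs ix ax nM) => y [iy ay].
by rewrite chart_normE (cmapK (mem_set iy)).
Qed.

Lemma norm_at_cst_commute M x : (forall y, cdom i y -> bdom a y -> norm_at y = M) ->
  cdom i x -> bdom a x -> forall j k,
  let A := hgmx theta i j a x in
  let B := adjoint (hmx h a x) (hgmx theta i k a x) in A *m B - B *m A = 0.
Proof.
move=> uM ix ax j k; have Ux : U (cmap i x) by exists x.
have uM' z : U z -> complex.Re (chart_norm z) = M.
  by move=> /chart_domainP[iz az _]; exact: uM.
have L0 := metric_laplacian_cst oU chart_metric_hermitian chart_metric_posdef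
  chart_norm_smooth uM' Ux (chart_norm_subharmonic Ux).
have := chart_norm_harmonic Ux L0 j k.
rewrite /higgs_adjoint /= (cmapK (mem_set ix)); exact.
Qed.

End OneChart.

(** The norm of the Higgs field attains its maximum on the compact manifold, the
    set where it does is open by the strong maximum principle, and the manifold
    is connected. *)
Lemma higgs_commute (omega : hermitianMetric X) (r : nat) (E : holBundle X r)
    (theta : higgsField E) (h : hermitianStructure E) (c : R) :
  compact [set: X] -> connected [set: X] ->
  kaehler omega -> ricci_flat omega ->
  (forall i (a : frame E) x, cdom i x -> bdom a x ->
    Lambda omega i x (fun j k =>
      let A := hgmx theta i j a x in
      let B := adjoint (hmx h a x) (hgmx theta i k a x) in
      chern_curvature i (hmx h a) j k x + (A *m B - B *m A))
    = (c%:C * 'i%C)%:M) ->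
  forall i (a : frame E) x, cdom i x -> bdom a x -> forall j k,
    let A := hgmx theta i j a x in
    let B := adjoint (hmx h a x) (hgmx theta i k a x) in A *m B - B *m A = 0.
Proof.
move=> cX conX ka ri ymh.
pose ci x := projT1 (cid (@cdom_cover _ _ X x)).
pose ca x := projT1 (cid (@bdom_cover _ _ X r E x)).
have ciP x : cdom (ci x) x := projT2 (cid (@cdom_cover _ _ X x)).
have caP x : bdom (ca x) x := projT2 (cid (@bdom_cover _ _ X r E x)).
pose u x := complex.Re (local_norm omega theta h (ci x) (ca x) x).
have uE i a x : cdom i x -> bdom a x ->
    u x = complex.Re (local_norm omega theta h i a x).
  move=> ix ax; rewrite /u.
  by rewrite (local_norm_invariant omega theta h (ciP x) ix (caP x) ax).
have near_u x (P : R -> Prop) :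
    (\forall y \near x, P (complex.Re (local_norm omega theta h (ci x) (ca x) y))) ->
    \forall y \near x, P (u y).
  move=> nP; have nT : \forall z \near cmap (ci x) x, [set: V] z by exact: filterT.
  apply: filterS2 nP (chart_nbhs (ciP x) (caP x) nT) => y Py [iy ay _].
  by rewrite (uE _ _ _ iy ay).
have cu : continuous u.
  move=> x P nP; apply: (near_u x P).
  have : {for x, continuous (fun y =>
      complex.Re (local_norm omega theta h (ci x) (ca x) y))}.
    exact: norm_at_continuous.
  by move=> /(_ P nP).
move=> i0 a0 x0 ix0 ax0.
have [m _ mmax] : exists2 m, m \in [set: X] & forall y, y \in [set: X] -> u y <= u m.
  apply: compact_EVT_max => //; first by exists x0.
  exact: continuous_subspaceT.
have [M [mM uM]] : exists M, u m = M /\ forall y, u y <= M.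
  have uM y : u y <= u m by apply: mmax; rewrite inE.
  exact: (ex_intro _ (u m) (conj erefl uM)).
have oK : open [set x | u x = M].
  rewrite openE => x /= xM; apply: (near_u x (fun t => t = M)).
  apply: (norm_at_max_near ka ri (ymh (ci x) (ca x)) _ (ciP x) (caP x)).
    by move=> y iy ay; rewrite -(uE _ _ _ iy ay).
  exact: xM.
have clK : closed [set x | u x = M].
  apply: (@closed_comp _ _ u [set t | t = M]); first by move=> x _; exact: cu.
  exact: closed_eq.
have KT : [set x | u x = M] = [set: X].
  apply: conX; first by exists m.
    by exists [set x | u x = M]; rewrite ?setTI.
  by exists [set x | u x = M]; rewrite ?setTI.
have nM y : cdom i0 y -> bdom a0 y ->
    complex.Re (local_norm omega theta h i0 a0 y) = M.
  move=> iy ay; have Ky : [set x | u x = M] y by rewrite KT.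
  exact: etrans (esym (uE _ _ _ iy ay)) Ky.
exact: (norm_at_cst_commute ka ri (ymh i0 a0) nM ix0 ax0).
Qed.

End Global.

Theorem theorem3p3 (R : realType) (d : nat) (X : complexManifold R d)
    (X_compact : compact [set: X]) (X_connected : connected [set: X])
    (c1_zero : c1_tangent_zero X)
    (omega : hermitianMetric X)
    (omega_kaehler : kaehler omega) (omega_ricci_flat : ricci_flat omega)
    (r : nat) (E : holBundle X r) (theta : higgsField E)
    (E_polystable : higgs_polystable omega theta)
    (h : hermitianStructure E)
    (h_ymh : yang_mills_higgs omega theta h) :
  yang_mills_higgs omega (higgs_zero E) h.
Proof.
have [c ymh] := h_ymh; exists c => i a x ix ax.
rewrite -(ymh i a x ix ax); apply: (f_equal (Lambda omega i x)).
apply/funext => j; apply/funext => k.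
have N0 := higgs_commute X_compact X_connected omega_kaehler omega_ricci_flat
  ymh ix ax j k.
apply: (f_equal (GRing.add _)); apply: etrans (esym N0).
by rewrite mul0mx mulmx0 subrr.
Qed.
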